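(* Every finite group all of whose abelian subgroups are cyclic is $2$-generated.
   Context: A finite group $G$ is $2$-generated if $d(G)\leq 2$, where $d(G)$ is the minimal cardinality of a generating set of $G$. *)

(* Defs.v *)
From mathcomp Require Import all_boot all_fingroup all_solvable.

Set Implicit Arguments.
Unset Strict Implicit.
Unset Printing Implicit Defensive.

(* Main.v *)
(* Every Sylow subgroup of G for an odd prime is cyclic, and commuting involutions of G are
   equal.  A counting argument shows that an involution of G is central modulo the odd core.
   Normal subgroups of odd order do not affect the property of being 2-generated, nor does the
   involution of a quaternion Sylow 2-subgroup, which is then central, so one is
   left with a group L with trivial odd core and a dihedral or Klein Sylow 2-subgroup D.  Unless
   L has a soluble minimal normal subgroup, an easy case, it has a simple normal subgroup M
   with trivial centralizer, all of whose involutions are conjugate.  Put T = D :&: M.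

   If no proper subgroup of M contains the centralizers of all involutions of T, one exhibits
   two elements of L whose span X contains T and the centralizer in M of one involution, and
   fuses all the involutions of T: then X contains M, and the generators are chosen so that it
   also contains L.  Otherwise M has a strongly embedded subgroup K.  Counting involutions in
   the cosets of K shows that T is a Klein group, that K = 'N_M(T) is maximal, and that K has a
   self-centralising subgroup of order 3; a conjugate of it outside K, together with the
   centralizer of an involution of T, generates M. *)

Require Import Defs.
From mathcomp Require Import all_boot all_fingroup all_solvable.
From mathcomp Require ssralg.

Set Implicit Arguments.
Unset Strict Implicit.
Unset Printing Implicit Defensive.
Import GroupScope.

(** * Transfer and cyclic Sylow subgroups *)

(** The cyclicity of abelian subgroups is lost modulo a central involution, since quaternion groups
    become dihedral; so the reductions carry two weaker conditions, [odd_cyclic] and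
    [commuting_involutions_eq], and only the first survives in a group [L] with dihedral Sylow
    2-subgroups. Typical insoluble examples are SL(2,p), with L = PSL(2,p); the strongly embedded
    case is modelled on A5 with K = A4. Neither characters nor a classification of groups with
    dihedral Sylow 2-subgroups is invoked. Cyclic odd Sylow subgroups replace them: a group of odd
    order is then soluble with cyclic Fitting subgroup, and an involution acting on it inverts a
    cyclic part and centralizes a complement, so that transfer and counting of involutions suffice.
    The odd cores of centralizers are not known to vanish, and two generators must also produce
    them. Hence a generator is often a product of commuting elements of coprime orders, both of
    which are powers of it. *)

Lemma commute_conjg (gT : finGroupType) (x y : gT) : commute x y -> x ^ y = x.
Proof. by move=> cxy; rewrite conjgE cxy mulKg. Qed.

(** Burnside's fusion argument: [P] and [P :^ x] are abelian Sylow subgroups containing [u ^ x], so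
    some [c] centralizing [u ^ x] carries the second to the first. Then [x * c] normalizes, hence
    centralizes, [P], and it acts on [u] as [x] does. *)
Lemma Sylow_conj_cent (gT : finGroupType) p (G P : {group gT}) u x :
    p.-Sylow(G) P -> abelian P -> 'N_G(P) \subset 'C(P) ->
  u \in P -> x \in G -> u ^ x \in P -> u ^ x = u.
Proof.
move=> sylP cPP sNC Pu Gx Pux; have [sPG _ _] := and3P sylP.
have sylC (Q : {group gT}) : p.-Sylow(G) Q -> u ^ x \in Q -> abelian Q ->
    p.-Sylow('C_G[u ^ x]) Q.
  move=> sylQ Qux cQQ; apply: (pHall_subl _ (subsetIl _ _) sylQ).
  by rewrite subsetI (pHall_sub sylQ) sub_cent1 (subsetP cQQ).
have [c /setIP[Gc /cent1P cc] def_P] :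
    exists2 c, c \in 'C_G[u ^ x] & P :=: (P :^ x) :^ c.
  apply: (Sylow_trans (P := (P :^ x)%G)); last exact: sylC.
  by apply: sylC; rewrite ?memJ_conjg ?abelianJ // pHallJ.
have /(subsetP sNC)/centP cPxc: x * c \in 'N_G(P).
  by rewrite inE groupM //=; apply/normP; rewrite conjsgM.
have uxc: u ^ (x * c) = u by apply/commute_conjg/commute_sym/cPxc.
by rewrite -[in RHS]uxc conjgM [RHS]commute_conjg //; apply: commute_sym.
Qed.

(** By the fusion lemma the transfer into [P] sends [g] in [P] to [g ^+ #|G : P|], an exponent prime
    to [#|P|]; so its kernel meets [P] trivially. *)
Lemma Burnside_normal_complement (gT : finGroupType) p (G P : {group gT}) :
    p.-Sylow(G) P -> 'N_G(P) \subset 'C(P) -> p^'.-Hall(G) 'O_p^'(G).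
Proof.
move=> sylP sNC; have [sPG pP _] := and3P sylP.
have cPP: abelian P.
  by apply: subset_trans sNC; rewrite subsetI sPG normG.
have abelA: abelian (idm P @* P) by rewrite morphim_idm.
pose V := transfer_morphism G abelA.
have PfA y: y \in P -> y \in idm P @* P by rewrite morphim_idm.
have Vexp g : g \in P -> V g = FiniteModule.fmod abelA (g ^+ #|G : P|).
  move=> Pg; have Gg := subsetP sPG _ Pg.
  have [X trX _] : exists2 X, is_transversal X (rcosets P G :* <[g]>) G & true.
    exists (transversal (rcosets P G :* <[g]>) G) => //.
    exact: (transversalP (rcosets_cycle_partition sPG Gg)).
  rewrite [V g](transfer_cycle_expansion sPG abelA Gg trX).
  rewrite -(sum_index_rcosets_cycle sPG Gg trX) FiniteModule.fmodX; last first.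
    exact: PfA.
  rewrite -ssralg.GRing.sumrMnr; apply: eq_bigr => x Xx.
  rewrite -FiniteModule.fmodX /restrm /= /restrm; last exact: PfA.
  apply: (congr1 (FiniteModule.fmod abelA)).
  have Gx: x \in G by apply: subsetP (transversal_sub trX) _ Xx.
  apply: (Sylow_conj_cent sylP) => //; rewrite ?groupX ?groupV //.
  rewrite conjgE invgK mulgA -mem_rcoset.
  exact: mulg_exp_card_rcosets.
have nKG: 'ker V <| G by apply: ker_normal.
have tiKP: 'ker V :&: P = 1.
  apply/trivgP/subsetP=> g /setIP[/mker Kg Pg]; rewrite inE.
  rewrite Vexp // in Kg; have:= congr1 val Kg.
  rewrite FiniteModule.fmodK ?PfA ?groupX //= => gn1.
  have co: coprime #|P| #|G : P|.
    by have [_ _ p'i] := and3P sylP; apply: pnat_coprime pP p'i.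
  by rewrite -(expgK co Pg) gn1 expg1n.
have p'K: p^'.-group ('ker V).
  have sylK: p.-Sylow('ker V) ('ker V :&: P).
    exact: Sylow_setI_normal nKG sylP.
  by rewrite /pgroup -partn_eq1 ?cardG_gt0 // -(card_Hall sylK) /= tiKP cards1.
have pV: p.-group (V @* G).
  have sV: V @* G \subset FiniteModule.fmod_morphism abelA @* (idm P @* P).
    apply/subsetP=> u _; rewrite -(FiniteModule.fmvalK u).
    by apply: (mem_morphim (FiniteModule.fmod_morphism abelA));
      apply: FiniteModule.fmodP.
  by apply: pgroupS sV _; rewrite !morphim_pgroup.
have hK: p^'.-Hall(G) ('ker V).
  rewrite /pHall subsetIl p'K /= pnatNK -card_quotient ?normal_norm //.
  by rewrite (card_isog (first_isog _)).
by rewrite (normal_Hall_pcore hK nKG).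
Qed.

Lemma card_index_cent_dvd_Aut (gT : finGroupType) (G P : {group gT}) :
  G \subset 'N(P) -> #|G : 'C_G(P)| %| #|Aut P|.
Proof.
move=> nPG; apply: dvdn_trans (cardSg (Aut_conj_aut P G)).
by rewrite card_morphim ker_conj_aut (setIidPr nPG) indexgI.
Qed.

Lemma comm_norm_cyclic_cent (gT : finGroupType) (F A B : {group gT}) :
  cyclic F -> A \subset 'N(F) -> B \subset 'N(F) -> [~: A, B] \subset 'C(F).
Proof.
move=> cF nFA nFB; rewrite gen_subG.
apply/subsetP=> _ /imset2P[a b Aa Bb ->] /=; rewrite -ker_conj_aut.
have [Na Nb] := (subsetP nFA a Aa, subsetP nFB b Bb).
apply/kerP; rewrite ?groupR // morphR //; apply/eqP/commgP.
by apply: (centsP (Aut_cyclic_abelian cF));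
   apply: (subsetP (Aut_conj_aut F 'N(F))); apply: mem_morphim.
Qed.

(** Climbing the derived series of [C]: if [C^](k.+1)[lies in]'F(G)[, it is central in]C^[(k)],
    which is then a nilpotent normal subgroup and lies in ['F(G)] too. *)
Lemma sol_cent_Fitting (gT : finGroupType) (G : {group gT}) :
  solvable G -> 'C_G('F(G)) \subset 'F(G).
Proof.
move=> solG; set C := 'C_G('F(G))%G; have solC : solvable C.
  exact: solvableS (subsetIl _ _) solG.
have nsCG : C <| G by apply: norm_normalI; rewrite norms_cent ?gFnorm.
have [k] : exists k, C^`(k) \subset 'F(G).
  by have /derivedP[n C1] := solC; exists n; rewrite C1 sub1G.
elim: k => [|k IHk] // sC1F; apply: IHk.
apply: Fitting_max; first by rewrite gFnormal_trans.
have sC1Z : C^`(k.+1) \subset 'Z(C^`(k)).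
  rewrite subsetI der_subS centsC (subset_trans (der_sub k _)) //.
  by rewrite (subset_trans (subsetIr _ _)) // centS.
rewrite -quotient_center_nil abelian_nil //; by apply: sub_der1_abelian; apply: sC1Z.
Qed.

(** Unlike the hypothesis on abelian subgroups, this passes to quotients. *)
Definition odd_cyclic gT (G : {group gT}) :=
  forall p (P : {group gT}), odd p -> P \subset G -> p.-group P -> cyclic P.

Lemma odd_cyclicS (gT : finGroupType) (G H : {group gT}) :
  H \subset G -> odd_cyclic G -> odd_cyclic H.
Proof.
by move=> sHG cG p P op sPH; apply: cG op (subset_trans sPH sHG).
Qed.

Lemma odd_cyclic_Zgroup (gT : finGroupType) (E : {group gT}) :
  odd #|E| -> odd_cyclic E -> Zgroup E.
Proof.
move=> oE cE; apply/forall_inP=> V /SylowP[p p_pr sylV].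
have [sVE pV _] := and3P sylV.
have [-> | ntV] := eqsVneq V 1; first exact: cyclic1.
have [_ p_dv _] := pgroup_pdiv pV ntV; apply: (cE p V _ sVE pV).
exact: dvdn_odd (dvdn_trans p_dv (cardSg sVE)) oE.
Qed.

Lemma cyclic_pgroup_min (gT : finGroupType) (p : nat) (P B H : {group gT}) :
    cyclic P -> p.-group P -> B \subset P -> #|B| = p ->
  H \subset P -> H :!=: 1 -> B \subset H.
Proof.
move=> cP pP sBP oB sHP ntH.
have [p_pr p_dv _] := pgroup_pdiv (pgroupS sHP pP) ntH.
have [x Hx ox] := Cauchy p_pr p_dv.
have -> : B :=: <[x]>.
  apply/eqP; rewrite (eq_subG_cyclic cP) ?cycle_subG ?(subsetP sHP) //.
  by rewrite oB -ox.
by rewrite cycle_subG.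
Qed.

(** By coprime action [[~: P, A]] and ['C_P(A)] meet trivially, but a cyclic [p]-group has only one
    subgroup of order [p], so one of them is trivial. *)
Lemma coprime_act_cyclic_pgroup (gT : finGroupType) (p : nat) (A P : {group gT}) :
    cyclic P -> p.-group P -> A \subset 'N(P) -> coprime #|P| #|A| ->
  A \subset 'C(P) \/ 'C_P(A) = 1.
Proof.
move=> cP pP nPA coPA; have tiC := coprime_abel_cent_TI nPA coPA (cyclic_abelian cP).
have sRP: [~: P, A] \subset P by rewrite commg_subl.
have [R1 | ntR] := eqVneq [~: P, A] 1.
  by left; rewrite centsC; apply/commG1P.
right; apply/eqP/idPn => ntC.
have [p_pr p_dv _] := pgroup_pdiv (pgroupS (subsetIl P 'C(A)) pP) ntC.
have [x Cx ox] := Cauchy p_pr p_dv; have [Px _] := setIP Cx.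
suff: x \in 'C_[~: P, A](A).
  by rewrite tiC => /set1P x1; move: p_pr; rewrite -ox x1 order1.
rewrite inE; have [_ ->] := setIP Cx; rewrite andbT.
rewrite -cycle_subG (cyclic_pgroup_min (P := P) (p := p)) ?cycle_subG //.
Qed.

Lemma conj_order_prime (gT : finGroupType) (p : nat) (G A B : {group gT}) :
    odd_cyclic G -> prime p -> odd p -> A \subset G -> B \subset G ->
    #|A| = p -> #|B| = p ->
  exists2 g, g \in G & B :=: A :^ g.
Proof.
move=> cG p_pr op sAG sBG oA oB.
have pA: p.-group A by rewrite /pgroup oA pnat_id.
have pB: p.-group B by rewrite /pgroup oB pnat_id.
have [P sylP sAP] := Sylow_superset sAG pA.
have [g Gg sBP] := Sylow_Jsub sylP sBG pB.
exists g^-1; rewrite ?groupV //; apply: (canRL (conjsgK g)).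
have [sPG pP _] := and3P sylP.
apply/eqP; rewrite (eq_subG_cyclic (cG p P op sPG pP)) //.
by rewrite cardJg oA oB.
Qed.

Lemma odd_cyclic_normal_uniq (gT : finGroupType) (p : nat) (G A B : {group gT}) :
    odd_cyclic G -> prime p -> odd p -> A <| G -> B \subset G ->
    #|A| = p -> #|B| = p -> B :=: A.
Proof.
move=> cG p_pr op /andP[sAG nAG] sBG oA oB.
have [g Gg ->] := conj_order_prime cG p_pr op sAG sBG oA oB.
exact: normsP nAG g Gg.
Qed.

(** Reduces Burnside's condition from [P] to its subgroup [B] of order [p]: a complement of [P] in
    its normalizer fixes [B] pointwise, so it cannot act nontrivially on [P]. *)
Lemma cyclic_Sylow_norm_cent (gT : finGroupType) (p : nat) (G P B : {group gT}) :
    prime p -> p.-Sylow(G) P -> cyclic P -> B \subset P -> #|B| = p ->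
  'N_G(B) \subset 'C(B) -> 'N_G(P) \subset 'C(P).
Proof.
move=> p_pr sylP cP sBP oB sNC; have [sPG pP _] := and3P sylP.
have ntB: B :!=: 1 by rewrite -cardG_gt1 oB prime_gt1.
have nsPN: P <| 'N_G(P) by rewrite normalSG.
have sylPN: p.-Sylow('N_G(P)) P.
  by apply: (pHall_subl _ _ sylP); rewrite ?subsetIl // normal_sub.
have [Q /complP[tiPQ defN]] := splitsP (SchurZassenhaus_split (pHall_Hall sylPN) nsPN).
have sQN: Q \subset 'N_G(P) by rewrite -defN mulG_subr.
have [sQG nPQ] : Q \subset G /\ Q \subset 'N(P).
  by move: sQN; rewrite subsetI => /andP[].
have coPQ: coprime #|P| #|Q|.
  have := pHall_Hall sylPN; rewrite /Hall -divgS ?normal_sub // -defN.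
  by rewrite (TI_cardMg tiPQ) mulKn // => /andP[].
have sBC: B \subset 'C(Q).
  rewrite centsC (subset_trans _ sNC) // subsetI sQG.
  have chB: B \char P by rewrite sub_cyclic_char.
  exact: char_norm_trans chB nPQ.
suff: P * Q \subset 'C(P) by rewrite defN.
rewrite mulG_subG [P \subset _](cyclic_abelian cP) /=.
have [// | C1] := coprime_act_cyclic_pgroup cP pP nPQ coPQ.
by case/negP: ntB; rewrite -subG1 -C1 subsetI sBP.
Qed.

(** The index [#|N : 'C(B)|] divides both [#|N|] and the order [m] of [Aut B]. *)
Lemma subset_cent_index (gT : finGroupType) (N B : {group gT}) m :
    N \subset 'N(B) -> cyclic B -> totient #|B| = m ->
    (forall q, prime q -> q %| #|N| -> q %| m -> False) ->
  N \subset 'C(B).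
Proof.
move=> nBN cB om coNm; rewrite -indexg_eq1; apply/eqP.
case: (ltngtP #|N : 'C(B)| 1) => //; first by rewrite ltnNge indexg_gt0.
move=> /pdiv_prime q_pr; case: (coNm _ q_pr).
  exact: dvdn_trans (pdiv_dvd _) (dvdn_indexg _ _).
apply: dvdn_trans (pdiv_dvd _) _.
by rewrite -om -card_Aut_cyclic // -indexgI card_index_cent_dvd_Aut.
Qed.

Lemma ex_subgroup_prime (gT : finGroupType) (p : nat) (P : {group gT}) : p.-group P -> P :!=: 1 ->
  exists2 B : {group gT}, B \subset P & #|B| = p.
Proof.
move=> pP ntP; have [p_pr p_dv _] := pgroup_pdiv pP ntP.
have [x Px ox] := Cauchy p_pr p_dv.
by exists <[x]>%G; rewrite ?cycle_subG // -ox.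
Qed.

Lemma normal_complement_prime (gT : finGroupType) (p : nat) (G B : {group gT}) :
    odd_cyclic G -> prime p -> odd p -> B \subset G -> #|B| = p ->
  'N_G(B) \subset 'C(B) -> p^'.-Hall(G) 'O_p^'(G).
Proof.
move=> cG p_pr op sBG oB sNC.
have pB: p.-group B by rewrite /pgroup oB pnat_id.
have [P sylP sBP] := Sylow_superset sBG pB.
have [sPG pP _] := and3P sylP.
apply: (Burnside_normal_complement sylP).
by apply: (cyclic_Sylow_norm_cent p_pr sylP (cG p P op sPG pP) sBP oB sNC).
Qed.

Lemma normal_complement_pdiv (gT : finGroupType) (p : nat) (G P : {group gT}) :
    p.-Sylow(G) P -> cyclic P -> (forall q, prime q -> q %| #|G| -> p <= q) ->
  p^'.-Hall(G) 'O_p^'(G).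
Proof.
move=> sylP cP minp; apply: (Burnside_normal_complement sylP).
have [sPG pP _] := and3P sylP.
have [P1 | ntP] := eqsVneq P 1; first by rewrite P1 cent1T subsetT.
have [p_pr _ _] := pgroup_pdiv pP ntP.
have [B sBP oB] := ex_subgroup_prime pP ntP.
apply: (cyclic_Sylow_norm_cent p_pr sylP cP sBP oB).
apply: (@subset_cent_index _ 'N_G(B)%G B p.-1); rewrite ?subsetIr //.
- exact: cyclicS cP.
- by rewrite oB totient_prime.
move=> q q_pr q_dv q_p1; have := minp q q_pr (dvdn_trans q_dv (cardSg (subsetIl _ _))).
have p1_gt0: 0 < p.-1 by rewrite -ltnS prednK ?prime_gt0 ?prime_gt1.
by rewrite leqNgt => /negP[]; rewrite -(prednK (prime_gt0 p_pr)) ltnS dvdn_leq.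
Qed.

Lemma Zgroup_sol (gT : finGroupType) (G : {group gT}) : Zgroup G -> solvable G.
Proof.
have [n] := ubnP #|G|; elim: n G => // n IH G leGn ZG.
have [-> | ntG] := eqsVneq G 1; first exact: solvable1.
have p_pr: prime (pdiv #|G|) by rewrite pdiv_prime // cardG_gt1.
set p := pdiv _ in p_pr.
have [P sylP] := Sylow_exists p G.
have cP: cyclic P by apply: (forall_inP ZG); apply/SylowP; exists p.
have hallO: p^'.-Hall(G) 'O_p^'(G).
  apply: normal_complement_pdiv sylP cP _ => q q_pr q_dv.
  exact: pdiv_min_dvd (prime_gt1 q_pr) q_dv.
have [sOG p'O pO] := and3P hallO.
rewrite (series_sol (pcore_normal p^' G)) IH ?(ZgroupS sOG) //.
  rewrite (pgroup_sol (p := p)) //.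
  by rewrite /pgroup card_quotient ?gFnorm // -(pnatNK p).
apply: (leq_trans (proper_card _) leGn); rewrite properEneq sOG andbT.
apply/eqP=> eO; move: p'O; rewrite eO /pgroup p'natE // /p.
by rewrite pdiv_dvd.
Qed.

Lemma odd_cyclic_sol (gT : finGroupType) (E : {group gT}) :
  odd #|E| -> odd_cyclic E -> solvable E.
Proof. by move=> oE cE; apply: Zgroup_sol; apply: odd_cyclic_Zgroup. Qed.

Lemma odd_core (gT : finGroupType) (G : {group gT}) : odd #|'O_2^'(G)|.
Proof. by rewrite odd_2'nat; exact: pcore_pgroup. Qed.

Lemma cyclic_Sylow2_complement (gT : finGroupType) (G T : {group gT}) :
  2.-Sylow(G) T -> cyclic T -> 'O_2^'(G) * T = G.
Proof.
move=> sylT cT.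
have hallO: 2^'.-Hall(G) 'O_2^'(G).
  by apply: normal_complement_pdiv sylT cT _ => q /prime_gt1.
by have /(sdprod_normal_pHallP (pcore_normal _ _) sylT)/sdprodP[] := hallO.
Qed.

Lemma coprime_comm_cent_prod (gT : finGroupType) (Q E : {group gT}) :
    Q \subset 'N(E) -> coprime #|E| #|Q| -> solvable E ->
  [~: E, Q] * 'C_E(Q) = E.
Proof.
move=> nEQ coEQ solE.
have sRE: [~: E, Q] \subset E by rewrite commg_subl.
have nRE: E \subset 'N([~: E, Q]) by rewrite commg_norml.
apply/eqP; rewrite eqEsubset mulG_subG sRE subsetIl /=.
rewrite -quotientSK // coprime_quotient_cent ?commg_normr //.
by rewrite subsetI subxx quotient_cents2r.
Qed.

(** [E] and [Q] both normalize the cyclic group ['F(E)], whose automorphism group is abelian; so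
    [[~: E, Q]] centralizes ['F(E)], which contains its own centralizer in [E]. *)
Lemma comm_odd_cyclic_Fitting (gT : finGroupType) (Q E : {group gT}) :
  odd #|E| -> odd_cyclic E -> Q \subset 'N(E) -> [~: E, Q] \subset 'F(E).
Proof.
move=> oE cE nEQ; apply: subset_trans (sol_cent_Fitting (odd_cyclic_sol oE cE)).
rewrite subsetI commg_subl nEQ comm_norm_cyclic_cent ?gFnorm //.
  exact: nil_Zgroup_cyclic (ZgroupS (Fitting_sub E) (odd_cyclic_Zgroup oE cE)) (Fitting_nil E).
exact: gFnorm_trans.
Qed.

Lemma cyclic_Fitting (gT : finGroupType) (E : {group gT}) :
  odd #|E| -> odd_cyclic E -> cyclic 'F(E).
Proof.
move=> oE cE.
exact: nil_Zgroup_cyclic (ZgroupS (Fitting_sub E) (odd_cyclic_Zgroup oE cE)) (Fitting_nil E).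
Qed.

Lemma coprime2 (n : nat) : odd n -> coprime n 2.
Proof. by rewrite coprimen2. Qed.

Lemma odd_sqr_mem (gT : finGroupType) (H : {group gT}) x : odd #[x] -> x ^+ 2 \in H -> x \in H.
Proof.
move=> odx Hx2; have <-: (x ^+ 2) ^+ (uphalf #[x]) = x.
  rewrite -expgM mul2n uphalfE; have := odd_double_half #[x].+1.
  by rewrite /= odx add0n => ->; rewrite expgS expg_order mulg1.
exact: groupX.
Qed.

Lemma mem_cent1E (gT : finGroupType) (x t : gT) : (x \in 'C[t]) = (x ^ t == x).
Proof.
apply/cent1P/eqP=> [/commute_conjg // | xt].
by apply/commgP/conjg_fixP.
Qed.

(** [Z] falls into the cyclic Fitting subgroup, where coprime action leaves [t] no fixed point in
    it; so [t] inverts [Z]. This splitting of an odd group into an inverted and a centralized part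
    is used throughout. *)
Lemma odd_cyclic_involution_act (gT : finGroupType) (E : {group gT}) t (Z := [~: E, <[t]>]%G) :
    odd #|E| -> odd_cyclic E -> t \in 'N(E) -> #[t] = 2 ->
  [/\ cyclic Z, Z <| E, Z * 'C_E[t] = E, coprime #|Z| #|'C_E[t]|
    & forall x, x \in E -> (x \in Z) = (x ^ t == x^-1)].
Proof.
move=> oE cE nEt ot; pose F := 'F(E)%G.
have nEc: <[t]> \subset 'N(E) by rewrite cycle_subG.
have cF: cyclic F := cyclic_Fitting oE cE.
have sFE: F \subset E := Fitting_sub E.
have solE := odd_cyclic_sol oE cE.
have coE2: coprime #|E| #|<[t]>| by rewrite -orderE ot coprime2.
have coF2: coprime #|F| #|<[t]>| by apply: coprimeSg coE2.
have sZF: Z \subset F := comm_odd_cyclic_Fitting oE cE nEc.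
have cZ: cyclic Z := cyclicS sZF cF.
have nsZE: Z <| E by rewrite /normal commg_norml commg_subl nEc.
have defE: Z * 'C_E[t] = E by rewrite -cent_cycle coprime_comm_cent_prod.
have nFt: <[t]> \subset 'N(F) by apply: gFnorm_trans.
have sRF: [~: F, <[t]>] \subset F by rewrite commg_subl.
have nRE: E \subset 'N([~: F, <[t]>]).
  have chR: [~: F, <[t]>]%G \char F by rewrite sub_cyclic_char.
  exact: char_norm_trans chR (normal_norm (Fitting_normal E)).
(* As [E = Z * 'C_E[t]], commutators with [t] come from [Z], hence from the abelian [F], and coprime
   action on [F] then yields ['C_Z[t] = 1]. *)
have sZR: Z \subset [~: F, <[t]>].
  rewrite gen_subG; apply/subsetP=> _ /imset2P[e u Ee tu ->].
  move: Ee; rewrite -defE => /mulsgP[z c Zz /setIP[Ec Cc] ->].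
  rewrite commMgJ (_ : [~ c, u] = 1) ?mulg1; last first.
    by rewrite -cent_cycle in Cc; apply/eqP/commgP/(centP Cc).
  by rewrite memJ_norm ?(subsetP nRE) // mem_commg // (subsetP sZF).
have CZ1: 'C_Z[t] = 1.
  apply/trivgP; rewrite -(coprime_abel_cent_TI nFt coF2 (cyclic_abelian cF)).
  by rewrite /= -cent_cycle setSI.
have invZ z: z \in Z -> z ^ t = z^-1.
  move=> Zz; have Zzt: z ^ t \in Z.
    by rewrite memJ_norm // (subsetP (commg_normr _ _)) ?cycle_id.
  apply/eqP; rewrite eq_sym eq_invg_mul.
  suff: z * z ^ t \in 'C_Z[t] by rewrite CZ1 inE.
  rewrite inE groupM //=; rewrite mem_cent1E; apply/eqP.
  rewrite conjMg -conjgM -expg2 -ot expg_order conjg1.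
  exact: (centsP (cyclic_abelian cZ)).
split=> //.
  (* For a common prime [p], the subgroup of order [p] of the cyclic [Z] is normal in [E], hence the
     only one of its order, and it would lie in ['C_Z[t]]. *)
  rewrite coprime_has_primes ?cardG_gt0 //; apply/hasPn=> p.
  rewrite !mem_primes => /and3P[p_pr _ p_dvC]; apply/negP=> /and3P[_ _ p_dvZ].
  have [x Zx ox] := Cauchy p_pr p_dvZ; have [y Cy oy] := Cauchy p_pr p_dvC.
  have [Ey _] := setIP Cy.
  have op: odd p by rewrite -oy (dvdn_odd (order_dvdG Ey)).
  have nsxE: <[x]> <| E.
    apply: char_normal_trans nsZE; rewrite sub_cyclic_char //.
    by rewrite cycle_subG.
  have e := odd_cyclic_normal_uniq cE p_pr op nsxE _ ox oy.
  have: y \in 'C_Z[t].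
    have [_ Cty] := setIP Cy; rewrite inE Cty andbT.
    have: y \in <[y]> := cycle_id y.
    by rewrite e ?cycle_subG // => /(subsetP _)->; rewrite // cycle_subG.
  by rewrite CZ1 => /set1P y1; move: p_pr; rewrite -oy y1 order1.
move=> x Ex; apply/idP/eqP=> [/invZ // | xt].
have: [~ x, t] \in Z by rewrite mem_commg ?cycle_id.
rewrite commgEl xt -invMg groupV => x2.
by apply: (odd_sqr_mem _ x2); rewrite (dvdn_odd _ oE) // order_dvdG.
Qed.

Lemma involution_inv (gT : finGroupType) (t : gT) : #[t] = 2 -> t^-1 = t.
Proof. by move=> ot; apply/eqP; rewrite eq_invg_mul -expg2 -ot expg_order. Qed.

Lemma involution_mulK (gT : finGroupType) (t : gT) : #[t] = 2 -> t * t = 1.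
Proof. by move=> ot; rewrite -expg2 -ot expg_order. Qed.

Lemma order2P (gT : finGroupType) (t : gT) : t != 1 -> t * t = 1 -> #[t] = 2.
Proof. by move=> nt1 tt; apply: nt_prime_order. Qed.

Lemma involution_mul_inv (gT : finGroupType) (s t : gT) :
  #[s] = 2 -> #[t] = 2 -> (t * s) ^ t = (t * s)^-1.
Proof.
move=> os ot; rewrite conjgE invMg !involution_inv //.
by rewrite !mulgA involution_mulK // mul1g.
Qed.

Lemma conj_inv_exp (gT : finGroupType) (x t : gT) n : x ^ t = x^-1 -> (x ^+ n) ^ t = (x ^+ n)^-1.
Proof. by move=> xt; rewrite conjXg xt expgVn. Qed.

(** [y] is the square root of [x = t * s] in [<[x]>]; since [t] inverts it,
    [t ^ y = t * y ^+ 2 = s]. *)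
Lemma odd_involutions_conj (gT : finGroupType) (s t : gT) :
  #[s] = 2 -> #[t] = 2 -> odd #[t * s] -> exists2 y, y \in <[t * s]> & s = t ^ y.
Proof.
move=> os ot odx; set x := t * s; have xt := involution_mul_inv os ot.
exists (x ^+ (uphalf #[x])); first exact: mem_cycle.
set y := x ^+ _; have yt: t * y = y^-1 * t.
  by rewrite -(conj_inv_exp _ xt) -/y conjgE -!mulgA involution_mulK // mulg1 involution_inv.
rewrite conjgE mulgA -yt -mulgA /y -expgD addnn uphalfE.
have := odd_double_half #[x].+1; rewrite /= odx add0n => ->.
by rewrite expgS expg_order mulg1 /x mulgA involution_mulK // mul1g.
Qed.

Lemma even_involutions_central (gT : finGroupType) (s t : gT) :
    #[s] = 2 -> #[t] = 2 -> ~~ odd #[t * s] ->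
  exists w, [/\ w \in <[t * s]>, #[w] = 2, commute w t & commute w s].
Proof.
move=> os ot evx; set x := t * s; have xt := involution_mul_inv os ot.
have xs: x ^ s = x^-1.
  by rewrite /x conjgE !invMg !involution_inv // !mulgA -[_ * s * s]mulgA involution_mulK // mulg1.
have dv2: 2 %| #[x] by rewrite dvdn2.
pose w := x ^+ (#[x] %/ 2).
have ow: #[w] = 2 by rewrite orderXdiv ?dvdn_div // divnA // mulKn.
have cw u : x ^ u = x^-1 -> commute w u.
  move=> xu; apply/cent1P; rewrite mem_cent1E; apply/eqP.
  by rewrite (conj_inv_exp _ xu) involution_inv.
by exists w; rewrite mem_cycle; split=> //; apply: cw.
Qed.

(** Equivalent to the absence of Klein four-subgroups. *)
Definition commuting_involutions_eq gT (G : {group gT}) :=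
  forall s t, s \in G -> t \in G -> #[s] = 2 -> #[t] = 2 -> commute s t -> s = t.

(** * Groups in which commuting involutions coincide *)

Lemma TI_mem (gT : finGroupType) (A B : {set gT}) x :
  A :&: B = 1 -> x \in A -> x \in B -> x = 1.
Proof. by move=> ti Ax Bx; apply/set1P; rewrite -[[set 1]]ti inE Ax. Qed.

Lemma conj_cycle_prime (gT : finGroupType) (G : {group gT}) a b :
    odd_cyclic G -> prime #[a] -> odd #[a] -> a \in G -> b \in G -> #[b] = #[a] ->
  exists2 g, g \in G & <[a]> = <[b]> :^ g.
Proof.
move=> cG pr_a oa Ga Gb ob.
by apply: (conj_order_prime cG pr_a oa); rewrite ?cycle_subG // -ob.
Qed.

Lemma pgroup_quotient_lift (gT : finGroupType) (p : nat) (G N : {group gT})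
    (H : {group coset_of N}) :
    N <| G -> H \subset G / N -> p.-group H ->
  exists2 P : {group gT}, P \subset G /\ p.-group P & H \subset P / N.
Proof.
move=> nsNG sHG pH; have [P sylP] := Sylow_exists p G.
have nNG := normal_norm nsNG; have [sPG pP _] := and3P sylP.
have sylPN : p.-Sylow(G / N) (P / N) by apply: quotient_pHall (subset_trans sPG nNG) sylP.
have [_ /morphimP[x Nx Gx ->] sHP] := Sylow_Jsub sylPN sHG pH.
exists (P :^ x^-1)%G; first by rewrite pgroupJ pP -(conjGid (groupVr Gx)) conjSg.
by rewrite quotientJ ?groupV // morphV // -sub_conjg.
Qed.

Lemma odd_cyclic_quotient (gT : finGroupType) (G N : {group gT}) :
  N <| G -> odd_cyclic G -> odd_cyclic (G / N)%G.
Proof.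
move=> nsNG cG p H op sHG pH.
have [P [sPG pP] sHP] := pgroup_quotient_lift nsNG sHG pH.
exact: cyclicS sHP (quotient_cyclic _ (cG p P op sPG pP)).
Qed.

(** Both involutions lift into one 2-subgroup [P], which meets the odd group [N] trivially, so their
    orders and their commuting lift as well. *)
Lemma commuting_involutions_eq_quotient (gT : finGroupType) (G N : {group gT}) :
    N <| G -> odd #|N| -> commuting_involutions_eq G ->
  commuting_involutions_eq (G / N)%G.
Proof.
move=> nsNG oN eqG a b Ga Gb oa ob cab; apply/eqP; apply: contraT => neq.
have pE: 2.-group (<[a]> <*> <[b]>).
  have cE: <[b]> \subset 'C(<[a]>) by rewrite cent_cycle cycle_subG; apply/cent1P.
  rewrite cent_joinEr // pgroupM /pgroup -!orderE oa ob.
  by rewrite pnat_id.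
have sEG: <[a]> <*> <[b]> \subset G / N by rewrite join_subG !cycle_subG Ga.
have [P [sPG pP] sEP] := pgroup_quotient_lift nsNG sEG pE.
have tiPN u : u \in N -> u \in P -> u = 1.
  apply: TI_mem; apply: coprime_TIg.
  by rewrite coprime_sym (pnat_coprime pP) // -odd_2'nat.
have [sab] : a \in P / N /\ b \in P / N.
  by split; rewrite (subsetP sEP) // mem_gen // inE cycle_id ?orbT.
have nNP := subset_trans sPG (normal_norm nsNG).
move: sab => /morphimP[s Ns Ps def_a] /morphimP[t Nt Pt def_b].
have sq1 u : u \in P -> coset N u * coset N u = 1 -> u * u = 1.
  move=> Pu; rewrite -morphM ?(subsetP nNP) // => /coset_idr u2.
  by apply: tiPN; rewrite ?u2 ?groupM ?(subsetP nNP).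
have o2 u : u \in P -> #[coset N u] = 2 -> #[u] = 2.
  move=> Pu o; apply: order2P.
    by apply: contraTneq isT => u1; move: o; rewrite u1 morph1 order1.
  by apply: sq1 => //; apply: involution_mulK.
case/negP: neq; rewrite def_a def_b; apply/eqP; congr (coset N _).
apply: eqG; rewrite ?(subsetP sPG) ?o2 -?def_a -?def_b //.
apply/commgP/eqP; apply: tiPN; last by rewrite groupR.
apply: coset_idr; first by rewrite groupR ?(subsetP nNP).
by rewrite morphR //; apply/eqP/commgP; rewrite -def_a -def_b.
Qed.

(** * Counting involutions in a minimal counterexample to centrality modulo the odd core *)

Section IsolatedInvolution.

Variables (gT : finGroupType) (G : {group gT}) (t : gT).
Hypotheses (cG : odd_cyclic G) (eqG : commuting_involutions_eq G).
Hypotheses (Gt : t \in G) (ot : #[t] = 2).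
Let C := 'C_G[t].
(** All involutions of [G] are conjugate, so [pi] serves for every one of them. *)
Let pi : nat_pred := \pi(C).

Let pi2 : 2 \in pi.
Proof.
have dv: 2 %| #|'C_G[t]| by rewrite -ot order_dvdG // inE Gt; apply/cent1P.
by rewrite /pi inE /= mem_primes cardG_gt0.
Qed.

Lemma isolated_odd s i : s \in G -> i \in G -> #[s] = 2 -> #[i] = 2 -> odd #[i * s].
Proof.
move=> Gs Gi os oi; apply: contraT => ev.
have [w] := even_involutions_central os oi ev.
case=> w_is ow cwi cws; have Gw: w \in G.
  by apply: subsetP w_is; rewrite cycle_subG groupM.
case/negP: ev; suff -> : i = s by rewrite involution_mulK // order1.
by rewrite -(eqG Gw Gi ow oi cwi) (eqG Gw Gs ow os cws).
Qed.

Lemma isolated_conj (H : {group gT}) s i : H \subset G ->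
  s \in H -> i \in H -> #[s] = 2 -> #[i] = 2 -> exists2 y, y \in H & s = i ^ y.
Proof.
move=> sHG Hs Hi os oi; have [Gs Gi] := (subsetP sHG s Hs, subsetP sHG i Hi).
have [y y_is ->] := odd_involutions_conj os oi (isolated_odd Gs Gi os oi).
by exists y => //; apply: subsetP y_is; rewrite cycle_subG groupM.
Qed.

Lemma card_isolated_cent i : i \in G -> #[i] = 2 -> #|'C_G[i]| = #|C|.
Proof.
move=> Gi oi; have [y Gy ->] := isolated_conj (subxx G) Gi Gt oi ot.
by rewrite cent1J -{1}(conjGid Gy) -conjIg cardJg.
Qed.

(* An element inverted by an involution centralises none: cyclic Sylow subgroups make the
   subgroups of order p conjugate, and t inverts none of those it centralises. *)
Lemma inverted_pi' i x : i \in G -> #[i] = 2 -> x \in G -> odd #[x] ->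
  x ^ i = x^-1 -> pi^'.-elt x.
Proof.
move=> Gi oi Gx ox xi; apply/pgroupP=> p p_pr p_dv; rewrite inE /=.
rewrite /pi mem_primes p_pr cardG_gt0 /=; apply/negP=> p_dvC.
have op: odd p := dvdn_odd p_dv ox.
have [a ax oa] := Cauchy p_pr p_dv; have [b /setIP[Gb Cb] ob] := Cauchy p_pr p_dvC.
have Ga: a \in G by apply: subsetP ax; rewrite cycle_subG.
have [g Gg defA] : exists2 g, g \in G & <[a]> = <[b]> :^ g.
  by apply: conj_cycle_prime; rewrite ?oa.
have ai: a ^ i = a^-1.
  by have /cycleP[k ->] := ax; rewrite (conj_inv_exp _ xi).
have Nai: i \in 'N_G(<[a]>) by rewrite inE Gi -cycle_subG norms_cycle ?ai ?groupV ?cycle_id.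
have cag: t ^ g \in 'C(<[a]>).
  rewrite defA centJ memJ_conjg cent_cycle; apply/cent1P/commute_sym.
  by apply/cent1P.
have Nat: t ^ g \in 'N_G(<[a]>) by rewrite inE groupJ // (subsetP (cent_sub _)).
have [y /setIP[_ Ny] di] := isolated_conj (subsetIl _ _) Nai Nat oi (etrans (orderJ t g) ot).
have: i \in 'C(<[a]>) by rewrite di -(normP Ny) centJ memJ_conjg.
rewrite cent_cycle => /cent1P/commute_sym/commute_conjg; rewrite ai => a1.
have: a * a = 1 by rewrite -{1}a1 mulVg.
move=> aa; have: #[a] %| 2 by rewrite order_dvdn expg2 aa.
by rewrite oa dvdn_prime2 // => /eqP p2; rewrite p2 in op.
Qed.

(** [Z] is the part of the odd core of [H] that [i] inverts, so its elements are [pi^']-elements,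
    whereas ['C_H[i]] lies in a group of order [#|C|]. *)
Lemma isolated_split (H : {group gT}) i :
    H \subset G -> i \in H -> #[i] = 2 -> 'O_2^'(H) * 'C_H[i] = H ->
  exists Z : {group gT}, [/\ Z <| H, pi^'.-group Z, Z * 'C_H[i] = H & pi.-group 'C_H[i]].
Proof.
move=> sHG Hi oi defH; pose O := 'O_2^'(H)%G.
have nOi: i \in 'N(O) by rewrite (subsetP (gFnorm _ _)).
have cO: odd_cyclic O by apply: odd_cyclicS cG; apply: subset_trans (pcore_sub _ _) sHG.
have [_ nsZO defO _ memZ] := odd_cyclic_involution_act (odd_core H) cO nOi oi.
exists [~: O, <[i]>]%G; have sZO := normal_sub nsZO.
have sOH: O \subset H := pcore_sub _ _.
have sCG: 'C_H[i] \subset 'C_G[i] by apply: setSI.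
split.
- rewrite /normal (subset_trans sZO) // -{1}defH mulG_subG normal_norm //=.
  apply: normsR; first by rewrite (subset_trans (subsetIl _ _)) ?gFnorm.
  by rewrite -cent_cycle subIset // cent_sub orbT.
- apply/pgroupP=> p p_pr p_dv; have [x Zx ox] := Cauchy p_pr p_dv.
  have Ox := subsetP sZO x Zx; have Gx: x \in G by rewrite (subsetP sHG) // (subsetP sOH).
  have /eqP xi: x ^ i == x^-1 by rewrite -memZ.
  have := inverted_pi' (subsetP sHG i Hi) oi Gx _ xi.
  rewrite (dvdn_odd (order_dvdG Ox)) ?odd_core // => /(_ isT).
  by rewrite /p_elt ox pnatE.
- rewrite -[RHS]defH -[X in X * _ = _]/(_ : {set gT}) -[in RHS]defO -mulgA; congr (_ * _).
  by rewrite mulSGid // setSI.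
apply: pgroupS sCG _; rewrite /pgroup card_isolated_cent ?(subsetP sHG) //.
by rewrite pnat_pi ?cardG_gt0.
Qed.

(** In [Z * <[h]>] both [<[h]>] and [Z * <[h]> :&: 'C_H[i]] are complements of [Z]; by
    Schur-Zassenhaus some [x] in [Z] conjugates the second to the first, and [i ^ x] commutes with
    [h]. *)
Lemma isolated_split_cent (H Z : {group gT}) i h :
    H \subset G -> i \in H -> #[i] = 2 ->
    Z <| H -> pi^'.-group Z -> Z * 'C_H[i] = H -> pi.-group 'C_H[i] ->
    h \in H -> pi.-elt h ->
  exists2 j, j \in 'C_H[h] & #[j] = 2.
Proof.
move=> sHG Hi oi nsZH pi'Z defH piC Hh pih.
have [sZH nZH] := andP nsZH.
have nZh: <[h]> \subset 'N(Z) by rewrite cycle_subG (subsetP nZH).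
have solZ: solvable Z.
  apply: (odd_cyclic_sol _ (odd_cyclicS (subset_trans sZH sHG) cG)).
  by rewrite odd_2'nat; apply: sub_pgroup pi'Z => p; apply: contra => /eqP->.
have coZh: coprime #|Z| #|<[h]>| by rewrite coprime_sym (pnat_coprime pih).
have sZhH: Z * <[h]> \subset H by rewrite mul_subG ?cycle_subG.
have defZh: Z * (Z * <[h]> :&: 'C_H[i]) = Z * <[h]>.
  rewrite -norm_joinEr // setIC group_modl ?joing_subl // defH /= norm_joinEr //.
  exact/setIidPr.
have [x Zx def_h] : exists2 x, x \in Z & <[h]>%G :=: (Z * <[h]> :&: 'C_H[i]) :^ x.
  pose D := (Z <*> <[h]> :&: 'C_H[i])%G.
  have defD: D = Z * <[h]> :&: 'C_H[i] :> {set gT}.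
    by rewrite /D /= norm_joinEr.
  have coZC: coprime #|Z| #|'C_H[i]| by rewrite coprime_sym (pnat_coprime piC).
  have coZD: coprime #|Z| #|D| by rewrite (coprimegS _ coZC) // subsetIr.
  rewrite -defD; apply: SchurZassenhaus_trans_sol => //.
  - by rewrite subIset // (subset_trans (subsetIl _ _)) // orbT.
  - by rewrite defD defZh mulG_subr.
  apply/eqP; rewrite -(eqn_pmul2l (cardG_gt0 Z)) -!coprime_cardMg //.
  by rewrite defD defZh.
exists (i ^ x); last by rewrite orderJ.
rewrite inE (groupJ Hi (subsetP sZH x Zx)) /=.
have: h \in (Z * <[h]> :&: 'C_H[i]) :^ x by rewrite -def_h cycle_id.
by rewrite conjIg conjIg -cent1J => /setIP[_ /setIP[_]]; rewrite cent1C.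
Qed.

(** The [pi^']-elements form the normal Hall subgroup [Z], the involutions form the class of [i],
    and that class has size [#|H : 'C_H[i]| = #|Z|]. *)
Lemma isolated_count (H Z : {group gT}) i :
    H \subset G -> i \in H -> #[i] = 2 ->
    Z <| H -> pi^'.-group Z -> Z * 'C_H[i] = H -> pi.-group 'C_H[i] ->
  #|[set x in H | pi^'.-elt x]| = #|[set x in H | #[x] == 2]|.
Proof.
move=> sHG Hi oi nsZH pi'Z defH piC.
have hallZ: pi^'.-Hall(H) Z.
  by have [] := coprime_mulpG_Hall defH pi'Z; rewrite ?pgroupNK.
have -> : [set x in H | pi^'.-elt x] = Z.
  apply/setP=> x; rewrite inE; case Hx: (x \in H) => /=.
    by rewrite -(mem_normal_Hall hallZ nsZH Hx).
  by apply/esym/negbTE; apply: contraFN Hx; apply: subsetP (normal_sub nsZH) x.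
have -> : [set x in H | #[x] == 2] = i ^: H.
  apply/setP=> x; rewrite inE; apply/andP/imsetP=> [[Hx /eqP ox] | [y Hy ->]].
    by have [y Hy ->] := isolated_conj sHG Hx Hi ox oi; exists y.
  by rewrite orderJ oi groupJ.
rewrite -index_cent1 -divgS ?subsetIl // -defH coprime_cardMg ?mulnK ?cardG_gt0 //.
by rewrite coprime_sym (pnat_coprime piC).
Qed.

Hypothesis IH : forall (H : {group gT}) i,
  H \proper G -> i \in H -> #[i] = 2 -> 'O_2^'(H) * 'C_H[i] = H.
Hypotheses (O1 : 'O_2^'(G) = 1) (ncC : 'C_G[t] != G).

Let cent1_proper i : i \in G -> #[i] = 2 -> 'C_G[i] \proper G.
Proof.
move=> Gi oi; rewrite properEcard subsetIl card_isolated_cent //.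
by rewrite proper_card // properEneq ncC subsetIl.
Qed.

Lemma isolated_cent_proper a : a \in G -> prime #[a] -> #[a] \in pi ->
  'C_G[a] \proper G /\ exists2 i, i \in 'C_G[a] & #[i] = 2.
Proof.
move=> Ga a_pr; have [oa2 _ | nea2] := eqVneq #[a] 2.
  by split; [apply: cent1_proper | exists a; rewrite // inE Ga cent1id].
have op: odd #[a] by have [/eqP | //] := even_prime a_pr; rewrite (negPf nea2).
rewrite /pi inE /= mem_primes => /and3P[_ _ p_dvC].
have [b /setIP[Gb Cb] ob] := Cauchy a_pr p_dvC.
have [g Gg defA] := conj_cycle_prime cG a_pr op Ga Gb ob.
split; last first.
  exists (t ^ g); last by rewrite orderJ.
  rewrite inE groupJ //= -cent_cycle defA centJ memJ_conjg cent_cycle.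
  by rewrite cent1C.
rewrite properE subsetIl /=; apply/negP=> sGC.
have nsaG: <[a]> <| G.
  rewrite /normal cycle_subG Ga; apply: subset_trans (cent_sub _).
  by rewrite cent_cycle; apply: subset_trans sGC (subsetIr _ _).
have: <[a]> \subset 'O_2^'(G).
  by apply: pcore_max nsaG; rewrite /pgroup -odd_2'nat.
rewrite O1 cycle_subG => /set1P a1; by rewrite a1 order1 in a_pr.
Qed.

(** An involution commuting with [h] is needed. A power [a] of [h] of prime order commutes with one,
    its span being conjugate to a subgroup of ['C_G[t]]; the splitting of the proper subgroup
    ['C_G[a]] then provides one for [h]. *)
Lemma isolated_section h : h \in G -> h != 1 -> pi.-elt h ->
  #|[set x in 'C_G[h] | pi^'.-elt x]| = #|[set x in 'C_G[h] | #[x] == 2]|.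
Proof.
move=> Gh nth pih; have q_pr: prime (pdiv #[h]) by rewrite pdiv_prime // order_gt1.
set q := pdiv _ in q_pr; have q_dv: q %| #[h] := pdiv_dvd _.
pose a := h ^+ (#[h] %/ q); have oa: #[a] = q.
  by rewrite orderXdiv ?dvdn_div // divnA // mulKn ?order_gt0.
have Ga: a \in G by rewrite groupX.
have [|| prC [i Ci oi]] := @isolated_cent_proper a Ga; rewrite ?oa //.
  exact: pgroupP pih q q_pr q_dv.
have sCG: 'C_G[a] \subset G := proper_sub prC.
have Ch: h \in 'C_G[a] by rewrite inE Gh; apply/cent1P; apply: commuteX.
have [Z [nsZ pi'Z defC piC]] := isolated_split sCG Ci oi (IH prC Ci oi).
have [j /setIP[Cj hj] oj] := isolated_split_cent sCG Ci oi nsZ pi'Z defC piC Ch pih.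
have Gj := subsetP sCG j Cj.
have Cj': j \in 'C_G[h] by rewrite inE Gj.
have prCh: 'C_G[h] \proper G.
  apply: sub_proper_trans prC; apply: setIS.
  by rewrite -!cent_cycle centS // cycle_subG mem_cycle.
have [Z' [nsZ' pi'Z' defC' piC']] := isolated_split (proper_sub prCh) Cj' oj (IH prCh Cj' oj).
exact: isolated_count (proper_sub prCh) Cj' oj nsZ' pi'Z' defC' piC'.
Qed.

Let I := [set x in G | #[x] == 2].

Let defI : I = t ^: G.
Proof.
apply/setP=> x; rewrite inE; apply/andP/imsetP=> [[Gx /eqP ox] | [y Gy ->]].
  by have [y Gy ->] := isolated_conj (subxx G) Gx Gt ox ot; exists y.
by rewrite orderJ ot groupJ.
Qed.

Let cardG_I : #|G| = (#|I| * #|C|)%N.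
Proof. by rewrite defI -index_cent1 mulnC Lagrange // subsetIl. Qed.

(* Counts the pairs (h, i) of a nontrivial pi-element h and an involution i centralising it,
   with the elements that are not pi' grouped by their pi-part h. *)
Lemma isolated_card_pi' : #|[set x in G | pi^'.-elt x]| = #|I|.
Proof.
pose S := [set x in G | ~~ pi^'.-elt x].
pose Hs := [set h in G | pi.-elt h & h != 1].
have cardS: #|S| = (#|I| * #|C|.-1)%N.
  transitivity (\sum_(h in Hs) #|[set x in 'C_G[h] | pi^'.-elt x]|)%N.
    rewrite -sum1_card (partition_big (fun g => g.`_pi) (mem Hs)) /=; last first.
      move=> g /[!inE] /andP[Gg npig]; rewrite groupX //= p_elt_constt.
      by apply: contra npig => /eqP/constt1P.
    apply: eq_bigr => h /[!inE] /and3P[Gh pih nth].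
    (* The elements with pi-part [h] are the products [h * y] with [y] a [pi^']-element of
       ['C_G[h]]. *)
    rewrite -sum1_card [RHS](reindex_onto (fun g => h^-1 * g) (mulg h)); last first.
      by move=> g _; rewrite mulKg.
    apply: eq_bigl => g; rewrite mulKVg eqxx andbT [g \in S]inE [RHS]inE in_setI.
    apply/andP/andP=> [[/andP[Gg npig] /eqP gh] | [/andP[Gy Cy] pi'y]].
      have def_g : h^-1 * g = g.`_pi^' by rewrite -{1}(consttC pi g) gh mulKg.
      rewrite def_g p_elt_constt groupX //=; split=> //.
      apply/cent1P; rewrite -gh; exact: commuteX2.
    move/cent1P: Cy => cyh; set y := h^-1 * g in Gy cyh pi'y.
    have def_g : g = h * y by rewrite mulKVg.
    clearbody y.
    have gh : g.`_pi = h.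
      by rewrite def_g (consttM pi (commute_sym cyh)) (constt_p_elt pih) (constt1P pi'y) mulg1.
    rewrite gh eqxx def_g groupM //=; split=> //; rewrite -def_g.
    by apply: contra nth => /constt1P; rewrite gh => ->.
  transitivity (\sum_(h in Hs) \sum_(i in I | h \in 'C[i]) 1)%N.
    apply: eq_bigr => h /[!inE] /and3P[Gh pih nth]; rewrite isolated_section //.
    rewrite -sum1_card; apply: eq_bigl => i.
    by rewrite inE in_setI [i \in I]inE cent1C -!andbA; case: (i \in G); rewrite //= andbC.
  rewrite (exchange_big_dep (mem I)) /=; last by move=> h i _ /andP[].
  transitivity (\sum_(i in I) #|C|.-1)%N; last by rewrite sum_nat_const.
  apply: eq_bigr => i Ii; move: (Ii); rewrite inE => /andP[Gi /eqP oi].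
  rewrite -(card_isolated_cent Gi oi) (cardsD1 1 'C_G[i]) group1 add1n /= -sum1_card.
  apply: eq_bigl => h; rewrite [h \in Hs]inE Gi oi eqxx in_setD1 in_setI /=.
  apply/idP/idP=> [/andP[/and3P[-> _ ->] ->] // | /and3P[-> Gh Ch]].
  have piC: pi.-group 'C_G[i] by rewrite /pgroup card_isolated_cent // pnat_pi ?cardG_gt0.
  by rewrite Gh Ch (mem_p_elt piC) // inE Gh.
have -> : #|[set x in G | pi^'.-elt x]| = (#|G| - #|S|)%N.
  have -> : S = G :\: [set x in G | pi^'.-elt x].
    by apply/setP=> x; rewrite !inE; case: (x \in G); rewrite ?andbF ?andbT.
  rewrite cardsD (setIidPr _) ?subKn //; first by rewrite subset_leq_card //; apply/subsetP=> x /[!inE] /andP[].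
  by apply/subsetP=> x /[!inE] /andP[].
by rewrite cardS cardG_I -mulnBr -subn1 subKn // muln1.
Qed.

(* Double counting of the pairs (i, x) of an involution i inverting a pi'-element x != 1:
   products of two distinct involutions give |I| (|I| - 1) of them, but each of the |I| - 1
   elements x is inverted by fewer than |I| involutions. *)
Lemma isolated_central_false : False.
Proof.
pose X := [set x in G | pi^'.-elt x] :\ 1.
have cardX: #|X|.+1 = #|I|.
  by rewrite -isolated_card_pi' (cardsD1 1 [set x in G | _]) inE group1 /p_elt order1.
have pi'X x : x \in X -> #[x] != 2.
  move=> /setD1P[_ /setIdP[_ pi'x]]; apply: contraL pi2 => /eqP ox.
  by move: pi'x; rewrite /p_elt ox pnatE.
have mI i x : i \in I -> x \in X -> (i * x \in I) = (x ^ i == x^-1).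
  rewrite [i \in I]inE => /andP[Gi /eqP oi] Xx.
  have [nx1 /setIdP[Gx _]] := setD1P Xx.
  rewrite inE groupM //=; apply/eqP/eqP=> [oix | xi].
    by have := involution_mul_inv oix oi; rewrite mulgA involution_mulK // mul1g.
  apply: order2P.
    apply: contra (pi'X x Xx) => /eqP ix1.
    by rewrite -(mulKg i x) ix1 mulg1 orderV oi.
  by rewrite -{1}(involution_inv oi) mulgA -(mulgA _ x i) -conjgE xi mulVg.
(* If all involutions inverted [x], they would invert every conjugate of [x]. As [x ^ g] is the
   product of the involutions [t ^ g] and [(t * x) ^ g], these conjugates would commute and span a
   normal subgroup of odd order, against [O1]. *)
have inj_all x : x \in X -> exists2 i, i \in I & x ^ i != x^-1.
  move=> Xx; have [nx1 /setIdP[Gx pi'x]] := setD1P Xx.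
  apply/exists_inP; apply: contraT; rewrite negb_exists_in => /forall_inP inv.
  have invI i : i \in I -> x ^ i = x^-1 by move/inv; rewrite negbK => /eqP.
  have It : t \in I by rewrite inE Gt ot.
  have IJ i g : g \in G -> i \in I -> i ^ g \in I.
    by move=> Gg; rewrite !inE orderJ => /andP[Gi ->]; rewrite groupJ.
  have invJ g i : g \in G -> i \in I -> (x ^ g) ^ i = (x ^ g)^-1.
    move=> Gg Ii; rewrite -conjVg -(invI (i ^ g^-1)) ?IJ ?groupV //.
    by rewrite -!conjgM -conjgCV.
  have abQ : abelian <<x ^: G>>.
    rewrite abelian_gen; apply/centsP=> _ /imsetP[g Gg ->] _ /imsetP[k Gk ->].
    apply/commute_sym/commgP/conjg_fixP.
    have Itx : t * x \in I by rewrite mI // invI.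
    have -> : x ^ g = t ^ g * (t * x) ^ g.
      by rewrite -conjMg mulgA involution_mulK // mul1g.
    by rewrite conjgM invJ ?IJ // conjVg invJ ?IJ // invgK.
  have Qx : x \in <<x ^: G>> by rewrite mem_gen // class_refl.
  have sQG : <<x ^: G>> \subset G by rewrite gen_subG class_subG.
  have oQ : odd #|<<x ^: G>>|.
    apply: contraT; rewrite -dvdn2 => /(Cauchy (isT : prime 2)) [s Qs os].
    have Is : s \in I by rewrite inE (subsetP sQG) //= os.
    have := invI s Is; rewrite commute_conjg; last exact: (centsP abQ).
    move=> xx; case/negP: (pi'X x Xx); apply/eqP; apply: order2P nx1 _.
    by rewrite {1}xx mulVg.
  have: <<x ^: G>> \subset 'O_2^'(G).
    rewrite pcore_max ?/pgroup -?odd_2'nat // /normal sQG.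
    by rewrite norms_gen ?class_norm.
  by rewrite O1 => /subsetP/(_ x Qx); rewrite inE (negPf nx1).
have cX x : x \in X -> #|[set i in I | i * x \in I]| <= #|X|.
  move=> Xx; rewrite -ltnS cardX; apply: proper_card; apply/properP; split.
    by apply/subsetP=> i /setIdP[].
  have [i Ii nxi] := inj_all x Xx; exists i; rewrite // inE Ii mI // negbTE //.
have sumI : (#|I| * #|X|)%N = (\sum_(x in X) #|[set i in I | (i * x)%g \in I]|)%N.
  transitivity (\sum_(x in X) \sum_(i in I | (i * x)%g \in I) 1)%N; last first.
    by apply: eq_bigr => x Xx; rewrite -sum1_card; apply: eq_bigl => i; rewrite inE.
  rewrite (exchange_big_dep (mem I)) /=; last by move=> x i _ /andP[].
  rewrite -sum_nat_const; apply: eq_bigr => i Ii.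
  have -> : #|X| = #|I :\ i| by rewrite (cardsD1 i I) Ii in cardX; case: cardX.
  rewrite -(card_imset _ (mulgI i^-1)) -sum1_card; apply: eq_bigl => x.
  rewrite Ii /=; apply/imsetP/andP=> [[s /setD1P[nsi Is] ->] | [Xx Iix]].
    move: Is Ii; rewrite !inE => /andP[Gs /eqP os] /andP[Gi /eqP oi].
    rewrite mulKVg Gs os eqxx groupM ?groupV //= -eq_mulVg1 eq_sym nsi.
    rewrite involution_inv //; split=> //.
    by apply: (inverted_pi' Gi oi); rewrite ?groupM ?isolated_odd ?involution_mul_inv.
  exists (i * x); last by rewrite mulKg.
  rewrite !inE in Iix *; rewrite Iix andbT; apply: contraTneq Xx => ixi.
  by rewrite -(mulKg i x) ixi mulVg !inE eqxx.
have X_gt0 : 0 < #|X|.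
  rewrite -ltnS cardX ltn_neqAle eq_sym; apply/andP; split.
    apply: contra ncC => /eqP I1; rewrite eqEcard subsetIl /=.
    by rewrite cardG_I I1 mul1n.
  by rewrite -cardX.
have: (\sum_(x in X) #|[set i in I | (i * x)%g \in I]| <= #|X| * #|X|)%N.
  by rewrite -sum_nat_const leq_sum.
by rewrite -sumI -cardX leq_pmul2r // ltnn.
Qed.


End IsolatedInvolution.

Lemma commuting_involutions_eqS (gT : finGroupType) (G H : {group gT}) :
  H \subset G -> commuting_involutions_eq G -> commuting_involutions_eq H.
Proof. by move=> /subsetP sHG eqG s t Hs Ht; apply: eqG; apply: sHG. Qed.

Lemma quotient_pcore_triv (gT : finGroupType) (p : nat_pred) (G : {group gT}) :
  'O_p(G / 'O_p(G)) = 1.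
Proof. by apply: trivg_pcore_quotient. Qed.

Lemma order_coset_involution (gT : finGroupType) (N : {group gT}) t :
  t \in 'N(N) -> odd #|N| -> #[t] = 2 -> #[coset N t] = 2.
Proof.
move=> Nt oN ot; apply: order2P.
  apply: contraL oN => /eqP/(coset_idr Nt) /order_dvdG.
  by rewrite ot dvdn2.
by rewrite -morphM // involution_mulK // morph1.
Qed.

(** A case of Glauberman's Z*-theorem. With a nontrivial odd core, induction applies to the quotient
    and coprime action lifts the centralizer. *)
Theorem involution_core_cent (gT : finGroupType) (G : {group gT}) t :
    odd_cyclic G -> commuting_involutions_eq G -> t \in G -> #[t] = 2 ->
  'O_2^'(G) * 'C_G[t] = G.
Proof.
have [n] := ubnP #|G|; elim: n gT G t => // n IH gT G t leGn cG eqG Gt ot.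
have [O1 | ntO] := eqVneq 'O_2^'(G) 1.
  rewrite O1 mul1g; apply/eqP; apply: contraT => ncC; exfalso.
  apply: (isolated_central_false cG eqG Gt ot _ O1 ncC) => H i prHG Hi oi.
  have sHG := proper_sub prHG.
  apply: IH => //; first exact: leq_trans (proper_card prHG) _.
    exact: odd_cyclicS cG.
  exact: commuting_involutions_eqS eqG.
pose O := 'O_2^'(G)%G; have nsO: O <| G := pcore_normal _ _.
have oO: odd #|O| := odd_core G.
have nOt: t \in 'N(O) by rewrite (subsetP (normal_norm nsO)).
have := IH _ (G / O)%G (coset O t).
rewrite /= quotient_pcore_triv mul1g => defC.
have {}defC : 'C_(G / O)[coset O t] = G / O.
  apply: defC.
  - by apply: leq_trans (ltn_quotient ntO (normal_sub nsO)) _.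
  - exact: odd_cyclic_quotient.
  - exact: commuting_involutions_eq_quotient.
  - exact: mem_quotient.
  - exact: order_coset_involution.
have coOt: coprime #|O| #|<[t]>| by rewrite -orderE ot coprime2.
have nGt: <[t]> \subset 'N(G) by rewrite cycle_subG (subsetP (normG G)).
have nOct: <[t]> \subset 'N(O) by rewrite cycle_subG.
have := coprime_norm_quotient_cent nGt nOct coOt (odd_cyclic_sol oO (odd_cyclicS (normal_sub nsO) cG)).
rewrite quotient_cycle // !cent_cycle defC => defQ.
apply/eqP; rewrite eqEsubset mul_subG ?subsetIl ?pcore_sub //=.
rewrite -quotientSK ?normal_norm //.
by rewrite /= -/O -defQ.
Qed.

(** * Reduction to a dihedral Sylow 2-subgroup *)

Lemma grank2P (gT : finGroupType) (G : {group gT}) :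
  reflect (exists x y, [/\ x \in G, y \in G & <<[set x; y]>> = G]) ('m(G) <= 2).
Proof.
apply: (iffP idP) => [m2 | [x [y [_ _ <-]]]]; last first.
  by apply: leq_trans (grank_min _) _; rewrite cards2; case: eqP.
have [B defG cardB] := grank_witness G; move: m2; rewrite -cardB -defG => {cardB defG}.
rewrite cardE; have: B =i enum B by move=> x; rewrite mem_enum.
case: (enum B) => [|x [|y [|//]]] defB _.
- have -> : B = set0 by apply/setP=> x; rewrite defB inE.
  by exists 1, 1; rewrite !group1 setUid gen0 genGid.
- have -> : B = [set x] by apply/setP=> y; rewrite defB !inE.
  by exists x, x; rewrite setUid cycle_id.
have -> : B = [set x; y] by apply/setP=> z; rewrite defB !inE.
by exists x, y; rewrite !mem_gen // !inE eqxx ?orbT.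
Qed.

Lemma gen_pair_quotient (gT : finGroupType) (G A : {group gT}) x y :
    A <| G -> x \in G -> y \in G -> <<[set coset A x; coset A y]>> = G / A ->
  A * <<[set x; y]>> = G.
Proof.
move=> nsAG Gx Gy defGA; have [sAG nAG] := andP nsAG.
have sYG: [set x; y] \subset G by apply/subsetP=> w /set2P[] ->.
have nAY := subset_trans sYG nAG.
have defY : <<[set x; y]>> / A = G / A.
  by rewrite quotient_gen // quotientU !quotient_set1 ?(subsetP nAG) // -defGA.
apply/eqP; rewrite eqEsubset mul_subG ?gen_subG //=.
by rewrite -quotientSK // defY.
Qed.

(* Let A = <[a]>.  If no lift of the generators of G / A generates G, then <<x, y>> and
   <<x, y * a>> (or <<x * a, y>>, when x centralises A) are both complements of A.  The former
   two are conjugate under some g in A by Schur-Zassenhaus; g commutes with x, so g = 1, and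
   a lies in <<x, y>>. *)
Lemma grank_prime_quotient (gT : finGroupType) (p : nat) (G A : {group gT}) :
    odd_cyclic G -> prime p -> odd p -> A <| G -> #|A| = p ->
  'm(G / A) <= 2 -> 'm(G) <= 2.
Proof.
move=> cG p_pr op nsAG oA /grank2P[xb [yb [Gxb Gyb defGA]]]; have [sAG nAG] := andP nsAG.
have [[x Nx Gx def_x] [y Ny Gy def_y]] := (morphimP Gxb, morphimP Gyb).
have genA u v : u \in G -> v \in G -> coset A u = xb -> coset A v = yb ->
  A * <<[set u; v]>> = G.
  by move=> Gu Gv xu yv; apply: gen_pair_quotient; rewrite ?xu ?yv.
have genG u v (Y := <<[set u; v]>>%G) : u \in G -> v \in G -> coset A u = xb -> coset A v = yb ->
    'm(G) <= 2 \/ [/\ A :&: Y = 1, p^'.-group Y & Y \subset G].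
  move=> Gu Gv xu yv; have defG := genA u v Gu Gv xu yv.
  have sYG: Y \subset G by rewrite -defG mulG_subr.
  have [sAY | nsAY] := boolP (A \subset Y).
    by left; apply/grank2P; exists u, v; split=> //; rewrite -defG (mulSGid sAY).
  right; split=> //; first by apply: prime_TIg => //; rewrite oA.
  apply/pgroupP=> q q_pr q_dv; apply: contra nsAY => /eqP def_q.
  rewrite {q}def_q in q_pr q_dv *; have [b Yb ob] := Cauchy p_pr q_dv.
  have <- : <[b]> = A; last by rewrite cycle_subG.
  by apply: (odd_cyclic_normal_uniq cG p_pr op nsAG _ oA ob); rewrite cycle_subG (subsetP sYG).
have [// | [tiX p'X sXG]] := genG x y Gx Gy (esym def_x) (esym def_y).
set X := <<_>>%G in tiX p'X sXG.
have [Xx Xy] : x \in X /\ y \in X by rewrite !mem_gen ?inE ?eqxx ?orbT.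
have defG : A * X = G by apply: genA.
have [a defA] : exists a, A :=: <[a]>.
  by apply/cyclicP; rewrite prime_cyclic ?oA.
have oa : #[a] = p by rewrite orderE -defA.
have Aa : a \in A by rewrite defA cycle_id.
have Ga := subsetP sAG a Aa; have a1 := coset_id Aa; have Na := subsetP nAG a Ga.
have p'x : coprime #[a] #[x].
  by rewrite oa prime_coprime // -p'natE // (pnat_dvd (order_dvdG Xx)).
have [cxa | ncxa] := boolP (x \in 'C[a]).
  have xa : coset A (x * a) = xb by rewrite morphM //= a1 mulg1.
  have [// | [tiY _ _]] := genG (x * a) y (groupM Gx Ga) Gy xa (esym def_y).
  have: a ^+ #[x] = 1.
    apply: (TI_mem tiY); first by rewrite groupX.
    have <- : (x * a) ^+ #[x] = a ^+ #[x].
      rewrite expgMn; first by rewrite expg_order mul1g.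
      exact/cent1P.
    by rewrite groupX // mem_gen // !inE eqxx.
  move/eqP; rewrite -order_dvdn => dv.
  have := p'x; rewrite /coprime (gcdn_idPl dv) oa => /eqP p1.
  by rewrite p1 in p_pr.
have ya : coset A (y * a) = yb by rewrite morphM //= a1 mulg1.
have [// | [tiY p'Y sYG]] := genG x (y * a) Gx (groupM Gy Ga) (esym def_x) ya.
have defGY := genA x (y * a) Gx (groupM Gy Ga) (esym def_x) ya.
set Y := <<_>>%G in tiY p'Y sYG defGY.
have pA : p.-group A by rewrite /pgroup oA pnat_id.
have [g Ag defY] : exists2 g, g \in A & Y :=: X :^ g.
  apply: SchurZassenhaus_trans_sol.
  - by apply: abelian_sol; rewrite cyclic_abelian // prime_cyclic ?oA.
  - exact: subset_trans sXG nAG.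
  - by rewrite defG.
  - exact: pnat_coprime pA p'X.
  by apply/eqP; rewrite -(eqn_pmul2l (cardG_gt0 A)) -!TI_cardMg ?defG ?defGY.
have Yx : x \in Y by rewrite mem_gen // !inE eqxx.
have cgx : commute x g.
  apply/commute_sym; rewrite -[g]invgK; apply/commute_sym/commuteV/commgP.
  have Xxg : x ^ g^-1 \in X by rewrite -mem_conjg -defY.
  apply/eqP; apply: (TI_mem tiX); last by rewrite commgEl groupM ?groupV.
  by rewrite commgEr groupM ?groupV // memJ_norm ?groupV ?(subsetP nAG).
have ng1 : g = 1.
  apply/eqP; apply: contraR ncxa => ng1.
  have defAg : <[g]> = A.
    apply/eqP; rewrite eqEcard cycle_subG Ag oA dvdn_leq ?order_gt0 //.
    have: #[g] %| p by rewrite -oA order_dvdG.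
    by case/(primeP p_pr).2/pred2P => [/eqP | <- //]; rewrite order_eq1 (negPf ng1).
  rewrite -cent_cycle -defA -defAg cent_cycle; exact/cent1P.
have Xa : a \in X.
  rewrite -(groupMl a Xy) -[in X in _ \in X](conjsg1 X) -ng1 -defY mem_gen //.
  by rewrite !inE eqxx orbT.
by move: p_pr; rewrite -oa (TI_mem tiX Aa Xa) order1.
Qed.

(** A minimal normal subgroup of [G] inside the soluble [N] is elementary abelian and cyclic, hence
    of prime order; these are factored out one at a time. *)
Lemma grank_odd_quotient (gT : finGroupType) (G N : {group gT}) :
    odd_cyclic G -> N <| G -> odd #|N| -> 'm(G / N) <= 2 -> 'm(G) <= 2.
Proof.
have [n] := ubnP #|N|; elim: n gT G N => // n IH gT G N leNn cG nsNG oN mGN.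
have [N1 | ntN] := eqsVneq N 1.
  have /isog_grank <- // : G / N \isog G by rewrite N1 isog_sym quotient1_isog.
have [sNG nNG] := andP nsNG.
have [A minA sAN] := minnormal_exists ntN nNG.
have solN := odd_cyclic_sol oN (odd_cyclicS sNG cG).
have [nAG ntA /is_abelemP[p p_pr abA]] := minnormal_solvable minA sAN solN.
have pA := abelem_pgroup abA.
have [_ p_dv _] := pgroup_pdiv pA ntA.
have op : odd p by apply: dvdn_odd p_dv (oddSg sAN oN).
have sAG := subset_trans sAN sNG.
have oA : #|A| = p := cyclic_abelem_prime abA (cG p A op sAG pA) ntA.
have nsAG : A <| G by rewrite /normal sAG.
apply: (grank_prime_quotient cG p_pr op nsAG oA).
apply: (IH _ (G / A)%G (N / A)%G).
- by apply: leq_trans (ltn_quotient ntA sAN) _.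
- exact: odd_cyclic_quotient.
- exact: quotient_normal.
- exact: quotient_odd.
by have /isog_grank -> := third_isog sAN nsAG nsNG.
Qed.

(** The case [#[r] = 2] is allowed, so that Klein groups count as dihedral, while [2 %| #[r]] rules
    out [r = 1]. *)
Definition dihedral_gens (gT : finGroupType) (D : {set gT}) r s :=
  [/\ #[s] = 2, s \notin <[r]>, r ^ s = r^-1, 2 %| #[r] & <[r]> * <[s]> = D].

Lemma Ohm1_unique_involution (gT : finGroupType) (T : {group gT}) :
  2.-group T -> T :!=: 1 -> commuting_involutions_eq T -> #|'Ohm_1(T)| = 2.
Proof.
move=> tT ntT eqT.
have ntZ : 'Z(T) != 1 by rewrite center_nil_eq1 ?(pgroup_nil tT).
have [_ dv _] := pgroup_pdiv (pgroupS (center_sub T) tT) ntZ.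
have [z Zz oz] := Cauchy (isT : prime 2) dv.
have [Tz cTz] := setIP Zz.
suff -> : 'Ohm_1(T) = <[z]> by rewrite -orderE.
apply/eqP; rewrite (OhmE 1 tT) eqEsubset gen_subG cycle_subG.
rewrite mem_gen; last by rewrite !inE Tz -oz expg_order eqxx.
rewrite andbT; apply/subsetP=> x /LdivP[Tx x2].
have [-> | ntx] := eqVneq x 1; first exact: group1.
have ox : #[x] = 2 by apply: order2P => //; rewrite -[LHS]expg2.
by rewrite (eqT x z) ?cycle_id //; apply/commute_sym/(centP cTz).
Qed.

Lemma quaternion_quotient (gT : finGroupType) (T : {group gT}) n :
    n > 2 -> T \isog 'Q_(2 ^ n) -> 
  exists2 z, z \in 'Z(T) /\ #[z] = 2 & exists r s, dihedral_gens (T / <[z]>) r s.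
Proof.
move=> n2 isoT; have [[x y] genT [oy y2 xy]] := generators_quaternion n2 isoT.
have [[[/pprodP[_ defT _] _ _] _ [defZ oZ _ _ _] _ _]] := quaternion_structure n2 genT isoT.
have [_ Tx ox /setDP[Ty nxy]] := genT.
set z := x ^+ _ in y2 defZ; exists z.
  by rewrite defZ cycle_id orderE -defZ.
have nzT : T \subset 'N(<[z]>) by rewrite -defZ gFnorm.
have [Nx Ny] := (subsetP nzT x Tx, subsetP nzT y Ty).
have szx : <[z]> \subset <[x]> by rewrite cycleX.
exists (coset <[z]> x), (coset <[z]> y).
have nys : coset <[z]> y \notin <[coset <[z]> x]>.
  rewrite -quotient_cycle //; apply: contra nxy => /morphimP[u Nu xu /= eq_yu].
  have := mem_quotient <[z]> xu; rewrite -eq_yu.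
  by rewrite -sub1set -quotient_set1 // quotientSGK ?sub1set.
split=> //.
- apply: order2P; first by apply: contra nys => /eqP->; rewrite group1.
  by rewrite -morphM //= -[y * y]/(y ^+ 2) y2 coset_id ?cycle_id.
- by rewrite -morphJ // xy morphV.
- rewrite orderE -quotient_cycle // card_quotient ?(subset_trans _ nzT) ?cycle_subG //.
  rewrite -divgS // -!orderE ox orderE -defZ oZ.
  by clear -n2; case: n n2 => [|[|[|n]]] // _; rewrite !expnS mulKn // dvdn_mulr.
by rewrite -!quotient_cycle // -defT quotientMl ?cycle_subG.
Qed.

Lemma reduce_to_dihedral (gT : finGroupType) (G : {group gT}) :
    (forall (rT : finGroupType) (L D : {group rT}) r s, odd_cyclic L -> 'O_2^'(L) = 1 ->
       2.-Sylow(L) D -> dihedral_gens D r s -> 'm(L) <= 2) ->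
  odd_cyclic G -> commuting_involutions_eq G -> 'm(G) <= 2.
Proof.
move=> dih; wlog O1 : gT G / 'O_2^'(G) = 1 => [IH | cG eqG].
  move=> cG eqG; apply: (grank_odd_quotient cG (pcore_normal 2^' G) (odd_core G)).
  apply: IH; first exact: quotient_pcore_triv.
    exact: odd_cyclic_quotient (pcore_normal _ _) cG.
  exact: commuting_involutions_eq_quotient (pcore_normal _ _) (odd_core G) eqG.
have [T sylT] := Sylow_exists 2 G; have [sTG tT _] := and3P sylT.
have [T1 | ntT] := eqVneq T 1%G.
  have oG : 2^'.-group G by rewrite -partG_eq1 -(card_Hall sylT) T1 cards1.
  have G1 : G :=: 1 by rewrite -(pcore_pgroup_id oG).
  by apply/grank2P; exists 1, 1; split=> //; rewrite setUid G1; exact: cycle1.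
have eqT := commuting_involutions_eqS sTG eqG.
have /(prime_Ohm1P tT ntT)/orP[cT | /andP[_ /eqP/quaternion_classP[n n2 isoT]]] :=
  Ohm1_unique_involution tT ntT eqT.
  have := cyclic_Sylow2_complement sylT cT; rewrite O1 mul1g => <-.
  have /cyclicP[x ->] := cT; apply/grank2P; exists x, x.
  by rewrite setUid cycle_id.
have [z [/setIP[Tz _] oz] [r [s dihr]]] := quaternion_quotient n2 isoT.
have Gz := subsetP sTG z Tz.
have cz : G \subset 'C(<[z]>).
  have := involution_core_cent cG eqG Gz oz; rewrite O1 mul1g cent_cycle => <-.
  exact: subsetIr.
have nsz : <[z]> <| G by rewrite /normal cycle_subG Gz cents_norm.
have nzG := normal_norm nsz.
have tz : 2.-group <[z]> by rewrite /pgroup -orderE oz.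
have sylD : 2.-Sylow(G / <[z]>) (T / <[z]>) by apply: quotient_pHall; rewrite ?(subset_trans sTG).
(* The preimage [H] of the odd core has [<[z]>] as Sylow 2-subgroup, so it has a normal
   2-complement, which lies in ['O_2^'(G) = 1]. *)
have coreL : 'O_2^'(G / <[z]>) = 1.
  have [H defH szH sHG] := inv_quotientS nsz (pcore_sub 2^' (G / <[z]>)).
  have nsHG : H <| G.
    by rewrite -(quotientGK nsz) -(quotientGK (normalS szH sHG nsz)) -defH cosetpre_normal pcore_normal.
  have nszH := normalS szH sHG nsz.
  have sylz : 2.-Sylow(H) <[z]>.
    rewrite pHallE szH /= -(Lagrange szH) -card_quotient ?normal_norm // -defH.
    by rewrite partnM // part_pnat_id // part_p'nat ?muln1 //; apply: pcore_pgroup.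
  have OH1 : 'O_2^'(H) = 1.
    apply/trivgP; rewrite -O1 pcore_max ?pcore_pgroup //.
    exact: gFnormal_trans.
  have := cyclic_Sylow2_complement sylz (cycle_cyclic z).
  by rewrite OH1 mul1g defH => <-; rewrite trivg_quotient.
have /grank2P[xb [yb [Gxb Gyb defL]]] := dih _ _ _ r s (odd_cyclic_quotient nsz cG) coreL sylD dihr.
have [[x Nx Gx def_x] [y Ny Gy def_y]] := (morphimP Gxb, morphimP Gyb).
have defG : <[z]> * <<[set x; y]>> = G.
  by apply: gen_pair_quotient; rewrite -?def_x -?def_y.
have sXG : <<[set x; y]>> \subset G by rewrite -defG mulG_subr.
apply/grank2P; exists x, y; split=> //.
(* Otherwise [x] and [y] span a complement of [<[z]>], of even order like the quotient; an
   involution of it would commute with [z] and differ from it. *)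
rewrite -[RHS]defG mulSGid // cycle_subG; apply: contraT => nXz.
have tiX : <[z]> :&: <<[set x; y]>> = 1.
  by apply: prime_TIg; rewrite -?orderE ?oz // cycle_subG.
have [_ dvs _ dvr _] := dihr.
have ev : 2 %| #|<<[set x; y]>>|.
  have -> : #|<<[set x; y]>>| = #|G / <[z]>|.
    by rewrite card_quotient // -divgS ?normal_sub // -defG TI_cardMg // mulKn ?order_gt0.
  apply: dvdn_trans dvr (order_dvdG _).
  apply: (subsetP (pHall_sub sylD)); case: dihr => _ _ _ _ <-.
  by rewrite (subsetP (mulG_subl _ _)) ?cycle_id.
have [i Xi oi] := Cauchy (isT : prime 2) ev.
have czi : commute z i.
  by apply/cent1P; rewrite cent1C -cent_cycle (subsetP cz) ?(subsetP sXG).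
by case/negP: nXz; rewrite (eqG z i Gz (subsetP sXG i Xi) oz oi czi).
Qed.

(** * Dihedral Sylow 2-subgroups and fusion *)

Section DihedralGens.

Variables (gT : finGroupType) (D : {group gT}) (r s : gT).
Hypothesis dihD : dihedral_gens D r s.

Lemma dihedral_mem_r : r \in D.
Proof. by case: dihD => _ _ _ _ <-; rewrite (subsetP (mulG_subl _ _)) ?cycle_id. Qed.

Lemma dihedral_mem_s : s \in D.
Proof. by case: dihD => _ _ _ _ <-; rewrite (subsetP (mulG_subr _ _)) ?cycle_id. Qed.

Lemma dihedral_norm : D \subset 'N(<[r]>).
Proof.
case: dihD => _ _ rs _ <-; rewrite mul_subG ?normG //.
by rewrite norms_cycle rs groupV cycle_id.
Qed.

Lemma dihedral_notin d : d \in D -> d \notin <[r]> -> exists2 k, k \in <[r]> & d = k * s.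
Proof.
case: dihD => os _ _ _ <- /mulsgP[k u rk]; rewrite cycle2g // => /set2P[] -> ->.
  by rewrite mulg1 rk.
by exists k.
Qed.

Lemma dihedral_reflection d : d \in D -> d \notin <[r]> -> #[d] = 2 /\ r ^ d = r^-1.
Proof.
move=> Dd rd; have [k rk def_d] := dihedral_notin Dd rd; have [os _ rs _ _] := dihD.
have ks : k ^ s = k^-1 by have /cycleP[n ->] := rk; apply: conj_inv_exp.
split; last first.
  have crk : commute r k by have /cycleP[n ->] := rk; apply: commuteX.
  by rewrite def_d conjgM (commute_conjg crk).
apply: order2P; first by apply: contraNneq rd => ->; apply: group1.
have -> : d * d = k * (s^-1 * (k * s)) by rewrite def_d (involution_inv os) !mulgA.
by rewrite -conjgE ks mulgV.
Qed.

Lemma card_dihedral_gens : #|D| = (2 * #[r])%N.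
Proof.
have [os rs _ _ <-] := dihD.
rewrite TI_cardMg -?orderE ?os 1?mulnC // setIC; apply: prime_TIg; rewrite -?orderE ?os //.
by rewrite cycle_subG.
Qed.

Lemma dihedral_change d : d \in D -> d \notin <[r]> -> dihedral_gens D r d.
Proof.
move=> Dd rd; have [od rdi] := dihedral_reflection Dd rd.
have [os rs rsi ev defD] := dihD; split=> //.
apply/eqP; rewrite eqEcard mul_subG ?cycle_subG ?dihedral_mem_r //= card_dihedral_gens.
rewrite TI_cardMg -?orderE ?od 1?mulnC // setIC; apply: prime_TIg; rewrite -?orderE ?od //.
by rewrite cycle_subG.
Qed.

Lemma dihedral_involution_rot u t : u \in <[r]> -> t \in <[r]> -> #[u] = 2 -> #[t] = 2 -> u = t.
Proof.
move=> ru rt ou ot.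
have /eqP eq_ut : <[u]> == <[t]>.
  by rewrite (eq_subG_cyclic (cycle_cyclic r)) ?cycle_subG // -!orderE ou ot.
have : u \in <[t]> by rewrite -eq_ut cycle_id.
by rewrite cycle2g // => /set2P[u1 | //]; rewrite u1 order1 in ou.
Qed.

Lemma dihedral_center t d : t \in <[r]> -> #[t] = 2 -> d \in D -> commute t d.
Proof.
move=> rt ot Dd; have [rd | rd] := boolP (d \in <[r]>).
  have /cycleP[i ->] := rt; have /cycleP[j ->] := rd; exact: commuteX2.
have [_ rdi] := dihedral_reflection Dd rd.
have td : t ^ d = t^-1 by have /cycleP[n ->] := rt; apply: conj_inv_exp.
by apply/commgP/conjg_fixP; rewrite td involution_inv.
Qed.

End DihedralGens.

(* N is the kernel of the transfer into D / <[r]>. *)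
Lemma dihedral_transfer_ker (gT : finGroupType) (X D : {group gT}) r s t :
    2.-Sylow(X) D -> dihedral_gens D r s -> t \in <[r]> -> #[t] = 2 ->
  exists N : {group gT}, [/\ N <| X, 2.-group (X / N)
    & forall d, d \in D -> d \notin <[r]> -> (forall x, x \in X -> d ^ x != t) -> d \notin N].
Proof.
move=> sylD dihD rt ot; have [sDX tD t'XD] := and3P sylD.
have nrD := dihedral_norm dihD; have [os rs _ _ _] := dihD.
have Ds := dihedral_mem_s dihD.
have cardQ : #|D / <[r]>| = 2.
  rewrite card_quotient // -divgS ?cycle_subG ?(dihedral_mem_r dihD) //.
  by rewrite (card_dihedral_gens dihD) -orderE mulnK ?order_gt0.
pose alpha := restrm nrD (coset <[r]>).
have imA : alpha @* D = D / <[r]> by rewrite morphim_restrm setIid.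
have abelA: abelian (alpha @* D) by rewrite imA cyclic_abelian // prime_cyclic // cardQ.
pose V := transfer_morphism X abelA.
have PfA y: y \in D -> alpha y \in alpha @* D by move=> Dy; apply: mem_morphim.
pose fm := FiniteModule.fmod abelA.
have Vexp d : d \in D -> d \notin <[r]> -> (forall x, x \in X -> d ^ x != t) ->
    V d = fm (alpha s).
  move=> Dd rd ndt; have Xd := subsetP sDX d Dd.
  have [X' trX] : exists X', is_transversal X' (rcosets D X :* <[d]>) X.
    exists (transversal (rcosets D X :* <[d]>) X).
    exact: (transversalP (rcosets_cycle_partition sDX Xd)).
  have [od _] := dihedral_reflection dihD Dd rd.
  have alpha_eq u : u \in D -> u \notin <[r]> -> alpha u = alpha s.
    move=> Du ru; rewrite /alpha /restrm /=.
    have Nu := subsetP nrD u Du; have Ns := subsetP nrD s Ds.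
    have nt v : v \in D -> v \notin <[r]> -> coset <[r]> v \in (D / <[r]>)^#.
      move=> Dv rv; rewrite !inE mem_quotient // andbT; apply: contra rv => /eqP.
      by apply: coset_idr; apply: subsetP nrD v Dv.
    have /cards1P[q defQ] : #|(D / <[r]>)^#| == 1%N.
      by have := cardsD1 1 (D / <[r]>); rewrite group1 cardQ add1n => /eqP; rewrite eqSS eq_sym.
    have := nt u Du ru; have := nt s Ds rs; rewrite defQ => /set1P-> /set1P->.
    by [].
  have as2 : alpha s ^+ 2 = 1.
    by rewrite -morphX //= expg2 involution_mulK // [LHS](morph1 (coset_morphism <[r]>)).
  rewrite [V d](transfer_cycle_expansion sDX abelA Xd trX).
  (* The orbit lengths of [d] on cosets sum to the odd index of [D], so this power can be split
     along the orbits. *)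
  have -> : alpha s = alpha s ^+ #|X : D|.
    have := odd_double_half #|X : D|; rewrite odd_2'nat t'XD add1n => <-.
    by rewrite expgS -mul2n expgM as2 expg1n mulg1.
  rewrite -(sum_index_rcosets_cycle sDX Xd trX) /fm FiniteModule.fmodX ?PfA //.
  rewrite -ssralg.GRing.sumrMnr; apply: eq_bigr => x X'x.
  have Gx: x \in X by apply: subsetP (transversal_sub trX) _ X'x.
  (* [n] is an orbit length. If [n = 1], the conjugate of [d] lies outside [<[r]>], whose only
     involution is [t]; if [n = 2], both sides vanish, as [d] and [alpha s] square to 1. *)
  set n := #|_ : _|.
  have n_le2 : n <= 2 by rewrite -od orderE /n /indexg leq_imset_card.
  have n_gt0 : 0 < n by rewrite indexg_gt0.
  have Dx : (d ^+ n) ^ x^-1 \in D.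
    by rewrite conjgE invgK mulgA -mem_rcoset; apply: mulg_exp_card_rcosets.
  rewrite -FiniteModule.fmodX ?PfA //=.
  have [n1 | n2] : n = 1%N \/ n = 2 by move: n n_le2 n_gt0 {Dx} => [|[|[|?]]]; auto.
    rewrite n1 in Dx *; rewrite !expg1 in Dx *.
    apply: (congr1 (FiniteModule.fmod abelA)); apply: alpha_eq => //.
    apply: contra (ndt x^-1 _) => [rdx|]; last by rewrite groupV.
    by apply/eqP; apply: dihedral_involution_rot rdx rt _ ot; rewrite orderJ.
  rewrite n2 {1}expg2 involution_mulK // conj1g as2.
  by apply: (congr1 (FiniteModule.fmod abelA)); apply: (morph1 alpha).
pose N := 'ker V.
have nsN: N <| X by apply: ker_normal.
have tV: 2.-group (V @* X).
  have sV: V @* X \subset FiniteModule.fmod_morphism abelA @* (alpha @* D).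
    apply/subsetP=> u _; rewrite -(FiniteModule.fmvalK u).
    by apply: (mem_morphim (FiniteModule.fmod_morphism abelA));
      apply: FiniteModule.fmodP.
  by apply: pgroupS sV _; rewrite !morphim_pgroup.
exists N; split=> //; first by rewrite /pgroup (card_isog (first_isog _)).
move=> d Dd rd ndt; apply/negP=> Nd.
have := Vexp d Dd rd ndt; rewrite (mker Nd) => e0.
have := congr1 (FiniteModule.fmval (abelA := abelA)) (esym e0).
rewrite /fm FiniteModule.fmodK ?PfA //= => a1.
by case/negP: rs; apply: coset_idr a1; apply: subsetP nrD s Ds.
Qed.

(** When no reflection is conjugate to [t], the transfer kernel meets [D] inside the cyclic [<[r]>];
    it has a normal 2-complement, which is one for [X] because the quotient is a 2-group. *)
Lemma dihedral_transfer (gT : finGroupType) (X D : {group gT}) r s t :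
    2.-Sylow(X) D -> dihedral_gens D r s -> t \in <[r]> -> #[t] = 2 ->
    (forall x d, x \in X -> d \in D -> d \notin <[r]> -> d ^ x != t) ->
  2^'.-Hall(X) 'O_2^'(X).
Proof.
move=> sylD dihD rt ot ndt; have [N [nsN tN nN]] := dihedral_transfer_ker sylD dihD rt ot.
have sND : N :&: D \subset <[r]>.
  apply/subsetP=> d /setIP[Nd Dd]; apply: contraLR Nd => rd.
  by apply: nN => // x Xx; apply: ndt.
have sylN : 2.-Sylow(N) (N :&: D) := Sylow_setI_normal nsN sylD.
have hN : 2^'.-Hall(N) 'O_2^'(N).
  by apply: normal_complement_pdiv sylN (cyclicS sND (cycle_cyclic r)) _ => q /prime_gt1.
have nsO : 'O_2^'(N) <| X by apply: gFnormal_trans.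
have hX : 2^'.-Hall(X) 'O_2^'(N).
  rewrite pHallE normal_sub //= (card_Hall hN) -(Lagrange (normal_sub nsN)) partnM //.
  rewrite -card_quotient ?normal_norm //.
  by rewrite [X in (_ * X)%N]part_p'nat ?muln1 // pnatNK.
by rewrite (normal_Hall_pcore hX nsO).
Qed.

Lemma odd_Hall_prod (gT : finGroupType) (X D : {group gT}) :
  2.-Sylow(X) D -> 2^'.-Hall(X) 'O_2^'(X) -> 'O_2^'(X) * D = X.
Proof.
by move=> sylD hX; have /(sdprod_normal_pHallP (pcore_normal _ _) sylD)/sdprodP[] := hX.
Qed.

(** * Strongly embedded subgroups *)

Lemma mulg_involution_sqr (gT : finGroupType) (k u : gT) :
  #[u] = 2 -> k * u * (k * u) = k * k ^ u.
Proof. by move=> ou; rewrite conjgE (involution_inv ou) !mulgA. Qed.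

Section Klein.

Variables (gT : finGroupType) (a b : gT).
Hypotheses (oa : #[a] = 2) (ob : #[b] = 2) (cab : commute a b) (nab : a != b).

Lemma klein_involution : #[a * b] = 2.
Proof.
apply: order2P; first by rewrite -{1}(involution_inv oa) -eq_mulVg1.
by rewrite mulg_involution_sqr // (commute_conjg cab) involution_mulK.
Qed.

Lemma klein_mem x : x \in <[a]> <*> <[b]> -> [\/ x = 1, x = a, x = b | x = a * b].
Proof.
rewrite cent_joinEr; last first.
  by rewrite cent_cycle cycle_subG; apply/cent1P/commute_sym.
case/mulsgP=> u v; rewrite /= !cycle2g // => /set2P[] -> /set2P[] -> ->.
- by rewrite mulg1; apply: Or41.
- by rewrite mul1g; apply: Or43.
- by rewrite mulg1; apply: Or42.
by apply: Or44.
Qed.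

Lemma klein_abelian : abelian (<[a]> <*> <[b]>).
Proof.
rewrite abelianY !cycle_abelian /= cent_cycle cycle_subG; apply/cent1P/commute_sym.
exact: cab.
Qed.

Lemma card_klein : #|<[a]> <*> <[b]>| = 4.
Proof.
rewrite cent_joinEr; last first.
  by rewrite cent_cycle cycle_subG; apply/cent1P/commute_sym.
rewrite TI_cardMg -?orderE ?oa ?ob //; apply: prime_TIg; rewrite -?orderE ?oa //.
by rewrite cycle_subG /= cycle2g // !inE negb_or nab andbT -order_eq1 oa.
Qed.

Lemma klein_noncyclic : ~~ cyclic (<[a]> <*> <[b]>).
Proof.
apply/negP=> cV; case/eqP: nab.
have /eqP eq_ab : <[a]> == <[b]>.
  by rewrite (eq_subG_cyclic cV) ?joing_subl ?joing_subr // -!orderE oa ob.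
have : a \in <[b]> by rewrite -eq_ab cycle_id.
by rewrite cycle2g // => /set2P[a1 | //]; have := oa; rewrite a1 order1.
Qed.

(** [O] is ['C_O[a]] times a group inverted by [a]; in the latter, the part centralized by [b] is in
    ['C_O[b]] and the part inverted by [b] is centralized by [a * b]. *)
Lemma klein_cent_gen (O H : {group gT}) :
    odd #|O| -> odd_cyclic O -> a \in 'N(O) -> b \in 'N(O) ->
    'C_O[a] \subset H -> 'C_O[b] \subset H -> 'C_O[a * b] \subset H ->
  O \subset H.
Proof.
move=> oO cO Na Nb Ca Cb Cab.
have [_ nsZ defO _ memZ] := odd_cyclic_involution_act oO cO Na oa.
set Z := [~: O, <[a]>]%G in nsZ defO memZ; have [sZO _] := andP nsZ.
have NbZ : b \in 'N(Z).
  have Nba : b \in 'N(<[a]>) by rewrite (subsetP (cent_sub _)) // cent_cycle; apply/cent1P/commute_sym.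
  by rewrite -cycle_subG normsR // cycle_subG.
have [_ _ defZ _ memZb] := odd_cyclic_involution_act (oddSg sZO oO) (odd_cyclicS sZO cO) NbZ ob.
rewrite -defO mul_subG // -defZ mul_subG //; last first.
  by apply: subset_trans Cb; apply: setSI.
apply/subsetP=> x Zbx; have Zx : x \in Z.
  by apply: subsetP Zbx; rewrite commg_subl cycle_subG.
apply: (subsetP Cab); rewrite in_setI (subsetP sZO) // cent1C cent1C mem_cent1E conjgM.
have /eqP -> : x ^ a == x^-1 by rewrite -memZ // (subsetP sZO).
have /eqP xb : x ^ b == x^-1 by rewrite -memZb.
by rewrite conjVg xb invgK eqxx.
Qed.

End Klein.

Section StronglyEmbedded.

Variables (gT : finGroupType) (M K : {group gT}) (t s : gT).
Hypotheses (cM : odd_cyclic M) (sKM : K \subset M).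
Hypothesis conjM : forall a b, a \in M -> b \in M -> #[a] = 2 -> #[b] = 2 ->
  exists2 g, g \in M & b = a ^ g.
Hypothesis conjK : forall a b, a \in K -> b \in K -> #[a] = 2 -> #[b] = 2 ->
  exists2 g, g \in K & b = a ^ g.
Hypothesis centK : forall i, i \in K -> #[i] = 2 -> 'C_M[i] \subset K.
Hypotheses (Kt : t \in K) (ot : #[t] = 2) (Ks : s \in K) (os : #[s] = 2).
Hypotheses (cts : commute t s) (nts : t != s).

(** [J] consists of all the involutions of [K]. For an involution [u] outside [K], [A u] turns out
    to be the set of elements of [K] inverted by [u], so its order counts the involutions of the
    coset [K :* u]. *)
Local Notation J := (t ^: K).
Local Notation E u := (K :&: K :^ u)%G.
Local Notation A u := [~: K :&: K :^ u, <[u]>]%G.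

Let cK : odd_cyclic K := odd_cyclicS sKM cM.

Lemma se_cent i x : i \in K -> #[i] = 2 -> x \in M -> commute i x -> x \in K.
Proof.
move=> Ki oi Mx cix; apply: (subsetP (centK Ki oi)); rewrite inE Mx.
exact/cent1P/commute_sym.
Qed.

Lemma se_class i : (i \in J) = (i \in K) && (#[i] == 2).
Proof.
apply/imsetP/andP=> [[g Kg ->] | [Ki /eqP oi]]; last exact: conjK.
by rewrite groupJ // orderJ ot.
Qed.

Lemma se_odd_mul i u : i \in K -> #[i] = 2 -> u \in M -> #[u] = 2 -> u \notin K -> odd #[i * u].
Proof.
move=> Ki oi Mu ou Ku; apply: contraR Ku => ev.
have [w [w_iu ow cwi cwu]] := even_involutions_central ou oi ev.
have Mw: w \in M.
  by apply: subsetP w_iu; rewrite cycle_subG groupM // (subsetP sKM).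
exact: se_cent (se_cent Ki oi Mw (commute_sym cwi)) ow Mu cwu.
Qed.

(** For an involution [i] of [E u], the square [(i * u) ^+ 2 = i * i ^ u] lies in [K]; as [i * u]
    has odd order, it lies in [K], and so would [u]. *)
Lemma se_inter_odd u : u \in M -> #[u] = 2 -> u \notin K -> odd #|E u|.
Proof.
move=> Mu ou Ku; apply: contraT; rewrite -dvdn2 => /(Cauchy (isT : prime 2))[i].
rewrite inE mem_conjg (involution_inv ou) => /andP[Ki Kiu] oi.
have odu := se_odd_mul Ki oi Mu ou Ku.
case/negP: Ku; rewrite -(groupMl u Ki); apply: odd_sqr_mem odu _.
have -> : (i * u) ^+ 2 = i * i ^ u by rewrite expg2 conjgE (involution_inv ou) !mulgA.
exact: groupM.
Qed.

Section Outside.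

Variable u : gT.
Hypotheses (Mu : u \in M) (ou : #[u] = 2) (Ku : u \notin K).

Let cE : odd_cyclic (E u).
Proof. by apply: odd_cyclicS cK; apply: subsetIl. Qed.

Lemma se_norm : u \in 'N(E u).
Proof.
have uu : u * u = 1 := involution_mulK ou.
by apply/normP; rewrite /= conjIg -conjsgM uu conjsg1 setIC.
Qed.

Let facts := odd_cyclic_involution_act (se_inter_odd Mu ou Ku) cE se_norm ou.

Lemma se_A_cyclic : cyclic (A u). Proof. by case: facts. Qed.

Lemma se_A_normal : A u <| E u. Proof. by case: facts. Qed.

Lemma se_A_prod : A u * 'C_(E u)[u] = E u. Proof. by case: facts. Qed.

Lemma se_A_coprime : coprime #|A u| #|'C_(E u)[u]|. Proof. by case: facts. Qed.

Lemma se_A_sub : A u \subset K.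
Proof. exact: subset_trans (normal_sub se_A_normal) (subsetIl _ _). Qed.

Lemma se_mem_A x : (x \in A u) = (x \in K) && (x ^ u == x^-1).
Proof.
apply/idP/andP=> [Ax | [Kx xu]].
  have Ex := subsetP (normal_sub se_A_normal) x Ax.
  rewrite (subsetP se_A_sub) //; case: facts => _ _ _ _ <- //.
have Ex : x \in E u.
  rewrite inE Kx mem_conjg (involution_inv ou) (eqP xu) groupV //.
by case: facts => _ _ _ _ ->.
Qed.

Lemma se_A_odd : odd #|A u|.
Proof. exact: oddSg (normal_sub se_A_normal) (se_inter_odd Mu ou Ku). Qed.

(** [i] and [u] are conjugate under [<[i * u]>], which normalizes [<[x]>] when [i] centralizes [x];
    then [u] would both centralize and invert [x]. *)
Lemma se_inverted_cent x i : x \in M -> odd #[x] -> x != 1 -> x ^ u = x^-1 ->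
  i \in K -> #[i] = 2 -> ~ commute i x.
Proof.
move=> Mx ox nx xu Ki oi cix.
have odu := se_odd_mul Ki oi Mu ou Ku.
have [y y_iu def_u] := odd_involutions_conj ou oi odu.
have Ni : i \in 'N(<[x]>).
  rewrite (subsetP (cent_sub _)) // cent_cycle; exact/cent1P.
have Nu : u \in 'N(<[x]>).
  by rewrite -cycle_subG norms_cycle xu groupV cycle_id.
have Ny : y \in 'N(<[x]>).
  by apply: subsetP y_iu; rewrite cycle_subG groupM.
have : u \in 'C(<[x]>).
  rewrite def_u -(normP Ny) centJ memJ_conjg cent_cycle; exact/cent1P.
rewrite cent_cycle => /cent1P/commute_sym/commute_conjg; rewrite xu => x1.
have ox2 : #[x] = 2 by apply: order2P => //; rewrite -{1}x1 mulVg.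
by rewrite ox2 in ox.
Qed.

Lemma se_A_cent1 x i : x \in A u -> i \in K -> #[i] = 2 -> commute i x -> x = 1.
Proof.
move=> Ax Ki oi cix; apply/eqP; apply: contraT => nx.
have := Ax; rewrite se_mem_A => /andP[Kx /eqP xu].
have ox : odd #[x] := dvdn_odd (order_dvdG Ax) se_A_odd.
by case: (se_inverted_cent (subsetP sKM x Kx) ox nx xu Ki oi cix).
Qed.

Lemma se_A_inj i : i \in K -> #[i] = 2 -> {in A u &, injective (conjg i)}.
Proof.
move=> Ki oi x y Ax Ay eq_xy; apply/eqP; rewrite eq_mulgV1; apply/eqP.
apply: (se_A_cent1 _ Ki oi); first by rewrite groupM ?groupV.
by apply/commgP/conjg_fixP; rewrite conjgM eq_xy conjgK.
Qed.

Lemma se_A_le : #|A u| <= #|J|.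
Proof.
rewrite -(card_in_imset (se_A_inj Kt ot)) subset_leq_card //.
apply/subsetP=> _ /imsetP[x Ax ->]; apply: imset_f.
exact: subsetP se_A_sub x Ax.
Qed.

Lemma se_coset_count : #|[set v in K :* u | #[v] == 2]| = #|A u|.
Proof.
rewrite -(card_imset (A u) (mulIg u)); apply: eq_card => v.
rewrite inE; apply/andP/imsetP=> [[/rcosetP[k Kk ->] /eqP oku] | [k Ak ->]].
  exists k => //; rewrite se_mem_A Kk /= conjgE (involution_inv ou) eq_sym eq_invg_mul.
  by rewrite mulgA involution_mulK.
have := Ak; rewrite se_mem_A => /andP[Kk /eqP ku].
rewrite mem_rcoset mulgK Kk; split=> //; apply/eqP; apply: order2P.
  by apply: contra Ku => /eqP/(canRL (mulKg k)); rewrite mulg1 => ->; rewrite groupV.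
by rewrite mulg_involution_sqr // ku mulgV.
Qed.

End Outside.

Let cardK : #|K| = (#|J| * #|'C_M[t]|)%N.
Proof.
have -> : 'C_M[t] = 'C_K[t].
  by apply/eqP; rewrite eqEsubset subsetI subsetIr centK // setSI.
by rewrite -index_cent1 mulnC Lagrange // subsetIl.
Qed.

Let cardM : #|M| = (#|[set v in M | #[v] == 2]| * #|'C_M[t]|)%N.
Proof.
have -> : [set v in M | #[v] == 2] = t ^: M.
  apply/setP=> v; rewrite inE; apply/andP/imsetP=> [[Mv /eqP ov] | [g Mg ->]].
    exact: conjM (subsetP sKM t Kt) Mv ot ov.
  by split; rewrite ?orderJ ?ot // groupJ // (subsetP sKM).
by rewrite -index_cent1 mulnC Lagrange // subsetIl.
Qed.

Lemma se_coset_le X : X \in rcosets K M -> #|[set v in X | #[v] == 2]| <= #|J|.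
Proof.
case/rcosetsP=> g Mg ->; have [Kg | nKg] := boolP (g \in K).
  rewrite rcoset_id //; apply: subset_leq_card; apply/subsetP=> v.
  by rewrite inE se_class.
have [-> | /set0Pn[u]] := eqVneq [set v in K :* g | #[v] == 2] set0.
  by rewrite cards0.
rewrite inE => /andP[Kgu /eqP ou]; have /rcosetP[k Kk def_u] := Kgu.
have Mu : u \in M by rewrite def_u groupM // (subsetP sKM).
have Ku : u \notin K by rewrite def_u groupMl.
have -> : K :* g = K :* u by apply/esym/rcoset_eqP.
by rewrite se_coset_count // se_A_le.
Qed.

(* By [cardM] and [cardK] a coset contains #|J| involutions on average. *)
Lemma se_coset_eq X : X \in rcosets K M -> #|[set v in X | #[v] == 2]| = #|J|.
Proof.
pose N (X : {set gT}) := #|[set v in X | #[v] == 2]|.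
have leN : forall X, X \in rcosets K M -> N X <= #|J| ?= iff (N X == #|J|).
  by move=> Y MY; split; rewrite // se_coset_le.
have [_ /esym] := leqif_sum leN.
have -> : (\sum_(Y in rcosets K M) #|J|)%N = (\sum_(Y in rcosets K M) N Y)%N.
  rewrite sum_nat_const -[#|rcosets K M|]/#|M : K|.
  have c_gt0 : 0 < #|'C_M[t]| := cardG_gt0 _.
  apply/eqP; rewrite -(eqn_pmul2r c_gt0) -mulnA -cardK mulnC Lagrange // cardM.
  rewrite eqn_pmul2r //; apply/eqP.
  rewrite -sum1_card (eq_bigl (fun v => (v \in M) && (#[v] == 2))); last by move=> v; rewrite inE.
  rewrite -(eq_bigl _ _ (fun v => erefl)) big_mkcondr /=.
  rewrite (set_partition_big _ (rcosets_partition sKM)) /=.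
  by apply: eq_bigr => Y _; rewrite /N -sum1_card -big_mkcondr; apply: eq_bigl => v; rewrite inE.
by rewrite eqxx => /forall_inP eqN MX; apply/eqP/eqN.
Qed.

Lemma se_card_A u : u \in M -> #[u] = 2 -> u \notin K -> #|A u| = #|J|.
Proof.
move=> Mu ou Ku; rewrite -se_coset_count // se_coset_eq //.
by apply/rcosetsP; exists u.
Qed.

Lemma se_coset_involution g : g \in M -> exists2 v, v \in K :* g & #[v] = 2.
Proof.
move=> Mg; have KgX : K :* g \in rcosets K M by apply/rcosetsP; exists g.
have: 0 < #|[set v in K :* g | #[v] == 2]|.
  by rewrite se_coset_eq // card_gt0; apply/set0Pn; exists t; apply: class_refl.
by rewrite card_gt0 => /set0Pn[v]; rewrite inE => /andP[? /eqP]; exists v.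
Qed.

(** Conjugation of a fixed involution embeds [A u] into [J], and the two have the same size: the
    action is regular. *)
Lemma se_A_trans u i i' : u \in M -> #[u] = 2 -> u \notin K ->
  i \in J -> i' \in J -> exists2 x, x \in A u & i' = i ^ x.
Proof.
move=> Mu ou Ku Ji Ji'; have := Ji; rewrite se_class => /andP[Ki /eqP oi].
have eqJ : conjg i @: A u = J.
  apply/eqP; rewrite eqEcard (card_in_imset (se_A_inj Mu ou Ku Ki oi)) se_card_A // leqnn andbT.
  apply/subsetP=> _ /imsetP[x Ax ->]; rewrite se_class groupJ ?orderJ ?oi //.
  exact: subsetP (se_A_sub Mu ou Ku) x Ax.
by apply/imsetP; rewrite eqJ.
Qed.

(** Subgroups of order [p] in [A u] and in ['C_M[t]] would be conjugate in [K], but no nontrivial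
    element of [A u] commutes with an involution of [K]. *)
Lemma se_prime_coprime p : prime p -> odd p -> (exists2 u, u \in M & #[u] = 2 /\ u \notin K) ->
  p %| #|J| -> ~~ (p %| #|'C_M[t]|).
Proof.
move=> p_pr op [u Mu [ou Ku]]; rewrite -(se_card_A Mu ou Ku) => /(Cauchy p_pr)[x Ax ox].
apply/negP=> /(Cauchy p_pr)[y Cy oy].
have Ky := subsetP (centK Kt ot) y Cy; have /setIP[My cyt] := Cy.
have Kx := subsetP (se_A_sub Mu ou Ku) x Ax.
have [g Kg defx] : exists2 g, g \in K & <[x]> = <[y]> :^ g.
  by apply: (conj_cycle_prime cK); rewrite ?ox ?oy.
have : x = 1.
  apply: (se_A_cent1 Mu ou Ku Ax (groupJ Kt Kg)); rewrite ?orderJ //.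
  apply/commute_sym/cent1P; rewrite cent1C -cent_cycle defx centJ memJ_conjg cent_cycle cent1C.
  exact: cyt.
by move=> x1; move: p_pr; rewrite -ox x1 order1.
Qed.

Section PrimeInverted.

Variables (u x : gT).
Hypotheses (Mu : u \in M) (ou : #[u] = 2) (Ku : u \notin K).
Hypotheses (Ax : x \in A u) (p_pr : prime #[x]).

Let Kx : x \in K. Proof. exact: subsetP (se_A_sub Mu ou Ku) x Ax. Qed.
Let Mx : x \in M. Proof. exact: subsetP sKM x Kx. Qed.
Let xu : x ^ u = x^-1.
Proof. by apply/eqP; have := Ax; rewrite se_mem_A // => /andP[]. Qed.
Let nx : x != 1. Proof. by rewrite -order_gt1 prime_gt1. Qed.
Let ox : odd #[x]. Proof. exact: dvdn_odd (order_dvdG Ax) (se_A_odd Mu ou Ku). Qed.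

Lemma se_cent_odd : odd #|'C_M[x]|.
Proof.
apply: contraT; rewrite -dvdn2 => /(Cauchy (isT : prime 2))[v /setIP[Mv cvx] ov].
have nc := se_prime_coprime p_pr ox (ex_intro2 _ _ u Mu (conj ou Ku)).
have dvJ : #[x] %| #|J| by rewrite -(se_card_A Mu ou Ku) order_dvdG.
case/negP: (nc dvJ); have [g Mg ->] := conjM Mv (subsetP sKM t Kt) ov ot.
rewrite cent1J -{1}(conjGid Mg) -conjIg cardJg order_dvdG // inE Mx.
by rewrite cent1C.
Qed.

(** [A u] centralizes [x] and is transitive on [J], so if one involution of [K] inverts [x], all do;
    the involution [t * s] would then centralize [x]. *)
Lemma se_no_inverting v : v \in K -> #[v] = 2 -> x ^ v != x^-1.
Proof.
move=> Kv ov; apply/eqP=> xv.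
have Jv : v \in J by rewrite se_class Kv ov.
have inv i : i \in K -> #[i] = 2 -> x ^ i = x^-1.
  move=> Ki oi; have Ji : i \in J by rewrite se_class Ki oi.
  have [a Aa ->] := se_A_trans Mu ou Ku Jv Ji.
  have cax : commute x a.
    exact: (centsP (cyclic_abelian (se_A_cyclic Mu ou Ku))).
  have xa : x ^ a = x by apply: commute_conjg.
  by rewrite -{1}xa -conjJg xv conjVg xa.
apply: (se_inverted_cent Mu ou Ku Mx ox nx xu (groupM Kt Ks)).
  apply: order2P; first by rewrite -(involution_inv os) -eq_mulgV1.
  by rewrite {1}cts mulgA -(mulgA s t t) involution_mulK // mulg1 involution_mulK.
apply/commute_sym/commgP/conjg_fixP.
by rewrite conjgM inv // conjVg inv // invgK.
Qed.

Let C := 'C_M[x]%G.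
Let Z := [~: C, <[u]>]%G.

Let uN : u \in 'N(C).
Proof.
rewrite -cycle_subG /= -cent_cycle normsI //.
  by rewrite cycle_subG (subsetP (normG M)).
by rewrite norms_cent // norms_cycle xu groupV cycle_id.
Qed.

Let memZ y : y \in C -> (y \in Z) = (y ^ u == y^-1).
Proof.
have cC : odd_cyclic C by apply: odd_cyclicS cM; apply: subsetIl.
by case: (odd_cyclic_involution_act se_cent_odd cC uN ou) => _ _ _ _; apply.
Qed.

Let ZsubC : Z \subset C.
Proof. by rewrite commg_subl cycle_subG. Qed.

Let inv_mem v : v \in M -> #[v] = 2 -> x ^ v = x^-1 -> u * v \in Z.
Proof.
move=> Mv ov xv; rewrite memZ.
  by rewrite (involution_mul_inv ov ou).
by rewrite inE groupM //= cent1C mem_cent1E conjgM xu conjVg xv invgK.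
Qed.

(** The coset of [c] contains an involution [v], and [x] lies in [E v]. There [A v], of the same
    order as [A u], contains the only subgroup of order [#[x]]; so [v] inverts [x]. *)
Lemma se_coset_inverting c : c \in 'C_M[x] -> c \notin K ->
  exists2 k, k \in K & [/\ #[k * c] = 2, k * c \in M & x ^ (k * c) = x^-1].
Proof.
move=> Cc Kc; have /setIP[Mc ccx] := Cc.
have [v /rcosetP[k Kk def_v] ov] := se_coset_involution Mc.
have Mv : v \in M by rewrite def_v groupM // (subsetP sKM).
have Kv : v \notin K by rewrite def_v groupMl.
have xc : x ^ c^-1 = x.
  apply: commute_conjg; apply: commuteV; apply/commute_sym/cent1P; exact: ccx.
have Evx : x \in E v.
  by rewrite inE Kx mem_conjg def_v invMg conjgM xc groupJ ?groupV.
have dvA : #[x] %| #|A v|.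
  by rewrite (se_card_A Mv ov Kv) -(se_card_A Mu ou Ku) order_dvdG.
have [b Ab ob] := Cauchy p_pr dvA.
have nsb : <[b]> <| E v.
  apply: char_normal_trans (se_A_normal Mv ov Kv).
  by rewrite (sub_cyclic_char _ (se_A_cyclic Mv ov Kv)) cycle_subG.
have cEv : odd_cyclic (E v) by apply: odd_cyclicS cK; apply: subsetIl.
have Avx : x \in A v.
  rewrite -cycle_subG.
  have -> : <[x]> = <[b]>.
    by apply: (odd_cyclic_normal_uniq cEv p_pr ox nsb) => //; rewrite ?cycle_subG.
  by rewrite cycle_subG.
have xv : x ^ v = x^-1.
  by apply/eqP; have := Avx; rewrite se_mem_A // => /andP[].
by exists k; rewrite // -def_v.
Qed.

(** A [y] in [Z] outside [K] yields an involution [k * y] inverting [x], with [k] in [K]. Then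
    [u * k] lies in [Z], so it is inverted by [u], and [k] is an involution of [K] that inverts [x]:
    impossible. *)
Let ZsubK : Z \subset K.
Proof.
apply/subsetP=> y Zy; apply: contraT => Ky.
have Cy := subsetP ZsubC y Zy.
have [k Kk] := se_coset_inverting Cy Ky.
move def_v : (k * y) => v [ov Mv xv]; move/esym in def_v.
have Zuk : u * k \in Z.
  have := groupM (inv_mem Mv ov xv) (groupVr Zy).
  by rewrite def_v !mulgA mulgK.
have /eqP ukV : (u * k) ^ u == (u * k)^-1 by rewrite -memZ // (subsetP ZsubC).
have ok : #[k] = 2.
  apply: order2P.
    apply: contraTneq isT => k1; have := dvdn_odd (order_dvdG Cy) se_cent_odd.
    by rewrite -[y]mul1g -k1 -def_v ov.
  have : (u * k) ^ u * (u * k) = 1 by rewrite ukV mulVg.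
  by rewrite conjgE (involution_inv ou) !mulgA (involution_mulK ou) mul1g -(mulgA k) (involution_mulK ou) mulg1.
case/negP: (se_no_inverting Kk ok).
have /setIP[_ cukx] := subsetP ZsubC _ Zuk.
have -> : k = u * (u * k) by rewrite mulgA involution_mulK ?mul1g.
rewrite conjgM xu conjVg; apply/eqP; congr (_^-1); apply: commute_conjg.
by apply/commute_sym/cent1P.
Qed.

Lemma se_inverting v : v \in M -> #[v] = 2 -> x ^ v = x^-1 -> u * v \in A u.
Proof.
move=> Mv ov xv; have Zuv := inv_mem Mv ov xv.
by rewrite se_mem_A // (subsetP ZsubK) // -memZ // (subsetP ZsubC).
Qed.

(** If [k] normalizes [<[x]>], the involution [u ^ k] also inverts [x], so
    [u * u ^ k = (k ^ u)^-1 * k] lies in [K], and with it [k ^ u]. *)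
Lemma se_norm_prime : 'N_K(<[x]>) \subset E u.
Proof.
apply/subsetP=> k /setIP[Kk nxk]; rewrite inE Kk mem_conjg /= (involution_inv ou).
have xuk : x ^ (u ^ k) = x^-1.
  have : x ^ k^-1 \in <[x]> by rewrite memJ_norm ?groupV // cycle_id.
  case/cycleP=> n xk; rewrite -{1}(conjgKV k x) -conjJg xk (conj_inv_exp _ xu) -xk.
  by rewrite conjVg conjgKV.
have := se_inverting (groupJ Mu (subsetP sKM k Kk)) (etrans (orderJ _ _) ou) xuk.
move/(subsetP (se_A_sub Mu ou Ku)).
have -> : u * u ^ k = (k ^ u)^-1 * k.
  by rewrite -conjVg !conjgE (involution_inv ou) !mulgA.
by rewrite groupMr // groupV.
Qed.

Lemma se_normal_complement : 'C_(E u)[u] \subset 'C[x] ->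
  #[x]^'.-Hall(K) 'O_(#[x]^')(K).
Proof.
move=> cWx; apply: (@normal_complement_prime _ _ K <[x]>%G) => //; rewrite ?cycle_subG //.
apply: subset_trans se_norm_prime _; rewrite -(se_A_prod Mu ou Ku) cent_cycle.
rewrite mul_subG //; apply/subsetP=> a Aa; apply/cent1P.
exact: (centsP (cyclic_abelian (se_A_cyclic Mu ou Ku))).
Qed.

Lemma se_prime_not_dvd : ~~ (#[x] %| #|'C_M[t]|).
Proof.
apply: se_prime_coprime => //; first by exists u.
by rewrite -(se_card_A Mu ou Ku) order_dvdG.
Qed.

End PrimeInverted.

(** As [A u] is transitive on [J], a Frattini argument makes ['C_(E u)[t]] a complement of [A u] in
    [E u]; it is conjugate under [A u] to the complement ['C_(E u)[u]]. *)
Lemma se_W_fix u : u \in M -> #[u] = 2 -> u \notin K ->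
  exists2 i, i \in J & 'C_(E u)[u] \subset 'C[i].
Proof.
move=> Mu ou Ku; have [sAE nAE] := andP (se_A_normal Mu ou Ku).
have Jt : t \in J := class_refl _ _.
have defE : A u * 'C_(E u)[t] = E u.
  apply/eqP; rewrite eqEsubset mul_subG ?subsetIl //=.
  apply/subsetP=> e Ee; have Ke : e \in K by apply: subsetP Ee; apply: subsetIl.
  have [|a Aa ta] := se_A_trans Mu ou Ku Jt (_ : t ^ e \in J); first exact: imset_f.
  rewrite -normC; last by apply: subset_trans nAE; apply: subsetIl.
  have -> : e = e * a^-1 * a by rewrite mulgKV.
  apply: mem_mulg => //.
  apply/setIP; split; first by rewrite groupM // groupV (subsetP sAE).
  by rewrite cent1C mem_cent1E conjgM ta conjgK.
have tiA : A u :&: 'C_(E u)[t] = 1.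
  apply/trivgP/subsetP=> e /setIP[Ae /setIP[_ /cent1P cet]].
  by rewrite inE (se_A_cent1 Mu ou Ku Ae Kt ot (commute_sym cet)).
have cardC : #|'C_(E u)[u]| = #|'C_(E u)[t]|.
  apply/eqP; rewrite -(eqn_pmul2l (cardG_gt0 (A u))) -(TI_cardMg tiA).
  by rewrite -coprime_cardMg ?se_A_coprime // defE se_A_prod.
have [|||||x Ax defW] := @SchurZassenhaus_trans_sol _ (A u) ('C_(E u)[t])%G ('C_(E u)[u])%G.
- exact: abelian_sol (cyclic_abelian (se_A_cyclic Mu ou Ku)).
- exact: subset_trans (subsetIl _ _) nAE.
- by rewrite /= defE subsetIl.
- by rewrite /= -cardC se_A_coprime.
- exact: cardC.
exists (t ^ x).
  by apply: imset_f; apply: subsetP (se_A_sub Mu ou Ku) x Ax.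
by rewrite defW cent1J conjSg subsetIr.
Qed.

(** Otherwise ['C_M(B)] would lie in [K], although it contains [u]: [S] because it centralizes an
    involution of its centre, which commutes with [i], and the odd core by [klein_cent_gen] applied
    to [i] and [v]. *)
Lemma se_cent_not_nilpotent (B S : {group gT}) u i v :
    u \in M -> u \notin K -> u \in 'C(B) ->
    i \in K -> #[i] = 2 -> v \in K -> #[v] = 2 -> commute i v -> i != v ->
    i \in 'N(B) -> v \in 'N(B) -> 2.-Sylow('C_M(B)) S -> i \in S ->
  'O_2^'('C_M(B)) * S <> 'C_M(B).
Proof.
move=> Mu Ku Bu Ki oi Kv ov civ niv Ni Nv sylS Si defX.
have [sSX tS _] := and3P sylS; have Xi := subsetP sSX i Si.
have [sSM Mv] := (subset_trans sSX (subsetIl _ _), subsetP sKM v Kv).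
have sSK : S \subset K.
  have ntS : S :!=: 1 by apply/trivgPn; exists i; rewrite // -order_gt1 oi.
  have ntZ : 'Z(S) != 1 by rewrite center_nil_eq1 ?(pgroup_nil tS).
  have [_ dv _] := pgroup_pdiv (pgroupS (center_sub S) tS) ntZ.
  have [z /setIP[Sz cSz] oz] := Cauchy (isT : prime 2) dv.
  have Kz : z \in K.
    exact: se_cent Ki oi (subsetP sSM z Sz) (commute_sym (centP cSz i Si)).
  apply/subsetP=> y Sy; apply: (se_cent Kz oz (subsetP sSM y Sy)).
  exact: centP cSz y Sy.
pose V := (<[i]> <*> <[v]>)%G.
have sVK : V \subset K by rewrite join_subG !cycle_subG Ki.
have sOK : 'O_2^'('C_M(B)) \subset K.
  have nOV : V \subset 'N('O_2^'('C_M(B))).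
    apply: gFnorm_trans; rewrite normsI ?norms_cent //.
      by apply: subset_trans sVK (subset_trans sKM (normG M)).
    by rewrite join_subG !cycle_subG Ni.
  have sub a : a \in K -> #[a] = 2 -> 'C_('O_2^'('C_M(B)))[a] \subset K.
    move=> Ka oa; apply: subset_trans (centK Ka oa); apply: setSI.
    by rewrite (subset_trans (pcore_sub _ _)) ?subsetIl.
  apply: (@klein_cent_gen _ i v oi ov civ 'O_2^'('C_M(B))%G K).
  - exact: odd_core.
  - by apply: odd_cyclicS cM; rewrite (subset_trans (pcore_sub _ _)) ?subsetIl.
  - by rewrite (subsetP nOV) // mem_gen // inE cycle_id.
  - by rewrite (subsetP nOV) // mem_gen // inE cycle_id orbT.
  - exact: sub.
  - exact: sub.
  by apply: (sub (i * v) (groupM Ki Kv)); apply: klein_involution.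
have sXK : 'C_M(B) \subset K by rewrite -defX mul_subG.
by case/negP: Ku; rewrite (subsetP sXK) // inE Mu.
Qed.

End StronglyEmbedded.

(** * Simple groups with dihedral Sylow 2-subgroups *)

Lemma dihedral_involution (gT : finGroupType) (D : {group gT}) r s : 2.-group D ->
  dihedral_gens D r s -> exists2 t, t \in <[r]> & #[t] = 2.
Proof. by move=> _ [_ _ _ ev _]; have [t rt ot] := Cauchy (isT : prime 2) ev; exists t. Qed.

Lemma odd_mem_core (gT : finGroupType) (X : {group gT}) x :
  2^'.-Hall(X) 'O_2^'(X) -> x \in X -> odd #[x] -> x \in 'O_2^'(X).
Proof.
by move=> hX Xx ox; rewrite (mem_normal_Hall hX (pcore_normal _ _) Xx) /p_elt -odd_2'nat.
Qed.

Lemma odd_sub_core (gT : finGroupType) (X H : {group gT}) :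
  2^'.-Hall(X) 'O_2^'(X) -> H \subset X -> odd #|H| -> H \subset 'O_2^'(X).
Proof.
move=> hX sHX oH; apply/subsetP=> x Hx; apply: odd_mem_core => //.
  exact: subsetP sHX x Hx.
exact: dvdn_odd (order_dvdG Hx) oH.
Qed.

(** Reflections have order less than [#[r]], so [x] normalizes [<[r]>], whose automorphism group is
    a 2-group. Then [s ^ (x ^+ n) = k' ^+ n * s] for a 2-element [k'], and [n = #[x]] forces
    [k' = 1]. *)
Lemma dihedral_odd_norm_cent (gT : finGroupType) (T : {group gT}) r s x :
    2.-group T -> dihedral_gens T r s -> 2 < #[r] -> x \in 'N(T) -> odd #[x] ->
  x \in 'C(T).
Proof.
move=> tT dihT r2 Nx ox; have [os rs rsi _ defT] := dihT.
have Tr := dihedral_mem_r dihT; have Ts := dihedral_mem_s dihT.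
have rxr : r ^ x \in <[r]>.
  apply: contraLR r2 => rx; have Trx : r ^ x \in T by rewrite memJ_norm.
  by have [orx _] := dihedral_reflection dihT Trx rx; rewrite -(orderJ r x) orx.
have Nxr : x \in 'N(<[r]>) by rewrite -cycle_subG norms_cycle.
have [k or] : exists k, #[r] = (2 ^ k.+1)%N.
  have [k or] := p_natP (mem_p_elt tT Tr); case: k or => [|k] or; last by exists k.
  by rewrite or in r2.
have cxr : <[x]> \subset 'C(<[r]>).
  apply: (@subset_cent_index _ <[x]>%G <[r]>%G (2 ^ k)%N); rewrite ?cycle_subG //.
  - exact: cycle_cyclic.
  - by rewrite -orderE or totient_pfactor //= mul1n.
  move=> q q_pr qx; rewrite Euclid_dvdX // => /andP[q2 _].
  by have := dvdn_odd qx ox; have := q2; rewrite dvdn_prime2 // => /eqP->.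
have kx k' : k' \in <[r]> -> k' ^ x = k'.
  by move=> rk; apply: commute_conjg; apply/commute_sym/(centsP cxr x (cycle_id x)).
have sx : s ^ x \notin <[r]> by rewrite memJ_norm.
have Tsx : s ^ x \in T by rewrite memJ_norm.
have [k' rk' def_sx] := dihedral_notin dihT Tsx sx.
have sxn n : s ^ (x ^+ n) = k' ^+ n * s.
  elim: n => [|n IH]; first by rewrite conjg1 mul1g.
  by rewrite expgSr conjgM IH conjMg kx ?groupX // def_sx mulgA -expgSr.
have k'1 : k' = 1.
  have /eqP := sxn #[x]; rewrite expg_order conjg1 -{1}[s]mul1g (inj_eq (mulIg s)) eq_sym.
  rewrite -order_dvdn => dvk; apply/eqP; rewrite -order_eq1 -dvdn1.
  have co : coprime #[k'] #[x].
    rewrite (pnat_coprime (pi := 2)) -?odd_2'nat //.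
    by apply: mem_p_elt tT _; apply: subsetP rk'; rewrite cycle_subG.
  by rewrite -(eqP co) dvdn_gcd dvdnn.
have cxr' : x \in 'C(<[r]>) by rewrite -cycle_subG.
have cxs : x \in 'C(<[s]>).
  rewrite cent_cycle; apply/cent1P/commute_sym/commgP/conjg_fixP.
  by rewrite def_sx k'1 mul1g.
by rewrite -defT centM inE cxr'.
Qed.

Lemma odd_pgroup_cent_prime (gT : finGroupType) (q : nat) (N B : {group gT}) :
    prime q -> #|B| = q -> N \subset 'N(B) ->
    (forall p, prime p -> p %| #|N| -> q <= p) -> N \subset 'C(B).
Proof.
move=> q_pr oB nBN minq; apply: (@subset_cent_index _ N B q.-1) => //.
- by apply: prime_cyclic; rewrite oB.
- by rewrite oB totient_prime.
move=> p p_pr pN pq1; have := minq p p_pr pN; apply/negP; rewrite -ltnNge.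
have q1 : 0 < q.-1 by rewrite -subn1 subn_gt0 prime_gt1.
by have := dvdn_leq q1 pq1; rewrite -ltnS prednK ?prime_gt0.
Qed.

Lemma dihedral_mul_notin (gT : finGroupType) (D : {group gT}) r s d e : dihedral_gens D r s ->
  d \in D -> e \in D -> d \notin <[r]> -> e \notin <[r]> -> d * e \in <[r]>.
Proof.
move=> dihD Dd De rd re; have [od _] := dihedral_reflection dihD Dd rd.
have [k rk ->] := dihedral_notin (dihedral_change dihD Dd rd) De re.
rewrite -{1}(involution_inv od) -conjgE memJ_norm //.
exact: subsetP (dihedral_norm dihD) d Dd.
Qed.

Lemma dihedral_subgroup (gT : finGroupType) (D P : {group gT}) r s :
    2.-group D -> dihedral_gens D r s -> P \subset D -> ~~ cyclic P ->
  exists r' d, [/\ dihedral_gens P r' d, <[r']> = P :&: <[r]> & d \notin <[r]>].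
Proof.
move=> tD dihD sPD ncP.
have /subsetPn[d Pd rd] : ~~ (P \subset <[r]>).
  by apply: contra ncP => sPr; apply: cyclicS sPr (cycle_cyclic r).
have /cyclicP[r' def_r'] : cyclic (P :&: <[r]>).
  exact: cyclicS (subsetIr _ _) (cycle_cyclic r).
have Dd := subsetP sPD d Pd; have [od rdi] := dihedral_reflection dihD Dd rd.
have sr'P : <[r']> \subset P by rewrite -def_r' subsetIl.
have defP : <[r']> * <[d]> = P.
  apply/eqP; rewrite eqEsubset mul_subG //= ?cycle_subG // -def_r'.
  apply/subsetP=> x Px; have [rx | rx] := boolP (x \in <[r]>).
    by rewrite (subsetP (mulG_subl _ _)) // inE Px.
  rewrite -(mulgKV d x) mem_mulg ?cycle_id // inE groupM ?groupV //=.
  by rewrite (involution_inv od) (dihedral_mul_notin dihD) ?(subsetP sPD).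
exists r', d; split=> //; split=> //.
- by apply: contra rd; rewrite -def_r' => /setIP[].
- have: r' \in <[r]> by apply: (subsetP (subsetIr P _)); rewrite def_r' cycle_id.
  by case/cycleP=> n ->; apply: conj_inv_exp.
have tr' : 2.-group <[r']> by rewrite -def_r'; apply: pgroupS tD; rewrite subIset ?sPD.
have [r1 | ntr'] := eqVneq <[r']> 1.
  by case/negP: ncP; rewrite -defP r1 mul1g cycle_cyclic.
by have [_ dv _] := pgroup_pdiv tr' ntr'.
Qed.

(** The Sylow 2-subgroup ['C_D(T)] of ['C_X(T)] lies in [T], so it is central there and Burnside's
    theorem applies. *)
Lemma cent_Sylow_Hall (gT : finGroupType) (X D T : {group gT}) :
    2.-Sylow(X) D -> T <| D -> 'C_D(T) \subset T ->
  2^'.-Hall('C_X(T)) 'O_2^'('C_X(T)).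
Proof.
move=> sylD /andP[sTD nTD] sCT; have sDX := pHall_sub sylD.
have sylN : 2.-Sylow('N_X(T)) D.
  by apply: pHall_subl sylD; rewrite ?subsetIl // subsetI sDX.
have nsCN : 'C_X(T) <| 'N_X(T) by rewrite /normal subcent_norm setIS ?cent_sub.
apply: (Burnside_normal_complement (Sylow_setI_normal nsCN sylN)).
apply: subset_trans (subsetIl _ _) (subset_trans (subsetIr _ _) _).
apply: centS; apply: subset_trans sCT.
by apply/subsetP=> x /setIP[/setIP[_ cx] Dx]; rewrite inE Dx.
Qed.

Section SimpleDihedral.

Variables (gT : finGroupType) (M T : {group gT}) (r s t : gT).
Hypotheses (cM : odd_cyclic M) (simM : simple M).
Hypotheses (sylT : 2.-Sylow(M) T) (dihT : dihedral_gens T r s).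
Hypotheses (rt : t \in <[r]>) (ot : #[t] = 2).

Let sTM : T \subset M. Proof. exact: pHall_sub sylT. Qed.
Let tT : 2.-group T. Proof. exact: pHall_pgroup sylT. Qed.
Let Tt : t \in T.
Proof. by apply: subsetP rt; rewrite cycle_subG (dihedral_mem_r dihT). Qed.
Let Mt : t \in M. Proof. exact: subsetP sTM t Tt. Qed.

Lemma simple_not_pgroup (p : nat) : ~~ p.-group M.
Proof.
apply/negP=> pM; have [_ simM'] := simpleP _ simM.
have nsr : <[r]> <| T.
  by rewrite /normal cycle_subG (dihedral_mem_r dihT) (dihedral_norm dihT).
have p2 : 2.-group M.
  have dv : 2 %| #|M| by rewrite -ot order_dvdG.
  by rewrite (eqnP (pgroupP pM 2 isT dv)).
have defM : M :=: T.
  by apply/esym/eqP; rewrite eqEcard sTM /= (card_Hall sylT) part_pnat_id ?leqnn.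
have [_ rs _ ev _] := dihT; case: (simM' <[r]>%G) => [|r1|rT].
- by rewrite defM.
- by move: ev; rewrite orderE r1 cards1.
by case/negP: rs; rewrite -[<[r]>]/(gval <[r]>%G) rT defM (dihedral_mem_s dihT).
Qed.

(** An involution of [T] not fused to [t] would lie outside the transfer kernel, which is normal
    with a 2-group as quotient; but [M] is simple and not a 2-group. *)
Lemma simple_fused a b : a \in M -> b \in M -> #[a] = 2 -> #[b] = 2 ->
  exists2 g, g \in M & b = a ^ g.
Proof.
suff fuse c : c \in M -> #[c] = 2 -> exists2 g, g \in M & c ^ g = t.
  move=> Ma Mb oa ob; have [g Mg ag] := fuse a Ma oa; have [h Mh bh] := fuse b Mb ob.
  exists (g * h^-1); first by rewrite groupM ?groupV.
  by rewrite conjgM ag -bh conjgK.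
move=> Mc oc; have tc : 2.-elt c by rewrite /p_elt oc.
have [x Mx cxT] : exists2 x, x \in M & c ^ x \in T.
  have scM : <[c]> \subset M by rewrite cycle_subG.
  have [x Mx sub] := Sylow_Jsub sylT scM tc.
  by exists x; rewrite // -cycle_subG cycleJ.
have ocx : #[c ^ x] = 2 by rewrite orderJ.
have [rcx | rcx] := boolP (c ^ x \in <[r]>).
  by exists x => //; apply: dihedral_involution_rot rcx rt _ _.
have [N [nsN tN /(_ _ cxT rcx) nN]] := dihedral_transfer_ker sylT dihT rt ot.
have [/exists_inP[g Mg /eqP] | ] := boolP [exists g in M, (c ^ x) ^ g == t].
  by rewrite -conjgM; exists (x * g); rewrite ?groupM.
rewrite negb_exists_in => /forall_inP/nN Ncx.
have [_ simM'] := simpleP _ simM; have [N1 | NM] := simM' N nsN.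
  case/negP: (simple_not_pgroup 2); move: tN; rewrite N1.
  by rewrite /pgroup -(card_isog (quotient1_isog M)).
by case/negP: Ncx; rewrite NM groupJ.
Qed.

Lemma simple_no_complement q : prime q -> odd q -> q %| #|M| ->
  ~~ q^'.-Hall(M) 'O_q^'(M).
Proof.
move=> q_pr oq q_dv; apply/negP=> hO; have [_ simM'] := simpleP _ simM.
have [O1 | OM] := simM' 'O_q^'(M)%G (pcore_normal _ _).
  case/negP: (simple_not_pgroup q); rewrite -(pgroupNK q) /pgroup.
  have := card_Hall hO; rewrite O1 cards1 => /esym/eqP.
  by rewrite partn_eq1 // pnatNK.
have := pcore_pgroup q^' M; rewrite /pgroup -[in X in _.-nat #|X|]/(gval 'O_q^'(M)%G) OM.
by move/pnatP => /(_ (cardG_gt0 _) q q_pr q_dv); rewrite !inE eqxx.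
Qed.

Lemma center_inv_Hall (X : {group gT}) :
  X \subset M -> T \subset X -> X \subset 'C[t] -> 2^'.-Hall(X) 'O_2^'(X).
Proof.
move=> sXM sTX cXt; have sylX := pHall_subl sTX sXM sylT.
apply: (dihedral_transfer sylX dihT rt ot) => x d Xx Td rd.
have cxt : commute t x by apply/commute_sym/cent1P; apply: subsetP cXt x Xx.
apply: contra rd => /eqP/(canRL (conjgK x)); rewrite (commute_conjg _) => [-> //|].
exact: commuteV.
Qed.

Lemma cent_inv_Hall : 2^'.-Hall('C_M[t]) 'O_2^'('C_M[t]).
Proof.
apply: center_inv_Hall; rewrite ?subsetIl ?subsetIr // subsetI sTM.
apply/subsetP=> d Td; apply/cent1P/commute_sym.
exact: (dihedral_center dihT rt ot Td).
Qed.

Lemma cent_self_Hall : 2^'.-Hall('C_M(T)) 'O_2^'('C_M(T)).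
Proof. by apply: (cent_Sylow_Hall sylT (normal_refl T)); apply: subsetIl. Qed.

Lemma conj_inv_Hall i : i \in M -> #[i] = 2 -> 2^'.-Hall('C_M[i]) 'O_2^'('C_M[i]).
Proof.
move=> Mi oi; have [g Mg ->] := simple_fused Mt Mi ot oi.
have -> : 'C_M[t ^ g] = 'C_M[t] :^ g by rewrite cent1J -{1}(conjGid Mg) -conjIg.
by rewrite pcoreJ pHallJ2 cent_inv_Hall.
Qed.

Lemma Sylow_cent_inv : T \subset 'C_M[t].
Proof.
rewrite subsetI sTM; apply/subsetP=> d Td; apply/cent1P/commute_sym.
exact: (dihedral_center dihT rt ot Td).
Qed.

(** [T] is Sylow in ['C_M(B)], so by Frattini ['N_M(B)] is ['C_M(B)] times elements normalizing [T].
    Were the odd ones among these to centralize [B], the simple [M] would have a normal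
    [q]-complement. *)
Lemma cent_Sylow_prime_norm q (B : {group gT}) :
    prime q -> odd q -> B \subset 'C_M(T) -> #|B| = q ->
  ~ (forall h, h \in 'N_M(T) -> odd #[h] -> h \in 'N(B) -> h \in 'C(B)).
Proof.
move=> q_pr oq sBC oB cent_odd; have [sBM cBT] := subsetIP sBC.
have q_dvM : q %| #|M| by rewrite -oB cardSg.
case/negP: (simple_no_complement q_pr oq q_dvM).
apply: (normal_complement_prime cM q_pr oq sBM oB).
have nsC : 'C_M(B) <| 'N_M(B) by rewrite /normal subcent_norm setIS ?cent_sub.
have sylC : 2.-Sylow('C_M(B)) T.
  by apply: pHall_subl sylT; rewrite ?subsetIl // subsetI sTM centsC.
rewrite -(Frattini_arg nsC sylC) mul_subG ?subsetIr //.
apply/subsetP=> g /setIP[/setIP[Mg Nb] NT].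
have sylN : 2.-Sylow('N_M(T)) T.
  by apply: pHall_subl sylT; rewrite ?subsetIl // subsetI sTM normG.
rewrite -(consttC 2 g) groupM //.
  have Ng : g.`_2 \in 'N_M(T) by rewrite inE !groupX.
  have := mem_normal_Hall sylN (normalSG sTM) Ng; rewrite p_elt_constt => Tg.
  by apply: (subsetP (_ : T \subset _)); rewrite 1?centsC // Tg.
have Ng : g.`_2^' \in 'N_M(T) by apply: groupX; apply/setIP.
have og : odd #[g.`_2^'] by rewrite odd_2'nat; apply: p_elt_constt.
by apply: cent_odd Ng og _; apply: groupX.
Qed.

Hypothesis r_gt2 : 2 < #[r].

(** For [2 < #[r]], odd elements of ['N_M(T)] centralize [T] and so lie in [W]; they act trivially
    on a group whose order is the least prime divisor of [#|W|]. *)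
Lemma core_cent_Sylow : 'O_2^'('C_M(T)) = 1.
Proof.
pose W := 'O_2^'('C_M(T))%G; apply/eqP; apply: contraT => ntW.
have oW : odd #|W| := odd_core _.
pose q := pdiv #|W|.
have q_pr : prime q by rewrite pdiv_prime // cardG_gt1.
have q_dv : q %| #|W| := pdiv_dvd _.
have oq : odd q := dvdn_odd q_dv oW.
have [b Wb ob] := Cauchy q_pr q_dv.
have sWC : W \subset 'C_M(T) := pcore_sub _ _.
have sbC : <[b]> \subset 'C_M(T) by rewrite cycle_subG (subsetP sWC).
case: (@cent_Sylow_prime_norm q <[b]>%G q_pr oq sbC ob) => h Ch oh Nb.
have CTh : h \in 'C_M(T).
  have /setIP[Mh Nh] := Ch; rewrite inE Mh.
  exact: (dihedral_odd_norm_cent tT dihT r_gt2).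
have Wh : h \in W := odd_mem_core cent_self_Hall CTh oh.
have : <[h]> \subset 'C(<[b]>).
  apply: (@odd_pgroup_cent_prime _ q <[h]>%G) => //.
    by rewrite cycle_subG.
  move=> p p_pr ph; apply: pdiv_min_dvd; first exact: prime_gt1.
  exact: dvdn_trans ph (order_dvdG Wh).
by rewrite cycle_subG.
Qed.

(** The core [U] of ['C_M[t]] has ['C_U(T) = 1], so [U = [~: U, T]], which lies in a cyclic Fitting
    subgroup; fusion carries this to [i]. *)
Lemma core_cent_inv_cyclic i : i \in M -> #[i] = 2 -> cyclic 'O_2^'('C_M[i]).
Proof.
move=> Mi oi; have [g Mg ->] := simple_fused Mt Mi ot oi.
rewrite cent1J -{1}(conjGid Mg) -conjIg pcoreJ cyclicJ {i Mi oi g Mg}.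
set U := 'O_2^'('C_M[t])%G; have oU : odd #|U| := odd_core _.
have sUC : U \subset 'C_M[t] := pcore_sub _ _.
have sTC := Sylow_cent_inv.
have nUT : T \subset 'N(U) by apply: subset_trans sTC (gFnorm _ _).
have cU : odd_cyclic U.
  by apply: odd_cyclicS cM; apply: subset_trans sUC (subsetIl _ _).
have coUT : coprime #|U| #|T|.
  by rewrite coprime_sym (pnat_coprime tT) // -odd_2'nat.
have tiC : 'C_U(T) = 1.
  apply/trivgP; rewrite -core_cent_Sylow (odd_sub_core cent_self_Hall) //.
    by apply: setSI; apply: subset_trans sUC (subsetIl _ _).
  exact: oddSg (subsetIl _ _) oU.
have := coprime_comm_cent_prod nUT coUT (odd_cyclic_sol oU cU).
rewrite tiC mulg1 => <-.
exact: cyclicS (comm_odd_cyclic_Fitting oU cU nUT) (cyclic_Fitting oU cU).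
Qed.

Lemma dihedral_central_inv i : i \in 'Z(T) -> #[i] = 2 -> i = t.
Proof.
case/setIP=> Ti cTi oi; apply: (dihedral_involution_rot _ rt oi ot).
have cri : commute r i by apply/commute_sym/(centP cTi)/(dihedral_mem_r dihT).
apply: contraLR r_gt2 => ri; have [_ rii] := dihedral_reflection dihT Ti ri.
rewrite -leqNgt dvdn_leq // order_dvdn expg2 -{1}[r]invgK -rii.
by rewrite (commute_conjg cri) mulVg.
Qed.

Section NoStronglyEmbedded.

Variable K : {group gT}.
Hypotheses (sKM : K \subset M) (nKM : K :!=: M).
Hypothesis centKT : forall i, i \in T -> #[i] = 2 -> 'C_M[i] \subset K.

Let sTK : T \subset K.
Proof. exact: subset_trans Sylow_cent_inv (centKT Tt ot). Qed.

Let sylTK : 2.-Sylow(K) T.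
Proof. exact: pHall_subl sTK sKM sylT. Qed.

Let centK i : i \in K -> #[i] = 2 -> 'C_M[i] \subset K.
Proof.
move=> Ki oi; have siK : <[i]> \subset K by rewrite cycle_subG.
have ti : 2.-group <[i]> by rewrite /pgroup -orderE oi.
have [x Kx] := Sylow_Jsub sylTK siK ti; rewrite -cycleJ cycle_subG => Tix.
rewrite -(conjSg _ _ x) (conjGid Kx) conjIg (conjGid (subsetP sKM x Kx)) -cent1J.
by rewrite centKT ?orderJ.
Qed.

(** If [c = t ^ g] is in [K], then [T :^ g] lies in ['C_M[c]], hence in [K], and some [k] in [K]
    carries it to [T]; as [t] is the only central involution of [T], [c ^ k = t]. *)
Let conjK a b : a \in K -> b \in K -> #[a] = 2 -> #[b] = 2 -> exists2 g, g \in K & b = a ^ g.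
Proof.
suff fuse c : c \in K -> #[c] = 2 -> exists2 g, g \in K & c ^ g = t.
  move=> Ka Kb oa ob; have [g Kg ag] := fuse a Ka oa; have [h Kh bh] := fuse b Kb ob.
  exists (g * h^-1); first by rewrite groupM ?groupV.
  by rewrite conjgM ag -bh conjgK.
move=> Kc oc; have Mc := subsetP sKM c Kc.
have [g Mg def_c] := simple_fused Mt Mc ot oc.
have sTgK : T :^ g \subset K.
  apply: subset_trans (centK Kc oc).
  by rewrite def_c cent1J -{1}(conjGid Mg) -conjIg conjSg Sylow_cent_inv.
have sylTg : 2.-Sylow(K) (T :^ g).
  by apply: pHall_subl sTgK sKM _; rewrite pHallJ.
have [k Kk defT] := Sylow_trans sylTg sylTK.
exists k => //; apply: dihedral_central_inv; last by rewrite orderJ.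
have {}defT : T :=: T :^ (g * k) by rewrite conjsgM.
rewrite def_c -conjgM inE {1}defT memJ_conjg Tt defT centJ memJ_conjg.
by apply/centP=> d Td; apply: (dihedral_center dihT rt ot Td).
Qed.

(* The centralizer of W := C_E(u) contains an element of prime order p of A(u), which gives K
   a normal p-complement.  By the Frattini argument some element of order p normalises, hence
   centralises T, although p does not divide #|'C_M[t]|. *)
Lemma no_strongly_embedded_aux : False.
Proof.
have Ts : s \in T := dihedral_mem_s dihT.
have [os rs _ _ _] := dihT.
have Kt := subsetP sTK t Tt; have Ks := subsetP sTK s Ts.
have cts : commute t s := dihedral_center dihT rt ot Ts.
have nts : t != s by apply: contraNneq rs => <-.
have /subsetPn[g Mg Kg] : ~~ (M \subset K).
  by apply: contra nKM => sMK; rewrite eqEsubset sKM.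
have fM := simple_fused.
have [u Kgu ou] := se_coset_involution cM sKM fM conjK centK Kt ot Mg.
have /rcosetP[k Kk def_u] := Kgu.
have Mu : u \in M by rewrite def_u groupM // (subsetP sKM).
have Ku : u \notin K by rewrite def_u groupMl.
have [i Ji sWi] := se_W_fix cM sKM fM conjK centK Kt ot Mu ou Ku.
set E := (K :&: K :^ u)%G in sWi; pose W := 'C_E[u]%G.
have [j Kj def_i] := imsetP Ji.
have [Ki oi] : i \in K /\ #[i] = 2 by rewrite def_i groupJ ?orderJ.
have Mi := subsetP sKM i Ki.
have sWK : W \subset K by rewrite subIset // subsetIl.
have oW : odd #|W| := oddSg (subsetIl _ _) (se_inter_odd sKM centK Mu ou Ku).
have sWCi : W \subset 'C_M[i] by rewrite subsetI (subset_trans sWK).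
have sWU : W \subset 'O_2^'('C_M[i]) := odd_sub_core (conj_inv_Hall Mi oi) sWCi oW.
have nsW : W <| 'C_M[i].
  apply: (char_normal_trans _ (pcore_normal 2^' _)).
  by rewrite (sub_cyclic_char _ (core_cent_inv_cyclic Mi oi)).
pose v := s ^ j; have Kv : v \in K by rewrite groupJ.
have civ : commute i v.
  by apply/commgP; rewrite def_i -conjRg conjg_eq1; apply/commgP.
have niv : i != v by rewrite def_i (inj_eq (conjg_inj _)).
have CiN x : x \in M -> commute i x -> x \in 'N(W).
  move=> Mx cix; rewrite (subsetP (normal_norm nsW)) // inE Mx.
  exact/cent1P/commute_sym.
have CWu : u \in 'C(W).
  by rewrite -sub_cent1 subsetIr.
have CWi : i \in 'C(W) by rewrite -sub_cent1.
have siC : <[i]> \subset 'C_M(W) by rewrite cycle_subG inE Mi.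
have ti : 2.-group <[i]> by rewrite /pgroup -orderE oi.
have [S sylS] := Sylow_superset siC ti; rewrite cycle_subG => Si.
have notnil : 'O_2^'('C_M(W)) * S <> 'C_M(W).
  apply: (se_cent_not_nilpotent cM sKM centK Mu Ku CWu Ki oi Kv _ civ niv _ _ sylS Si).
  - by rewrite orderJ.
  - exact: CiN.
  by apply: CiN => //; apply: (subsetP sKM).
have ncS : ~~ cyclic S by apply/negP => /(cyclic_Sylow2_complement sylS).
have [sSC tS _] := and3P sylS; have sSM := subset_trans sSC (subsetIl _ _).
have [x Mx sSx] := Sylow_Jsub sylT sSM tS.
have ncSx : ~~ cyclic (S :^ x) by rewrite cyclicJ.
have [r' [d [dihS def_r' rd]]] := dihedral_subgroup tT dihT sSx ncSx.
have [z r'z oz] := dihedral_involution (pgroupS sSx tT) dihS.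
(* [S] is not cyclic, so it is dihedral: [i'] is its central involution, or one of its reflections
   when [i] is central. *)
have [i' [Si' oi' Ki' nii']] : exists i', [/\ i' \in S, #[i'] = 2, i' \in K & i' != i].
  have Sz : z ^ x^-1 \in S.
    by rewrite -mem_conjg (subsetP _ z r'z) // cycle_subG (dihedral_mem_r dihS).
  have ozx : #[z ^ x^-1] = 2 by rewrite orderJ.
  have [ez | nez] := eqVneq (z ^ x^-1) i; last first.
    exists (z ^ x^-1); split=> //; apply: (se_cent centK Ki oi (subsetP sSM _ Sz)).
    have Six : i ^ x \in S :^ x by rewrite memJ_conjg.
    have := dihedral_center dihS r'z oz Six => /commute_sym.
    move=> /commgP/eqP e1; apply/commgP/eqP; apply: (conjg_inj x).
    by rewrite conjRg conjgKV e1 conj1g.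
  have Sd : d ^ x^-1 \in S by rewrite -mem_conjg (dihedral_mem_s dihS).
  have [od r'd _ _ _] := dihS.
  exists (d ^ x^-1); split=> //; first by rewrite orderJ.
    apply: (se_cent centK Ki oi (subsetP sSM _ Sd)); rewrite -ez.
    apply/commgP; rewrite -conjRg conjg_eq1; apply/commgP.
    exact: (dihedral_center dihS r'z oz (dihedral_mem_s dihS)).
  by rewrite -ez (inj_eq (conjg_inj _)); apply: contraNneq r'd => ->.
have Ji' : i' \in t ^: K by rewrite (se_class conjK Kt ot) Ki' oi'.
have [a Aa def_i'] := se_A_trans cM sKM fM conjK centK Kt ot Mu ou Ku Ji Ji'.
have na : a != 1 by apply: contraNneq nii' => a1; rewrite def_i' a1 conjg1.
have sAE := se_A_normal cM sKM centK Mu ou Ku.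
have CWi' : i' \in 'C(W) by have /setIP[] := subsetP sSC i' Si'.
(* [W] fixes [i] and [i' = i ^ a], and [a] is the only element of the regular group [A(u)] taking
   [i] to [i']; so [W] fixes [a]. *)
have CWa : a \in 'C(W).
  apply/centP=> w Ww; apply/commgP/conjg_fixP.
  apply: (se_A_inj cM sKM centK Mu ou Ku Ki oi) => //.
    by rewrite memJ_norm // (subsetP (normal_norm sAE)) // (subsetP (subsetIl _ _) w Ww).
  have iw : i ^ w = i by apply: commute_conjg; apply: (centP CWi).
  rewrite -[LHS]/(i ^ (a ^ w)) -{1}iw -conjJg -def_i'.
  by rewrite (commute_conjg (centP CWi' w Ww)).
set p := pdiv #[a]; have p_pr : prime p by rewrite pdiv_prime ?order_gt1.
have [y ay oy] : exists2 y, y \in <[a]> & #[y] = p.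
  by have [y ay oy] := Cauchy p_pr (pdiv_dvd #[a] : p %| #|<[a]>|); exists y.
have Ay : y \in [~: K :&: K :^ u, <[u]>] by apply: subsetP ay; rewrite cycle_subG.
have y_pr : prime #[y] by rewrite oy.
have CWy : W \subset 'C[y].
  by rewrite sub_cent1; apply: subsetP ay; rewrite cycle_subG.
have hK := se_normal_complement cM sKM fM conjK centK Kt ot Ks os cts nts Mu ou Ku Ay y_pr CWy.
have ndv := se_prime_not_dvd cM sKM fM conjK centK Kt ot Mu ou Ku Ay y_pr.
rewrite oy in hK ndv; pose K1 := 'O_p^'(K)%G.
have op : odd p.
  by rewrite -oy; apply: dvdn_odd (order_dvdG Ay) (se_A_odd cM sKM centK Mu ou Ku).
have sTK1 : T \subset K1.
  rewrite (sub_normal_Hall hK (pcore_normal _ _) sTK); apply: sub_pgroup tT => q /eqP->.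
  by apply/eqP=> p2; rewrite -p2 in op.
have sylT1 : 2.-Sylow(K1) T := pHall_subl sTK1 (pcore_sub _ _) sylTK.
have defK := Frattini_arg (pcore_normal _ _) sylT1.
have pN : p %| #|'N_K(T)|.
  have: p %| #|K1| * #|'N_K(T)|.
    apply: dvdn_trans (_ : #|K| %| _); first by rewrite -oy order_dvdG ?(subsetP (se_A_sub cM sKM centK Mu ou Ku)).
    by rewrite -{1}defK dvdn_cardMg.
  rewrite Euclid_dvdM // => /orP[pK1 | //]; have := pcore_pgroup p^' K.
  by move/pgroupP/(_ p p_pr pK1); rewrite !inE eqxx.
have [b /setIP[Kb Nb] ob] := Cauchy p_pr pN.
have CTb : b \in 'C(T) by apply: (dihedral_odd_norm_cent tT dihT r_gt2); rewrite ?ob.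
case/negP: ndv; rewrite -ob order_dvdG // inE (subsetP sKM) //=.
by apply/cent1P/commute_sym; apply/commute_sym/(centP CTb).
Qed.

End NoStronglyEmbedded.

Theorem dihedral8_no_strongly_embedded (K : {group gT}) :
    K \subset M -> (forall i, i \in T -> #[i] = 2 -> 'C_M[i] \subset K) ->
  K :=: M.
Proof.
move=> sKM cKT; apply/eqP; apply: contraT => nKM.
by case: (no_strongly_embedded_aux sKM nKM cKT).
Qed.

End SimpleDihedral.

(** * Minimal normal subgroups *)

Lemma dihedral_klein_pair (gT : finGroupType) (D P : {group gT}) r s :
    2.-group D -> dihedral_gens D r s -> P \subset D -> ~~ cyclic P ->
  exists a b, [/\ a \in P, b \in P, #[a] = 2, #[b] = 2 & commute a b /\ a != b].
Proof.
move=> tD dihD sPD ncP; have [r' [d [dihP _ _]]] := dihedral_subgroup tD dihD sPD ncP.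
have [t rt ot] := dihedral_involution (pgroupS sPD tD) dihP.
have [od rd _ _ _] := dihP; exists t, d; split=> //.
- by apply: subsetP rt; rewrite cycle_subG (dihedral_mem_r dihP).
- exact: dihedral_mem_s dihP.
split; first exact: (dihedral_center dihP rt ot (dihedral_mem_s dihP)).
by apply: contraNneq rd => <-.
Qed.

Lemma dihedral_self_cent (gT : finGroupType) (D P : {group gT}) r s :
    2.-group D -> dihedral_gens D r s -> P \subset D -> ~~ cyclic P ->
  'C_D(P) \subset P.
Proof.
move=> tD dihD sPD ncP; have [r' [d [dihP def_r' rd]]] := dihedral_subgroup tD dihD sPD ncP.
have [t rt ot] := dihedral_involution (pgroupS sPD tD) dihP.
have Pd := dihedral_mem_s dihP; have Dd := subsetP sPD d Pd.
have [Pt rt'] : t \in P /\ t \in <[r]> by apply/setIP; rewrite -def_r'.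
have key y : y \in <[r]> -> commute y d -> y \in P.
  move=> ry cyd; have [od rdi] := dihedral_reflection dihD Dd rd.
  have yd : y ^ d = y^-1 by have /cycleP[n ->] := ry; apply: conj_inv_exp.
  have [-> | ny] := eqVneq y 1; first exact: group1.
  rewrite (dihedral_involution_rot ry rt' _ ot) //; apply: order2P => //.
  by rewrite -{1}(commute_conjg cyd) yd mulVg.
apply/subsetP=> x /setIP[Dx cPx]; have cxd := centP cPx d Pd.
have [rx | rx] := boolP (x \in <[r]>); first exact: key.
rewrite -(groupMr x Pd); apply: key; first exact: (dihedral_mul_notin dihD).
by apply: commute_sym; apply: commuteM => //; apply: commute_sym.
Qed.

Lemma dihedral_grank (gT : finGroupType) (D : {group gT}) r s :
  dihedral_gens D r s -> 'm(D) <= 2.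
Proof.
move=> dihD; apply/grank2P; exists r, s.
split; [exact: dihedral_mem_r dihD | exact: dihedral_mem_s dihD |].
apply/eqP; rewrite eqEsubset gen_subG; apply/andP; split.
  apply/subsetP=> x /set2P[] ->; [exact: dihedral_mem_r dihD | exact: dihedral_mem_s dihD].
by case: dihD => _ _ _ _ <-; rewrite mul_subG // cycle_subG mem_gen // !inE eqxx ?orbT.
Qed.

Section DihedralSylow.

Variables (gT : finGroupType) (L D : {group gT}) (r s : gT).
Hypothesis O1 : 'O_2^'(L) = 1.
Hypotheses (sylD : 2.-Sylow(L) D) (dihD : dihedral_gens D r s).

Let sDL : D \subset L. Proof. exact: pHall_sub sylD. Qed.
Let tD : 2.-group D. Proof. exact: pHall_pgroup sylD. Qed.

(** A noncyclic abelian subgroup of a dihedral 2-group has order 4. *)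
Lemma dihedral_rank2 a b w : a \in L -> b \in L -> w \in L ->
    #[a] = 2 -> #[b] = 2 -> #[w] = 2 -> a != b ->
    commute a b -> commute a w -> commute b w ->
  w \in <[a]> <*> <[b]>.
Proof.
move=> La Lb Lw oa ob ow nab cab caw cbw; pose V := (<[a]> <*> <[b]>)%G.
have cVw : <[w]> \subset 'C(V).
  rewrite cycle_subG /= centY !cent_cycle; apply/setIP.
  by split; apply/cent1P; apply: commute_sym.
pose P := (V <*> <[w]>)%G.
have defP : P :=: V * <[w]> by rewrite /P /= cent_joinEr.
have tP : 2.-group P.
  by rewrite defP pgroupM /pgroup card_klein // -orderE ow.
have abP : abelian P.
  by rewrite /P /= abelianY klein_abelian //= cycle_abelian.
have sPL : P \subset L by rewrite !join_subG !cycle_subG La Lb.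
have [x Lx sPx] := Sylow_Jsub sylD sPL tP.
have sVP : V \subset P by apply: joing_subl.
have ncP : ~~ cyclic (P :^ x).
  by rewrite cyclicJ; apply: contra (klein_noncyclic oa ob nab); apply: cyclicS.
have [r' [d [dihP _ _]]] := dihedral_subgroup tD dihD sPx ncP.
have [od _ r'd _ _] := dihP.
have cr'd : commute r' d.
  have abPx : abelian (P :^ x) by rewrite abelianJ.
  exact: (centsP abPx _ (dihedral_mem_r dihP) _ (dihedral_mem_s dihP)).
have r'2 : #[r'] <= 2.
  by rewrite dvdn_leq // order_dvdn expg2 -{1}(commute_conjg cr'd) r'd mulVg.
have -> : <[a]> <*> <[b]> = P.
  apply/eqP; rewrite eqEcard sVP /= -(cardJg P x) (card_dihedral_gens dihP) card_klein //.
  by rewrite (leq_mul2l 2 _ 2) r'2.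
by rewrite mem_gen // inE cycle_id orbT.
Qed.

Lemma sub_normal_core (M : {group gT}) : M <| L -> 'O_2^'(M) = 1.
Proof.
move=> nsM; apply/trivgP; rewrite -O1 pcore_max ?pcore_pgroup //.
exact: gFnormal_trans.
Qed.

Lemma normal_2group_sub (M : {group gT}) : M <| L -> 2.-group M -> M \subset D.
Proof.
move=> nsM tM; apply: subset_trans (pcore_max tM nsM) _.
exact: pcore_sub_Hall sylD.
Qed.

Lemma central_inv_grank z : z \in L -> #[z] = 2 -> L \subset 'C[z] -> 'm(L) <= 2.
Proof.
move=> Lz oz cLz.
have Dz : z \in D.
  rewrite -cycle_subG normal_2group_sub // /pgroup -?orderE ?oz //.
  by rewrite /normal cycle_subG Lz cents_norm // cent_cycle.
have cz x : x \in L -> commute x z by move=> Lx; apply/cent1P/(subsetP cLz).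
(* A central [z] outside [<[r]>] forces [#[r] = 2]: then [D] is a Klein group and [z] may play the
   part of [r]. *)
have [r0 [s0 [dih0 rz]]] : exists r0 s0, dihedral_gens D r0 s0 /\ z \in <[r0]>.
  have [rz | rz] := boolP (z \in <[r]>); first by exists r, s.
  have [_ rzi] := dihedral_reflection dihD Dz rz.
  have crz : commute r z := cz r (subsetP sDL r (dihedral_mem_r dihD)).
  have or : #[r] = 2.
    have [_ _ _ ev _] := dihD; apply/eqP; rewrite eqn_dvd ev andbT order_dvdn expg2.
    by rewrite -{1}(commute_conjg crz) rzi mulVg.
  have [_ _ _ _ defD] := dihedral_change dihD Dz rz.
  exists z, r; split; last exact: cycle_id.
  split=> //.
  - by rewrite cycle2g // !inE -order_eq1 or /=; apply: contra rz => /eqP<-; apply: cycle_id.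
  - by rewrite (commute_conjg (commute_sym crz)) involution_inv.
  - by rewrite oz.
  rewrite -defD; apply: normC; rewrite cycle_subG (subsetP (cent_sub _)) // cent_cycle.
  exact/cent1P/commute_sym.
have hL : 2^'.-Hall(L) 'O_2^'(L).
  apply: (dihedral_transfer sylD dih0 rz oz) => x d Lx Dd rd.
  apply: contra rd => /eqP/(canRL (conjgK x)) ->.
  by rewrite (commute_conjg _) //; apply: commuteV; apply: commute_sym; apply: cz.
have := odd_Hall_prod sylD hL; rewrite O1 mul1g => <-.
exact: dihedral_grank dih0.
Qed.

(** Here ['C_L[t] = D], so [#|L : D|] is the size of the class of [t] in [V], that is 1 or 3. In the
    second case [r] and an element of order 3 generate [L], as in A4 or S4. *)
Lemma normal_klein_grank (V : {group gT}) :
  V <| L -> 2.-abelem V -> ~~ cyclic V -> 'm(L) <= 2.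
Proof.
move=> nsV abV ncV; have [tV cVV _] := and3P abV.
have sVD := normal_2group_sub nsV tV; have [sVL nVL] := andP nsV.
have [t rt ot] := dihedral_involution tD dihD.
have [r' [d [dihV def_r' rd]]] := dihedral_subgroup tD dihD sVD ncV.
have Vd := dihedral_mem_s dihV; have Vr' := dihedral_mem_r dihV.
have or' : #[r'] = 2.
  have [_ _ _ ev _] := dihV; apply: (abelem_order_p abV Vr').
  by apply: contraTneq ev => ->; rewrite order1.
have Vt : t \in V.
  have rr' : r' \in <[r]> by have: r' \in V :&: <[r]>; [rewrite -def_r' cycle_id | case/setIP].
  by rewrite (dihedral_involution_rot rt rr' ot or').
have [Dt Lt] := (subsetP sVD t Vt, subsetP sVL t Vt).
have nsVD : V <| D := normalS sVD sDL nsV.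
have hCV := cent_Sylow_Hall sylD nsVD (dihedral_self_cent tD dihD sVD ncV).
have nsCV : 'C_L(V) <| L by rewrite /normal subsetIl normsI ?normG ?norms_cent.
have OCV : 'O_2^'('C_L(V)) = 1 by apply: sub_normal_core.
have sCV : 'C_L(V) \subset V.
  apply: subset_trans (dihedral_self_cent tD dihD sVD ncV).
  rewrite subsetI subsetIr andbT normal_2group_sub //.
  by rewrite -(pgroupNK 2) /pgroup -partn_eq1 ?cardG_gt0 // -(card_Hall hCV) /= OCV cards1.
have sDC : D \subset 'C_L[t].
  rewrite subsetI sDL; apply/subsetP=> x Dx; apply/cent1P/commute_sym.
  exact: (dihedral_center dihD rt ot Dx).
have sylDC : 2.-Sylow('C_L[t]) D := pHall_subl sDC (subsetIl _ _) sylD.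
have defC : 'C_L[t] = D.
  have hC : 2^'.-Hall('C_L[t]) 'O_2^'('C_L[t]).
    apply: (dihedral_transfer sylDC dihD rt ot) => x e /setIP[_ /cent1P cxt] De re.
    apply: contra re => /eqP/(canRL (conjgK x)) ->.
    by rewrite (commute_conjg _) //; apply/commuteV/commute_sym.
  have := odd_Hall_prod sylDC hC; set O := 'O_2^'('C_L[t]).
  suff -> : O = 1 by rewrite mul1g.
  have sVC : V \subset 'C_L[t] := subset_trans sVD sDC.
  have tiOV : O :&: V = 1.
    apply: coprime_TIg; rewrite coprime_sym (pnat_coprime tV) //.
    exact: pcore_pgroup.
  have sOV : O \subset V.
    apply: subset_trans sCV; rewrite subsetI; apply/andP; split.
      by apply: subset_trans (pcore_sub _ _) (subsetIl _ _).
    apply/commG1P/trivgP; rewrite -tiOV commg_subI // subsetI subxx /=.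
      by apply: subset_trans (subset_trans (pcore_sub _ _) (subsetIl _ _)) nVL.
    by apply: subset_trans sVC (gFnorm _ _).
  by rewrite -tiOV (setIidPl sOV).
have sOrb : t ^: L \subset V^#.
  apply/subsetP=> _ /imsetP[x Lx ->]; rewrite !inE -order_eq1 orderJ ot /=.
  by rewrite memJ_norm // (subsetP nVL).
have cardL : #|L| = (#|t ^: L| * #|D|)%N.
  by rewrite -defC -index_cent1 mulnC Lagrange // subsetIl.
have cardV : #|V| = 4 by rewrite (card_dihedral_gens dihV) or'.
have orb3 : #|t ^: L| <= 3.
  by rewrite -ltnS -cardV (cardsD1 1 V) group1 ltnS subset_leq_card.
have odd_orb : odd #|t ^: L|.
  have [_ _ t'] := and3P sylD; rewrite odd_2'nat.
  by move: t'; rewrite -divgS // cardL mulnK ?cardG_gt0.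
have [o1 | o3] : #|t ^: L| = 1%N \/ #|t ^: L| = 3.
  by move: (#|_|) orb3 odd_orb => [|[|[|[|]]]] //; auto.
  have -> : L :=: D by apply/eqP; rewrite eq_sym eqEcard sDL cardL o1 mul1n /=.
  exact: dihedral_grank dihD.
have [x Lx ox] : exists2 x, x \in L & #[x] = 3.
  by have [|x Lx ox] := @Cauchy _ 3 L isT; [rewrite cardL o3 dvdn_mulr | exists x].
have [Lr Dr] : r \in L /\ r \in D by rewrite (subsetP sDL) (dihedral_mem_r dihD).
pose X := <<[set r; x]>>%G.
have Xr : r \in X by rewrite mem_gen // !inE eqxx.
have Xx : x \in X by rewrite mem_gen // !inE eqxx orbT.
have Xt : t \in X by apply: subsetP rt; rewrite cycle_subG.
have ntx : t != t ^ x.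
  apply/eqP=> tx; have Dx : x \in D.
    by rewrite -defC inE Lx cent1C mem_cent1E -tx eqxx.
  by have := mem_p_elt tD Dx; rewrite /p_elt ox.
have Vtx : t ^ x \in V by rewrite memJ_norm // (subsetP nVL).
have otx : #[t ^ x] = 2 by rewrite orderJ.
have sVX : V \subset X.
  have -> : V :=: <[t]> <*> <[t ^ x]>.
    apply/esym/eqP; rewrite eqEcard join_subG !cycle_subG Vt Vtx cardV card_klein //.
    exact: (centsP cVV).
  by rewrite join_subG !cycle_subG Xt groupJ.
have sDX : D \subset X.
  have Dd := subsetP sVD d Vd.
  have [_ _ _ _ <-] := dihedral_change dihD Dd rd.
  by rewrite mul_subG // cycle_subG // (subsetP sVX).
apply/grank2P; exists r, x; split=> //.
have sXL : X \subset L by rewrite gen_subG; apply/subsetP=> y /set2P[] ->.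
apply/eqP; rewrite eqEcard sXL cardL o3 dvdn_leq ?cardG_gt0 // Gauss_dvd.
  by rewrite -{1}ox order_dvdG // cardSg.
rewrite coprime_sym; apply: (pnat_coprime tD); by [].
Qed.

End DihedralSylow.

Section MinimalNormal.

Variables (gT : finGroupType) (L D M : {group gT}) (r s : gT).
Hypothesis O1 : 'O_2^'(L) = 1.
Hypotheses (sylD : 2.-Sylow(L) D) (dihD : dihedral_gens D r s).
Hypotheses (minM : minnormal M L) (sML : M \subset L).

Let nsM : M <| L.
Proof. by have [/andP[_ nM] _] := mingroupP minM; rewrite /normal sML. Qed.

Let ntM : M :!=: 1.
Proof. by have [/andP[nt _] _] := mingroupP minM. Qed.

Lemma minnormal_sol_grank : solvable M -> 'm(L) <= 2.
Proof.
move=> solM; have [nM _ /is_abelemP[p p_pr abM]] := minnormal_solvable minM (subxx M) solM.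
have pM := abelem_pgroup abM.
have p2 : p = 2.
  apply/eqP; apply: contraNT ntM => np2; rewrite -subG1 -O1 pcore_max //.
  by apply: sub_pgroup pM => q /eqP->; rewrite !inE np2.
rewrite {p p_pr}p2 in abM pM.
have [cM | ncM] := boolP (cyclic M); last exact: (normal_klein_grank O1 sylD dihD nsM abM ncM).
have oM := cyclic_abelem_prime abM cM ntM.
have /cyclicP[z defM] := cM; have oz : #[z] = 2 by rewrite orderE -defM.
apply: (central_inv_grank O1 sylD dihD _ oz).
  by rewrite -cycle_subG -defM.
apply/subsetP=> x Lx; have Mzx : z ^ x \in M.
  by rewrite memJ_norm ?(subsetP nM) // defM cycle_id.
rewrite cent1C mem_cent1E; move: Mzx; rewrite defM cycle2g // => /set2P[zx | -> //].
by have := orderJ z x; rewrite zx order1 oz.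
Qed.

Hypothesis nsolM : ~~ solvable M.

(** With a cyclic Sylow 2-subgroup and a trivial odd core, [N] would be a 2-group; then ['O_2(M)]
    would be all of [M] by minimality, against insolubility. *)
Lemma subnormal_noncyclic (N P : {group gT}) :
  N <| M -> N :!=: 1 -> 2.-Sylow(N) P -> ~~ cyclic P.
Proof.
move=> nsN ntN sylP; apply: contra nsolM => cP.
have := cyclic_Sylow2_complement sylP cP.
have -> : 'O_2^'(N) = 1.
  apply/trivgP; rewrite -(sub_normal_core O1 nsM) pcore_max ?pcore_pgroup //.
  exact: gFnormal_trans.
rewrite mul1g => defN.
have tN : 2.-group N by rewrite -defN; apply: pHall_pgroup sylP.
have sNO : N \subset 'O_2(M) by apply: pcore_max.
have [_ minM'] := mingroupP minM.
have defO : 'O_2(M) = M.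
  apply: minM'; last exact: pcore_sub.
  rewrite /= (gFnorm_trans _ (normal_norm nsM)) andbT.
  by apply: contraNneq ntN => O21; rewrite -subG1 -O21.
by rewrite -defO (pgroup_sol (pcore_pgroup _ _)).
Qed.

Lemma subnormal_klein_pair (N : {group gT}) : N <| M -> N :!=: 1 ->
  exists a b, [/\ a \in N, b \in N, #[a] = 2, #[b] = 2 & commute a b /\ a != b].
Proof.
move=> nsN ntN; have [P sylP] := Sylow_exists 2 N; have [sPN tP _] := and3P sylP.
have ncP := subnormal_noncyclic nsN ntN sylP.
have sPL : P \subset L := subset_trans (subset_trans sPN (normal_sub nsN)) sML.
have [x Lx sPx] := Sylow_Jsub sylD sPL tP.
have ncPx : ~~ cyclic (P :^ x) by rewrite cyclicJ.
have [a [b [Pa Pb oa ob [cab nab]]]] :=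
  dihedral_klein_pair (pHall_pgroup sylD) dihD sPx ncPx.
exists (a ^ x^-1), (b ^ x^-1).
rewrite !orderJ oa ob (inj_eq (conjg_inj _)) nab !(subsetP sPN) -?mem_conjg //.
by split=> //; split=> //; apply/commgP; rewrite -conjRg conjg_eq1; apply/commgP.
Qed.

(** A conjugate [N :^ l] other than [N] would commute with it elementwise, so [a ^ l] would commute
    with the Klein group of [a] and [b] in [N]; the 2-rank of [L] forces [a ^ l] into
    [N :&: N :^ l = 1]. *)
Lemma minnormal_simple : simple M.
Proof.
have [N minN sNM] := minnormal_exists ntM (normG M).
have [/andP[ntN nMN] minN'] := mingroupP minN.
have nsN : N <| M by rewrite /normal sNM.
have [a [b [Na Nb oa ob [cab nab]]]] := subnormal_klein_pair nsN ntN.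
have sNL := subset_trans sNM sML.
suff nLN : L \subset 'N(N).
  have [_ minM'] := mingroupP minM.
  have defN : N :=: M by apply: minM'; rewrite // ntN.
  by rewrite /simple -{1}(group_inj defN).
apply/subsetP=> l Ll; apply: contraT => nNl.
have nsNl : N :^ l <| M.
  by rewrite -(normsP (normal_norm nsM) l Ll) normalJ.
have tiN : N :&: N :^ l = 1.
  apply/eqP; apply: contraT => ntI.
  have defI : N :&: N :^ l = N.
    apply: minN'; last exact: subsetIl.
    by rewrite /= ntI normsI // normal_norm.
  case/negP: nNl; rewrite -groupV inE sub_conjgV.
  by apply/setIidPl.
have Nal : a ^ l \in N :^ l by rewrite memJ_conjg.
have cNNl x y : x \in N -> y \in N :^ l -> commute x y.
  move=> Nx Nly; apply/commgP/eqP; apply: (TI_mem tiN).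
    rewrite commgEl groupM ?groupV // memJ_norm // (subsetP nMN) //.
    exact: subsetP (normal_sub nsNl) y Nly.
  rewrite commgEr groupM // memJ_norm ?groupV // (subsetP (normal_norm nsNl)) //.
  exact: subsetP sNM x Nx.
have Nal' : a ^ l \in N.
  have sV : <[a]> <*> <[b]> \subset N by rewrite join_subG !cycle_subG Na.
  apply: (subsetP sV); apply: (dihedral_rank2 sylD dihD) => //.
  - exact: subsetP sNL a Na.
  - exact: subsetP sNL b Nb.
  - by rewrite groupJ // (subsetP sNL).
  - by rewrite orderJ.
  - exact: cNNl.
  exact: cNNl.
by have := orderJ a l; rewrite (TI_mem tiN Nal' Nal) order1 oa.
Qed.

Lemma minnormal_cent : 'C_L(M) = 1.
Proof.
have nsC : 'C_L(M) <| L by rewrite /normal subsetIl normsI ?normG ?norms_cent ?normal_norm.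
have [a [b [Ma Mb oa ob [cab nab]]]] := subnormal_klein_pair (normal_refl M) ntM.
apply/trivgP; rewrite -O1 pcore_max // /pgroup -odd_2'nat.
apply: contraT; rewrite -dvdn2 => /(Cauchy (isT : prime 2))[w /setIP[Lw cMw] ow].
have sV : <[a]> <*> <[b]> \subset M by rewrite join_subG !cycle_subG Ma.
have Mw : w \in M.
  apply: (subsetP sV); apply: (dihedral_rank2 sylD dihD) => //.
  - exact: subsetP sML a Ma.
  - exact: subsetP sML b Mb.
  - exact/commute_sym/(centP cMw).
  exact/commute_sym/(centP cMw).
have Zw : w \in 'Z(M) by rewrite inE Mw.
have [_ simM'] := simpleP _ minnormal_simple.
have [Z1 | ZM] := simM' 'Z(M)%G (center_normal M).
  by move: Zw; rewrite Z1 => /set1P w1; rewrite w1 order1 in ow.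
by case/negP: nsolM; rewrite -ZM; apply: abelian_sol; apply: center_abelian.
Qed.

End MinimalNormal.

Lemma dihedral_reduction (gT : finGroupType) (L D : {group gT}) r s :
    'O_2^'(L) = 1 -> 2.-Sylow(L) D -> dihedral_gens D r s ->
    (forall M : {group gT}, M <| L -> simple M -> 'C_L(M) = 1 -> ~~ cyclic (D :&: M) ->
       'm(L) <= 2) ->
  'm(L) <= 2.
Proof.
move=> O1 sylD dihD simple_case.
have ntL : L :!=: 1.
  apply: contraNneq (_ : s != 1) => [L1|].
    have := subsetP (pHall_sub sylD) s (dihedral_mem_s dihD).
    by rewrite L1 inE.
  by rewrite -order_eq1; case: dihD => ->.
have [M minM sML] := minnormal_exists ntL (normG L).
have [solM | nsolM] := boolP (solvable M).
  exact: minnormal_sol_grank O1 sylD dihD minM sML solM.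
have nsM : M <| L by have [/andP[_ nM] _] := mingroupP minM; rewrite /normal sML.
have ntM : M :!=: 1 by have [/andP[nt _] _] := mingroupP minM.
apply: (simple_case M nsM).
- exact: minnormal_simple O1 sylD dihD minM sML nsolM.
- exact: minnormal_cent O1 sylD dihD minM sML nsolM.
apply: (subnormal_noncyclic O1 minM sML nsolM (normal_refl M) ntM).
by have := Sylow_setI_normal nsM sylD; rewrite setIC.
Qed.

(** * Simple groups with a Klein Sylow 2-subgroup *)

Section FourGroup.

Variables (gT : finGroupType) (M V : {group gT}) (t s : gT).
Hypotheses (cM : odd_cyclic M) (simM : simple M).
Hypotheses (sylV : 2.-Sylow(M) V) (dihV : dihedral_gens V t s) (ot : #[t] = 2).

Let sVM : V \subset M. Proof. exact: pHall_sub sylV. Qed.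
Let tV : 2.-group V. Proof. exact: pHall_pgroup sylV. Qed.
Let Vt : t \in V. Proof. exact: dihedral_mem_r dihV. Qed.
Let Vs : s \in V. Proof. exact: dihedral_mem_s dihV. Qed.
Let os : #[s] = 2. Proof. by case: dihV. Qed.
Let rt : t \in <[t]>. Proof. exact: cycle_id. Qed.
Let cts : commute t s. Proof. exact: (dihedral_center dihV rt ot Vs). Qed.
Let nts : t != s.
Proof. by case: dihV => _ ns _ _ _; apply: contraNneq ns => <-. Qed.
Let Mt : t \in M. Proof. exact: subsetP sVM t Vt. Qed.

Lemma four_mem x : x \in V -> [\/ x = 1, x = t, x = s | x = t * s].
Proof.
move=> Vx; apply: (klein_mem ot os cts); case: dihV => _ _ _ _ defV.
by rewrite cent_joinEr ?defV // cent_cycle cycle_subG; apply/cent1P/commute_sym.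
Qed.

Lemma four_order x : x \in V -> x != 1 -> #[x] = 2.
Proof.
move/four_mem=> -[-> | -> | -> | -> _] //; first by rewrite eqxx.
exact: klein_involution.
Qed.

Lemma four_abelian : abelian V.
Proof.
case: dihV => _ _ _ _ <-; rewrite abelianM !cycle_abelian cent_cycle cycle_subG.
exact/cent1P/commute_sym.
Qed.

Lemma four_gen a b : a \in V -> b \in V -> a != 1 -> b != 1 -> a != b -> <[a]> <*> <[b]> = V.
Proof.
move=> Va Vb na nb nab; have cab : commute a b := centsP four_abelian a Va b Vb.
apply/eqP; rewrite eqEcard join_subG !cycle_subG Va Vb card_klein ?four_order //.
by rewrite (card_dihedral_gens dihV) ot.
Qed.

Lemma four_cases a b x : a \in V -> b \in V -> a != 1 -> b != 1 -> a != b -> x \in V ->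
  [\/ x = 1, x = a, x = b | x = a * b].
Proof.
move=> Va Vb na nb nab; have cab : commute a b := centsP four_abelian a Va b Vb.
by rewrite -{1}(four_gen Va Vb na nb nab); apply: klein_mem; rewrite ?four_order.
Qed.

Lemma four_fix2 x a b : a \in V -> b \in V -> a != 1 -> b != 1 -> a != b ->
  a ^ x = a -> b ^ x = b -> x \in 'C(V).
Proof.
move=> Va Vb na nb nab ax bx; rewrite -(four_gen Va Vb na nb nab) centY !cent_cycle.
by apply/setIP; split; apply/cent1P/commute_sym/commgP/conjg_fixP.
Qed.

Lemma four_other a : a \in V -> exists b, [/\ b \in V, b != 1 & a != b].
Proof.
move=> Va; have [-> | nta] := eqVneq a t; last by exists t; rewrite -order_eq1 ot.
by exists s; rewrite -order_eq1 os.
Qed.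

Lemma four_no_fix x a : x \in 'N(V) -> odd #[x] -> x \notin 'C(V) ->
  a \in V -> a != 1 -> a ^ x != a.
Proof.
move=> Nx ox ncx Va na; apply: contra ncx => /eqP ax.
have [b [Vb nb nab]] := four_other Va.
have Vbx : b ^ x \in V by rewrite memJ_norm.
have nbx : b ^ x != 1 by rewrite conjg_eq1.
have nabx : b ^ x != a by rewrite -{1}ax (inj_eq (conjg_inj _)) eq_sym.
case: (four_cases Va Vb na nb nab Vbx) => bx; rewrite ?bx ?eqxx // in nbx nabx.
  exact: four_fix2 Va Vb na nb nab ax bx.
apply: odd_sqr_mem ox _; apply: (four_fix2 Va Vb) => //.
  by rewrite expgS expg1 conjgM !ax.
by rewrite expgS expg1 conjgM bx conjMg ax bx mulgA involution_mulK ?four_order ?mul1g.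
Qed.

Lemma four_cycle x a : x \in 'N(V) -> odd #[x] -> x \notin 'C(V) ->
  a \in V -> a != 1 -> a ^ (x ^+ 2) = a * a ^ x.
Proof.
move=> Nx ox ncx Va na.
have Vax : a ^ x \in V by rewrite memJ_norm.
have nax : a ^ x != 1 by rewrite conjg_eq1.
have naax : a != a ^ x by rewrite eq_sym four_no_fix.
have nx2 : x ^+ 2 \notin 'C(V) by apply: contra ncx; apply: odd_sqr_mem.
have ox2 : odd #[x ^+ 2] by apply: dvdn_odd (orderXdvd x 2) ox.
have : a ^ (x ^+ 2) != 1 by rewrite conjg_eq1.
have := four_no_fix (groupX 2 Nx) ox2 nx2 Va na.
have := four_no_fix Nx ox ncx Vax nax.
rewrite -conjgM -[x * x]/(x ^+ 2).
have Vx2 : a ^ (x ^+ 2) \in V by rewrite memJ_norm ?groupX.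
case: (four_cases Va Vax na nax naax Vx2) => -> //; rewrite ?eqxx //.
Qed.

(** Burnside's theorem provides an element acting nontrivially on [V]. Its 2'-part permutes the
    three involutions cyclically, so it or its square takes [t] to [s]. *)
Lemma four_fused_norm : exists x, [/\ x \in 'N_M(V), odd #[x], x \notin 'C(V) & t ^ x = s].
Proof.
have /subsetPn[x /setIP[Mx Nx] ncx] : ~~ ('N_M(V) \subset 'C(V)).
  apply/negP=> sNC; have hM := Burnside_normal_complement sylV sNC.
  have [_ simM'] := simpleP _ simM.
  case: (simM' 'O_2^'(M)%G (pcore_normal _ _)) => [O1 | OM].
    have := odd_Hall_prod sylV hM; rewrite O1 mul1g => defM.
    case/negP: (simple_not_pgroup simM sylV dihV rt ot 2).
    by rewrite -defM.
  have oM : odd #|M| by rewrite -OM odd_core.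
  by have := order_dvdG Mt; rewrite ot dvdn2 oM.
have sylN : 2.-Sylow('N_M(V)) V.
  by apply: pHall_subl sylV; rewrite ?subsetIl // subsetI sVM normG.
have Nx2 : x.`_2 \in 'N_M(V) by rewrite inE !groupX.
have Vx2 : x.`_2 \in V by rewrite (mem_normal_Hall sylN (normalSG sVM) Nx2) p_elt_constt.
set y := x.`_2^'; have oy : odd #[y] by rewrite odd_2'nat; apply: p_elt_constt.
have ncy : y \notin 'C(V).
  apply: contra ncx => cy; rewrite -(consttC 2 x) groupM //.
  exact: subsetP four_abelian _ Vx2.
have [My Ny] : y \in M /\ y \in 'N(V) by split; apply: groupX.
have nt1 : t != 1 by rewrite -order_eq1 ot.
have ns1 : s != 1 by rewrite -order_eq1 os.
have Vty : t ^ y \in V by rewrite memJ_norm.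
case: (four_cases Vt Vs nt1 ns1 nts Vty) => ty.
- by case/negP: nt1; rewrite -(conjg_eq1 t y) ty.
- by have := four_no_fix Ny oy ncy Vt nt1; rewrite ty eqxx.
- by exists y; split=> //; apply/setIP.
exists (y ^+ 2); split.
- by apply: groupX; apply/setIP.
- exact: dvdn_odd (orderXdvd y 2) oy.
- by apply: contra ncy; apply: odd_sqr_mem.
by rewrite four_cycle // ty mulgA involution_mulK // mul1g.
Qed.

(** Odd elements of ['N(V)] induce the identity or a 3-cycle on the three involutions, so modulo
    ['C(V)] they are powers of [x]. *)
Lemma four_mod x h : x \in 'N(V) -> odd #[x] -> x \notin 'C(V) ->
  h \in 'N(V) -> odd #[h] -> exists2 z, z \in <[x]> & h * z \in 'C(V).
Proof.
move=> Nx ox ncx Nh oh; have [ch | nch] := boolP (h \in 'C(V)).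
  by exists 1; rewrite ?mulg1 ?group1.
have nt1 : t != 1 by rewrite -order_eq1 ot.
have step y : y \in 'N(V) -> odd #[y] -> y \notin 'C(V) -> t ^ h = t ^ y -> h * y^-1 \in 'C(V).
  move=> Ny oy ncy ty; have Vty : t ^ y \in V by rewrite memJ_norm.
  have nty : t ^ y != 1 by rewrite conjg_eq1.
  apply: (four_fix2 Vt Vty nt1 nty).
  - by rewrite eq_sym four_no_fix.
  - by rewrite conjgM ty conjgK.
  rewrite -{1}ty -conjgM mulgA -[h * h]/(h ^+ 2) conjgM four_cycle // ty.
  by rewrite -four_cycle // -conjgM -[y ^+ 2]/(y * y) mulgK.
have Vtx : t ^ x \in V by rewrite memJ_norm.
have Vth : t ^ h \in V by rewrite memJ_norm.
have ntx : t ^ x != 1 by rewrite conjg_eq1.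
have nttx : t != t ^ x by rewrite eq_sym four_no_fix.
case: (four_cases Vt Vtx nt1 ntx nttx Vth) => th.
- by case/negP: nt1; rewrite -(conjg_eq1 t h) th.
- by have := four_no_fix Nh oh nch Vt nt1; rewrite th eqxx.
- by exists x^-1; [rewrite groupV cycle_id | apply: step].
exists (x ^+ 2)^-1; first by rewrite groupV mem_cycle.
apply: step.
- exact: groupX.
- exact: dvdn_odd (orderXdvd x 2) ox.
- by apply: contra ncx; apply: odd_sqr_mem.
by rewrite four_cycle.
Qed.

Let sylN : 2.-Sylow('N_M(V)) V.
Proof. by apply: pHall_subl sylV; rewrite ?subsetIl // subsetI sVM normG. Qed.

(** A group of odd order acts trivially on one of order 3, so [cent_Sylow_prime_norm] excludes this
    prime. It makes the action of 3-elements on [W] coprime. *)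
Lemma four_odd_prime (q : nat) (W := 'O_2^'('C_M(V))) : q = 3 -> ~~ (q %| #|W|).
Proof.
move=> q3; apply/negP=> q_dv; have q_pr : prime q by rewrite q3.
have [b Wb ob] := Cauchy q_pr q_dv.
have sbC : <[b]> \subset 'C_M(V) by rewrite cycle_subG (subsetP (pcore_sub _ _) b Wb).
have oq : odd q by rewrite q3.
case: (@cent_Sylow_prime_norm _ M V t s t cM simM sylV dihV rt ot q <[b]>%G q_pr oq sbC ob).
move=> h _ oh Nb; rewrite -cycle_subG.
apply: (@subset_cent_index _ <[h]>%G <[b]>%G 2); rewrite ?cycle_subG ?cycle_cyclic //.
  by rewrite -orderE ob q3.
move=> p p_pr ph; rewrite dvdn_prime2 // => /eqP p2.
by have := dvdn_odd ph oh; rewrite p2.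
Qed.

(** The cube of an odd element of ['N(V)] centralizes [V], so [x] may be taken a 3-element. The
    least prime [p] dividing the order of ['C_W(<[x]>)], nontrivial because of [B], then contradicts
    [cent_Sylow_prime_norm]. *)
Lemma four_cent_prime_false (q : nat) (B : {group gT}) x :
    prime q -> odd q -> B \subset 'C_M(V) -> #|B| = q ->
    x \in 'N_M(V) -> odd #[x] -> x \notin 'C(V) -> x \in 'C(B) -> False.
Proof.
wlog x3 : x / 3.-elt x => [IH|] q_pr oq sBC oB NMx ox ncx cBx.
  have [_ Nx] := setIP NMx.
  apply: (IH x.`_3) => //.
  - exact: p_elt_constt.
  - exact: groupX.
  - exact: dvdn_odd (orderXdvd _ _) ox.
  - apply: contra ncx => c3; rewrite -(consttC 3 x) groupM //.
    set y := x.`_3^'; have Ny : y \in 'N(V) by apply: groupX.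
    have oy : odd #[y] := dvdn_odd (orderXdvd _ _) ox.
    apply: contraT => ncy; have nt1 : t != 1 by rewrite -order_eq1 ot.
    have ns1 : s != 1 by rewrite -order_eq1 os.
    have ty3 a : a \in V -> a != 1 -> a ^ (y ^+ 3) = a.
      move=> Va na; have Vay : a ^ y \in V by rewrite memJ_norm.
      have caay : commute a (a ^ y) := centsP four_abelian a Va _ Vay.
      rewrite expgSr conjgM (four_cycle Ny oy ncy Va na) conjMg -conjgM.
      rewrite -[y * y]/(y ^+ 2) (four_cycle Ny oy ncy Va na) caay mulgA.
      by rewrite involution_mulK ?mul1g // four_order // conjg_eq1.
    have gen_y : generator <[y]> (y ^+ 3).
      rewrite generator_coprime coprime_sym prime_coprime // -p'natE //.
      exact: p_elt_constt.
    case/negP: ncy; rewrite -cycle_subG (eqP gen_y) cycle_subG.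
    exact: (four_fix2 Vt Vs nt1 ns1 nts (ty3 t Vt nt1) (ty3 s Vs ns1)).
  exact: groupX.
have [Mx Nx] := setIP NMx.
pose W := 'O_2^'('C_M(V))%G; have oW : odd #|W| := odd_core _.
have hW : 2^'.-Hall('C_M(V)) W := cent_self_Hall sylV.
have sWC : W \subset 'C_M(V) := pcore_sub _ _.
have sBW : B \subset W by rewrite (odd_sub_core hW) ?oB.
have nWx : x \in 'N(W).
  have : x \in 'N('C_M(V)) by apply: (subsetP (subcent_norm _ _)).
  by apply: subsetP; apply: gFnorms.
pose Cx := 'C_W(<[x]>)%G.
have sBCx : B \subset Cx.
  by rewrite subsetI sBW centsC cycle_subG.
have ntCx : 1 < #|Cx|.
  by apply: leq_trans (subset_leq_card sBCx); rewrite oB prime_gt1.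
pose p := pdiv #|Cx|; have p_pr : prime p by rewrite pdiv_prime.
have [b Cb ob] := Cauchy p_pr (pdiv_dvd #|Cx| : p %| #|Cx|).
have [Wb cxb] := setIP Cb.
have op : odd p by rewrite -ob; apply: dvdn_odd (order_dvdG Wb) oW.
have sbC : <[b]> \subset 'C_M(V) by rewrite cycle_subG (subsetP sWC).
have cbx : <[x]> \subset 'C(<[b]>) by rewrite centsC cycle_subG.
have cbV : V \subset 'C(<[b]>).
  by rewrite centsC; apply: subset_trans sbC (subsetIr _ _).
case: (@cent_Sylow_prime_norm _ M V t s t cM simM sylV dihV rt ot p <[b]>%G p_pr op sbC ob).
move=> h /setIP[Mh Nh] oh Nbh.
have [z xz chz] := four_mod Nx ox ncx Nh oh.
have cbz : z \in 'C(<[b]>) := subsetP cbx z xz.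
rewrite -(groupMr h cbz); set c := h * z.
have Mc : c \in M by rewrite groupM //; apply: subsetP xz; rewrite cycle_subG.
have Cc : c \in 'C_M(V) by apply/setIP.
have Nbc : c \in 'N(<[b]>) by rewrite groupM // (subsetP (cent_sub _)).
rewrite -(consttC 2 c) groupM //.
  apply: (subsetP cbV); rewrite (mem_normal_Hall sylN (normalSG sVM)) ?p_elt_constt //.
  by rewrite inE !groupX //= (subsetP (cent_sub _)).
pose Y := 'N_W(<[b]>)%G.
have Yc : c.`_2^' \in Y.
  rewrite inE [X in _ && X]groupX // andbT; apply: (odd_mem_core hW); first exact: groupX.
  by rewrite odd_2'nat; apply: p_elt_constt.
have sYW : Y \subset W := subsetIl _ _.
have nYx : <[x]> \subset 'N(Y).
  apply: normsI; first by rewrite cycle_subG.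
  exact: subset_trans cbx (subset_trans (cent_sub _) (normG _)).
have coYx : coprime #|Y| #|<[x]>|.
  rewrite coprime_sym (pnat_coprime x3) // p'natE //.
  by apply: contra (four_odd_prime (erefl 3)) => dv; apply: dvdn_trans dv (cardSg sYW).
have cY : odd_cyclic Y.
  by apply: odd_cyclicS cM; apply: subset_trans sYW (subset_trans sWC (subsetIl _ _)).
(* [[~: Y, <[x]>]] centralizes [b] since both factors normalize the cyclic [<[b]>]; ['C_Y(<[x]>)]
   does by the choice of [p]. *)
have defY := coprime_comm_cent_prod nYx coYx (odd_cyclic_sol (oddSg sYW oW) cY).
apply: subsetP Yc; rewrite -{1}defY mul_subG //.
  apply: comm_norm_cyclic_cent; first exact: cycle_cyclic.
    exact: subsetIr.
  exact: subset_trans cbx (cent_sub _).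
apply: (@odd_pgroup_cent_prime _ p ('C_Y(<[x]>))%G <[b]>%G) => //.
  by rewrite subIset // subsetIr.
move=> p' p'_pr p'dv; apply: pdiv_min_dvd; first exact: prime_gt1.
by apply: dvdn_trans p'dv (cardSg _); apply: setSI.
Qed.

(** * Strongly embedded subgroups when the Sylow 2-subgroup is a Klein group *)

Section FourStronglyEmbedded.

Variables (K : {group gT}) (x : gT).
Hypotheses (sKM : K \subset M) (nKM : K :!=: M).
Hypothesis centKV : forall i, i \in V -> #[i] = 2 -> 'C_M[i] \subset K.
Hypotheses (Kx : x \in K) (Nx : x \in 'N(V)) (ox : odd #[x]) (ncx : x \notin 'C(V)).

Let sVC : V \subset 'C_M[t] := Sylow_cent_inv sylV dihV rt ot.

Let sVK : V \subset K.
Proof. exact: subset_trans sVC (centKV Vt ot). Qed.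

Let sylVK : 2.-Sylow(K) V.
Proof. exact: pHall_subl sVK sKM sylV. Qed.

Let centK i : i \in K -> #[i] = 2 -> 'C_M[i] \subset K.
Proof.
move=> Ki oi; have siK : <[i]> \subset K by rewrite cycle_subG.
have ti : 2.-group <[i]> by rewrite /pgroup -orderE oi.
have [y Ky] := Sylow_Jsub sylVK siK ti; rewrite -cycleJ cycle_subG => Viy.
rewrite -(conjSg _ _ y) (conjGid Ky) conjIg (conjGid (subsetP sKM y Ky)) -cent1J.
by rewrite centKV ?orderJ.
Qed.

Let nt1 : t != 1. Proof. by rewrite -order_eq1 ot. Qed.

Let conjK a b : a \in K -> b \in K -> #[a] = 2 -> #[b] = 2 -> exists2 g, g \in K & b = a ^ g.
Proof.
suff fuse c : c \in K -> #[c] = 2 -> exists2 g, g \in K & c = t ^ g.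
  move=> Ka Kb oa ob; have [g Kg ->] := fuse a Ka oa; have [h Kh ->] := fuse b Kb ob.
  by exists (g^-1 * h); rewrite ?groupM ?groupV // conjgM conjgK.
move=> Kc oc; have scK : <[c]> \subset K by rewrite cycle_subG.
have tc : 2.-group <[c]> by rewrite /pgroup -orderE oc.
have [y Ky] := Sylow_Jsub sylVK scK tc; rewrite -cycleJ cycle_subG => Vcy.
suff [g Kg def_cy] : exists2 g, g \in K & c ^ y = t ^ g.
  by exists (g * y^-1); rewrite ?groupM ?groupV // conjgM -def_cy conjgK.
have Vtx : t ^ x \in V by rewrite memJ_norm.
have ntx : t ^ x != 1 by rewrite conjg_eq1.
have nttx : t != t ^ x by rewrite eq_sym four_no_fix.
case: (four_cases Vt Vtx nt1 ntx nttx Vcy) => cy.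
- by have := orderJ c y; rewrite cy order1 oc.
- by exists 1; rewrite ?group1 // conjg1.
- by exists x.
by exists (x ^+ 2); rewrite ?groupX // four_cycle.
Qed.

Let fM := simple_fused simM sylV dihV rt ot.
Let Kt : t \in K. Proof. exact: subsetP sVK t Vt. Qed.
Let Ks : s \in K. Proof. exact: subsetP sVK s Vs. Qed.

(** A subgroup [B] of prime order here commutes with [u] and with an involution of [K], so ['C_M(B)]
    has no normal 2-complement. It then contains a conjugate of [V] and an odd element moving it,
    against [four_cent_prime_false]. *)
Lemma four_se_W u : u \in M -> #[u] = 2 -> u \notin K -> 'C_(K :&: K :^ u)[u] = 1.
Proof.
move=> Mu ou Ku; pose W := 'C_(K :&: K :^ u)[u]%G.
apply/eqP; apply: contraT => ntW.
have sWE : W \subset K :&: K :^ u := subsetIl _ _.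
have oW : odd #|W| := oddSg sWE (se_inter_odd sKM centK Mu ou Ku).
pose q := pdiv #|W|; have q_pr : prime q by rewrite pdiv_prime // cardG_gt1.
have [b Wb ob] := Cauchy q_pr (pdiv_dvd #|W| : q %| #|W|).
have oq : odd q by rewrite -ob; apply: dvdn_odd (order_dvdG Wb) oW.
have [i Ji sWi] := se_W_fix cM sKM fM conjK centK Kt ot Mu ou Ku.
have [Ki oi] : i \in K /\ #[i] = 2.
  by move: Ji; rewrite (se_class conjK Kt ot) => /andP[-> /eqP->].
have Mi := subsetP sKM i Ki.
pose B := <[b]>%G; have oB : #|B| = q by [].
have sBW : B \subset W by rewrite cycle_subG.
have sBM : B \subset M.
  exact: subset_trans sBW (subset_trans sWE (subset_trans (subsetIl _ _) sKM)).
pose C := 'C_M[i]%G; pose O := 'O_2^'(C)%G.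
have sBC : B \subset C by rewrite subsetI sBM (subset_trans sBW).
have hC : 2^'.-Hall(C) O := conj_inv_Hall simM sylV dihV rt ot Mi oi.
have sBO : B \subset O by rewrite (odd_sub_core hC) ?oB.
have nOC : C \subset 'N(O) := gFnorm _ _.
have cO : odd_cyclic O.
  by apply: odd_cyclicS cM; apply: subset_trans (pcore_sub _ _) (subsetIl _ _).
(* Frattini argument on the subgroups of order [q] of [O]. Since [O] is odd, ['N_C(B)] keeps the
   full 2-part of [#|C|], which provides an involution [v != i]. *)
have sCN : C \subset 'N_C(B) * O.
  apply/subsetP=> g Cg; have Ng := subsetP nOC g Cg.
  have sBgO : B :^ g \subset O by rewrite -(normP Ng) conjSg.
  have [y Oy defB] := conj_order_prime cO q_pr oq sBO sBgO oB (etrans (cardJg _ _) oB).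
  rewrite -(mulgKV y g) mem_mulg // inE groupM ?groupV //=; last first.
    by apply: subsetP Oy; apply: pcore_sub.
  by apply/normP; rewrite conjsgM defB conjsgK.
have NCi : i \in 'N_C(B).
  rewrite inE inE Mi cent1id /= (subsetP (cent_sub _)) // -sub_cent1.
  by apply: subset_trans sBW _; rewrite sWi.
have ti : 2.-group <[i]> by rewrite /pgroup -orderE oi.
have siN : <[i]> \subset 'N_C(B) by rewrite cycle_subG.
have [P sylP] := Sylow_superset siN ti; rewrite cycle_subG => Pi.
have [sPN tP _] := and3P sylP.
have P4 : 4 <= #|P|.
  rewrite (card_Hall sylP); have -> : 4 = (#|V|`_2)%N.
    by rewrite part_pnat_id // (card_dihedral_gens dihV) ot.
  apply: dvdn_leq; first exact: part_gt0.
  have dvV : #|V| %| #|'N_C(B)| * #|O|.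
    apply: dvdn_trans (dvdn_cardMg _ _).
    have [g Mg def_i] := fM (subsetP sKM t Kt) Mi ot oi.
    have -> : 'N_C(B) * O = C.
      by apply/eqP; rewrite eqEsubset sCN mul_subG ?subsetIl ?pcore_sub.
    rewrite -(cardJg V g) cardSg // /C def_i /= cent1J -{1}(conjGid Mg) -conjIg conjSg.
    exact: sVC.
  apply: dvdn_trans (partn_dvd 2 _ dvV) _; first by rewrite muln_gt0 !cardG_gt0.
  by rewrite partnM // [X in (_ * X)%N]part_p'nat ?muln1 //; apply: pcore_pgroup.
have sPC : P \subset C := subset_trans sPN (subsetIl _ _).
have sPM : P \subset M := subset_trans sPC (subsetIl _ _).
have [v Pv niv] : exists2 v, v \in P & v \notin <[i]>.
  apply/subsetPn; apply: contraL P4 => sPi; rewrite -ltnNge.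
  by rewrite (leq_ltn_trans (subset_leq_card sPi)) // -orderE oi.
have [g Mg sPV] := Sylow_Jsub sylV sPM tP.
have ov : #[v] = 2.
  rewrite -(orderJ v g) four_order //; first by rewrite (subsetP sPV) // memJ_conjg.
  by rewrite conjg_eq1; apply: contraNneq niv => ->; apply: group1.
have civ : commute i v.
  by have /setIP[_ /cent1P/commute_sym] := subsetP sPC v Pv.
have Mv := subsetP sPM v Pv.
have Kv : v \in K := se_cent centK Ki oi Mv civ.
have niv' : i != v by apply: contraNneq niv => <-; apply: cycle_id.
have cBi : i \in 'C(B) by rewrite -sub_cent1; apply: subset_trans sBW sWi.
have cBu : u \in 'C(B) by rewrite -sub_cent1; apply: subset_trans sBW (subsetIr _ _).
have siX : <[i]> \subset 'C_M(B) by rewrite cycle_subG inE Mi.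
have [S sylS] := Sylow_superset siX ti; rewrite cycle_subG => Si.
have Nv : v \in 'N(B) by have /setIP[] := subsetP sPN v Pv.
have Ni : i \in 'N(B) by have /setIP[] := NCi.
have notnil := se_cent_not_nilpotent cM sKM centK Mu Ku cBu Ki oi Kv ov civ niv' Ni Nv sylS Si.
have ncS : ~~ cyclic S by apply/negP => /(cyclic_Sylow2_complement sylS).
have [sSX tS _] := and3P sylS; have sSM := subset_trans sSX (subsetIl _ _).
have [y My sSV] := Sylow_Jsub sylV sSM tS.
have defSy : S :^ y = V.
  have ncSy : ~~ cyclic (S :^ y) by rewrite cyclicJ.
  have [p' [d [dihS _ _]]] := dihedral_subgroup tV dihV sSV ncSy.
  apply/eqP; rewrite eqEcard sSV (card_dihedral_gens dihV) ot (card_dihedral_gens dihS).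
  have [_ _ _ ev _] := dihS; rewrite leq_mul2l /=; exact: dvdn_leq (order_gt0 _) ev.
have abS : abelian S by rewrite -(abelianJ _ y) defSy four_abelian.
have /subsetPn[w /setIP[Xw Nw] ncw] : ~~ ('N_('C_M(B))(S) \subset 'C(S)).
  apply/negP=> sNC; case: notnil; apply: (odd_Hall_prod sylS).
  exact: Burnside_normal_complement sylS sNC.
have sylNS : 2.-Sylow('N_('C_M(B))(S)) S.
  by apply: pHall_subl sylS; rewrite ?subsetIl // subsetI sSX normG.
have NXw2 : w.`_2 \in 'N_('C_M(B))(S) by rewrite inE !groupX.
have Sw2 : w.`_2 \in S by rewrite (mem_normal_Hall sylNS (normalSG sSX) NXw2) p_elt_constt.
set z := w.`_2^'; have oz : odd #[z] by rewrite odd_2'nat; apply: p_elt_constt.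
have ncz : z \notin 'C(S).
  apply: contra ncw => cz; rewrite -(consttC 2 w) groupM //; exact: subsetP abS _ Sw2.
have [Mw cBw] := setIP Xw.
exfalso; apply: (@four_cent_prime_false q (B :^ y)%G (z ^ y) q_pr oq).
- rewrite -defSy centJ /= -{1}(conjGid My) -conjIg conjSg subsetI sBM centsC.
  exact: subset_trans sSX (subsetIr _ _).
- by rewrite cardJg.
- by rewrite inE groupJ ?groupX //= -defSy normJ memJ_conjg groupX.
- by rewrite orderJ.
- by rewrite -defSy centJ memJ_conjg.
by rewrite /= centJ memJ_conjg groupX.
Qed.

Let exists_outside : exists2 u, u \in M & #[u] = 2 /\ u \notin K.
Proof.
have /subsetPn[g Mg Kg] : ~~ (M \subset K).
  by apply: contra nKM => sMK; rewrite eqEsubset sKM.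
have [u Kgu ou] := se_coset_involution cM sKM fM conjK centK Kt ot Mg.
have /rcosetP[k Kk def_u] := Kgu.
exists u; first by rewrite def_u groupM // (subsetP sKM).
by rewrite ou def_u groupMl.
Qed.

(** For each prime dividing [#|t ^: K| = #|K : C|], [K] has a normal complement containing [C]. The
    normal closure of [C] therefore has order prime to that index, and is [C] itself. *)
Lemma four_se_cent_normal : 'C_M[t] <| K.
Proof.
have [u Mu [ou Ku]] := exists_outside.
set C := 'C_M[t]; have sCK : C \subset K := centK Kt ot.
pose N := <<class_support C K>>%G.
have sNK : N \subset K by rewrite gen_subG class_support_sub_norm // normG.
have sCN : C \subset N by rewrite /N /= sub_gen // sub_class_support.
have cardK : #|K| = (#|t ^: K| * #|C|)%N.
  have -> : C = 'C_K[t] by apply/eqP; rewrite eqEsubset subsetI subsetIr sCK setSI.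
  by rewrite -index_cent1 mulnC Lagrange // subsetIl.
have coN : coprime #|N| #|t ^: K|.
  rewrite coprime_has_primes ?cardG_gt0 //; last by rewrite card_gt0; apply/set0Pn; exists t; apply: class_refl.
  apply/hasPn=> p; rewrite mem_primes => /and3P[p_pr _ p_dv].
  rewrite mem_primes p_pr cardG_gt0 /=.
  rewrite -(se_card_A cM sKM fM conjK centK Kt ot Mu ou Ku) in p_dv.
  have [y Ay oy] := Cauchy p_pr p_dv; rewrite -oy in p_pr *.
  have W1 : 'C_(K :&: K :^ u)[u] \subset 'C[y] by rewrite four_se_W // sub1G.
  have hK := se_normal_complement cM sKM fM conjK centK Kt ot Ks os cts nts Mu ou Ku Ay p_pr W1.
  have ndv := se_prime_not_dvd cM sKM fM conjK centK Kt ot Mu ou Ku Ay p_pr.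
  have sCO : C \subset 'O_(#[y]^')(K).
    rewrite (sub_normal_Hall hK (pcore_normal _ _) sCK) /pgroup p'natE //.
  have sNO : N \subset 'O_(#[y]^')(K).
    by rewrite gen_subG class_support_sub_norm // gFnorm.
  by have := pgroupS sNO (pcore_pgroup _ _); rewrite /pgroup p'natE.
suff defN : N :=: C by rewrite -defN /normal sNK norms_gen // class_support_norm.
apply/esym/eqP; rewrite eqEcard sCN dvdn_leq ?cardG_gt0 //.
by rewrite -(Gauss_dvdr _ coN) -cardK cardSg.
Qed.

Theorem four_strongly_embedded :
  [/\ K :=: 'N_M(V), forall i, i \in V -> i != 1 -> 'C_M[i] = 'C_M(V)
    & exists x0 u, [/\ x0 \in K, #[x0] = 3, 'C_M[x0] = <[x0]>, u \in M & #[u] = 2 /\ x0 ^ u = x0^-1]].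
Proof.
have [u Mu [ou Ku]] := exists_outside.
have nsC := four_se_cent_normal; set C := 'C_M[t] in nsC; have [sCK nCK] := andP nsC.
have ns1 : s != 1 by rewrite -order_eq1 os.
have centE i : i \in V -> i != 1 -> 'C_M[i] = C.
  move=> Vi ni; have Ki := subsetP sVK i Vi.
  have [k Kk ->] := conjK Kt Ki ot (four_order Vi ni).
  rewrite cent1J -{1}(conjGid (subsetP sKM k Kk)) -conjIg.
  exact: (normP (subsetP nCK k Kk)).
have defC : C = 'C_M(V).
  apply/eqP; rewrite eqEsubset subsetI subsetIl /=; apply/andP; split; last first.
    by rewrite setIS // -cent_cycle centS // cycle_subG.
  have -> : V :=: <[t]> <*> <[s]> by rewrite (four_gen Vt Vs nt1 ns1 nts).
  by rewrite centY !cent_cycle subsetI subsetIr -(centE s Vs ns1) subsetIr.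
have nsVC : V <| C.
  rewrite /normal sVC; apply: cents_norm; rewrite centsC -/C defC.
  by rewrite centsC subsetIr.
have hV : 2.-Hall(C) V := pHall_subl sVC (subsetIl _ _) sylV.
have nVK : K \subset 'N(V).
  apply/subsetP=> k Kk; rewrite inE (sub_normal_Hall hV nsVC) ?pgroupJ //.
  by have := sVC; rewrite -/C -(conjSg _ _ k) (normP (subsetP nCK k Kk)).
have defK : K :=: 'N_M(V).
  apply/eqP; rewrite eqEsubset subsetI sKM nVK /=.
  apply/subsetP=> g /setIP[Mg Ng].
  have Ktg : t ^ g \in K by apply: (subsetP sVK); rewrite memJ_norm.
  have [k Kk tk] := conjK Kt Ktg ot (etrans (orderJ _ _) ot).
  rewrite -(mulgKV k g) groupM //; apply: (subsetP sCK).
  have Mk := subsetP sKM k Kk.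
  apply/setIP; split; first by rewrite groupM ?groupV.
  by rewrite cent1C mem_cent1E conjgM tk conjgK.
split=> // [i Vi ni|]; first by rewrite centE.
have cardA := se_card_A cM sKM fM conjK centK Kt ot Mu ou Ku.
have oA := se_A_odd cM sKM centK Mu ou Ku.
have cA := se_A_cyclic cM sKM centK Mu ou Ku.
(* This order is the size of the class of [t] in [K]: at most 3, since [K] normalizes [V]; more than
   1, since [x] moves [t]; and odd. *)
have A3 : #|[~: K :&: K :^ u, <[u]>]| = 3.
  have le3 : #|t ^: K| <= 3.
    have <- : #|V^#| = 3.
      by have := cardsD1 1 V; rewrite group1 (card_dihedral_gens dihV) ot add1n => -[].
    apply: subset_leq_card; apply/subsetP=> _ /imsetP[k Kk ->].
    by rewrite !inE conjg_eq1 nt1 memJ_norm // (subsetP nVK).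
  have gt1 : 1 < #|t ^: K|.
    rewrite (cardsD1 t) class_refl ltnS card_gt0; apply/set0Pn; exists (t ^ x).
    by rewrite !inE four_no_fix // imset_f.
  rewrite cardA in oA *.
  by move: (#|_|) le3 gt1 oA => [|[|[|[|]]]].
have /cyclicP[x0 defA] := cA; have ox0 : #[x0] = 3 by rewrite orderE -defA.
have Ax0 : x0 \in [~: K :&: K :^ u, <[u]>] by rewrite defA cycle_id.
have := Ax0; rewrite -/(gval [~: _, _]%G) (se_mem_A cM sKM centK Mu ou Ku) => /andP[Kx0 /eqP x0u].
have pr3 : prime #[x0] by rewrite ox0.
have sNA : 'N_K(<[x0]>) \subset <[x0]>.
  apply: subset_trans (se_norm_prime cM sKM fM conjK centK Kt ot Ks os cts nts Mu ou Ku Ax0 pr3) _.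
  rewrite -(se_A_prod cM sKM centK Mu ou Ku) four_se_W // mulg1.
  by rewrite -defA.
exists x0, u; split=> //; apply/eqP; rewrite eqEsubset cycle_subG inE (subsetP sKM) // cent1id !andbT.
apply/subsetP=> c Cc; have /setIP[Mc cx0c] := Cc.
have [Kc | Kc] := boolP (c \in K).
  apply: (subsetP sNA); rewrite inE Kc (subsetP (cent_sub _)) // cent_cycle.
  exact: cx0c.
(* Both [k * c] and [k] invert [x0]; but [k] lies in ['N_K(<[x0]>)], that is in [<[x0]>], so it also
   centralizes [x0]. *)
have [k Kk [_ _ x0kc]] :=
  se_coset_inverting cM sKM fM conjK centK Kt ot Mu ou Ku Ax0 pr3 Cc Kc.
have x0c : x0 ^ c = x0.
  by apply/eqP; rewrite -mem_cent1E cent1C.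
have x0k : x0 ^ k = x0^-1.
  by apply: (conjg_inj c); rewrite -conjgM x0kc conjVg x0c.
have kx0 : k \in <[x0]>.
  by apply: (subsetP sNA); rewrite inE Kk /= -cycle_subG norms_cycle x0k groupV cycle_id.
have : x0 ^ k = x0 by apply: commute_conjg; apply: (centsP (cycle_abelian x0)) => //; apply: cycle_id.
rewrite x0k => x0V; have : #[x0] %| 2 by rewrite order_dvdn expg2 -{1}x0V mulVg.
by rewrite ox0.
Qed.

End FourStronglyEmbedded.

End FourGroup.

(** * Generators when involution centralizers generate M *)

(** A reflection [s] of [D :&: M] serves both groups. Normality puts [r ^+ 2], a product of [s] and
    a conjugate of it, into [M], so [D :&: M] has index 1 or 2 in [D]. *)
Lemma dihedral_normal_inter (gT : finGroupType) (D M L : {group gT}) r s0 :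
    2.-group D -> dihedral_gens D r s0 -> D \subset L -> M <| L -> ~~ cyclic (D :&: M) ->
  exists s r', [/\ dihedral_gens D r s, s \in M, dihedral_gens (D :&: M) r' s
    & r' = r /\ D \subset M \/ r' = r ^+ 2 /\ r \notin M].
Proof.
move=> tD dih0 sDL nsM ncT; pose T := (D :&: M)%G.
have sTD : T \subset D := subsetIl _ _.
have [r1 [s [dihT def_r1 rs]]] := dihedral_subgroup tD dih0 sTD ncT.
have Ts := dihedral_mem_s dihT; have [Ds Ms] := setIP Ts.
have dihD := dihedral_change dih0 Ds rs; have [os _ rsi ev defD] := dihD.
have Dr := dihedral_mem_r dihD.
have [Mr | Mr] := boolP (r \in M).
  have sDM : D \subset M by rewrite -defD mul_subG ?cycle_subG.
  by exists s, r; split; rewrite // ?(setIidPl sDM) //; left.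
exists s, (r ^+ 2); split; rewrite // ; last by right.
have Mr2 : r ^+ 2 \in M.
  have -> : r ^+ 2 = s^-1 ^ r^-1 * s.
    by rewrite conjgE invgK -!mulgA -[s^-1 * _]conjgE conjVg rsi invgK expgS expg1.
  rewrite groupM // memJ_norm ?groupV //.
  exact: subsetP (normal_norm nsM) r (subsetP sDL r Dr).
have def_r2 : <[r ^+ 2]> = T :&: <[r]>.
  apply/eqP; rewrite eqEsubset cycle_subG !inE groupX // Mr2 mem_cycle /=.
  apply/subsetP=> x /setIP[/setIP[Dx Mx] /cycleP[n def_x]].
  have := odd_double_half n; case on : (odd n) => /= def_n.
    case/negP: Mr; rewrite -(groupMr r (groupX n./2 Mr2)) -expgM mul2n -expgS.
    by rewrite -add1n def_n -def_x.
  by rewrite def_x -def_n add0n -mul2n expgM mem_cycle.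
have [r1s er1 dr1 ev1 defT] := dihT; rewrite -def_r2 in def_r1.
split=> //.
- by rewrite def_r2; apply: contra rs => /setIP[].
- by rewrite conjXg rsi expgVn.
- by rewrite orderE -def_r1.
by rewrite -def_r1.
Qed.

Section NormalSimple.

Variables (gT : finGroupType) (L D M : {group gT}) (r s r' t : gT).
Hypotheses (cL : odd_cyclic L) (sylD : 2.-Sylow(L) D) (dihD : dihedral_gens D r s).
Hypotheses (nsM : M <| L) (simM : simple M) (CM : 'C_L(M) = 1).
Let T := (D :&: M)%G.
Hypotheses (dihT : dihedral_gens T r' s) (srr' : <[r']> \subset <[r]>).
Hypotheses (rt : t \in <[r']>) (ot : #[t] = 2).

Let sDL : D \subset L. Proof. exact: pHall_sub sylD. Qed.
Let tD : 2.-group D. Proof. exact: pHall_pgroup sylD. Qed.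
Let sML : M \subset L. Proof. exact: normal_sub nsM. Qed.
Let sTD : T \subset D. Proof. exact: subsetIl. Qed.
Let sTM : T \subset M. Proof. exact: subsetIr. Qed.
Let sylT : 2.-Sylow(M) T.
Proof. by have := Sylow_setI_normal nsM sylD; rewrite setIC. Qed.
Let rtD : t \in <[r]>. Proof. exact: subsetP srr' t rt. Qed.
Let Tt : t \in T.
Proof. by apply: subsetP rt; rewrite cycle_subG (dihedral_mem_r dihT). Qed.
Let Ms : s \in M.
Proof. exact: subsetP sTM s (dihedral_mem_s dihT). Qed.
Let Mt : t \in M. Proof. exact: subsetP sTM t Tt. Qed.
Let nsTD : T <| D.
Proof. by rewrite /normal sTD normsI ?normG // (subset_trans sDL) ?normal_norm. Qed.

Let ncT : ~~ cyclic T.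
Proof.
have [os rs _ _ _] := dihT; have Ts := dihedral_mem_s dihT.
apply/negP=> cT; case/negP: rs.
have /eqP est : <[s]> == <[t]>.
  by rewrite (eq_subG_cyclic cT) ?cycle_subG // -!orderE os ot.
have: s \in <[t]> by rewrite -est cycle_id.
by apply: subsetP; rewrite cycle_subG.
Qed.

Local Notation O := 'O_2^'('C_L[t])%G.
Local Notation R := 'O_2^'('C_L(T))%G.
Local Notation Z := [~: 'O_2^'('C_L[t]), T]%G.

Lemma ns_cent_Hall : 2^'.-Hall('C_L[t]) O.
Proof. exact: cent_inv_Hall sylD dihD rtD ot. Qed.

Lemma ns_cent_prod : O * D = 'C_L[t].
Proof.
apply: odd_Hall_prod ns_cent_Hall.
exact: pHall_subl (Sylow_cent_inv sylD dihD rtD ot) (subsetIl _ _) sylD.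
Qed.

Lemma ns_Sylow_cent_Hall : 2^'.-Hall('C_L(T)) R.
Proof. exact: cent_Sylow_Hall sylD nsTD (dihedral_self_cent tD dihD sTD ncT). Qed.

Lemma ns_core_odd : odd #|O|. Proof. exact: odd_core. Qed.
Lemma ns_core_sub : O \subset L.
Proof. exact: subset_trans (pcore_sub _ _) (subsetIl _ _). Qed.
Lemma ns_core_odd_cyclic : odd_cyclic O. Proof. exact: odd_cyclicS ns_core_sub cL. Qed.

Let sDC : D \subset 'C_L[t]. Proof. exact: Sylow_cent_inv sylD dihD rtD ot. Qed.
Let nOD : D \subset 'N(O). Proof. exact: subset_trans sDC (gFnorm _ _). Qed.
Let nOT : T \subset 'N(O). Proof. exact: subset_trans sTD nOD. Qed.

Let coOT : coprime #|O| #|T|.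
Proof.
by rewrite coprime_sym (pnat_coprime (pgroupS sTD tD)) // -odd_2'nat ns_core_odd.
Qed.

Lemma ns_R_def : 'C_O(T) = R.
Proof.
apply/eqP; rewrite eqEsubset; apply/andP; split.
  apply: (odd_sub_core ns_Sylow_cent_Hall); first by rewrite setSI // ns_core_sub.
  exact: oddSg (subsetIl _ _) ns_core_odd.
have sRC : R \subset 'C_L(T) := pcore_sub _ _.
rewrite subsetI; apply/andP; split; last exact: subset_trans sRC (subsetIr _ _).
apply: (odd_sub_core ns_cent_Hall); last exact: odd_core.
apply: subset_trans sRC _; rewrite /= setIS // -cent_cycle centS // cycle_subG.
exact: Tt.
Qed.

Lemma ns_Z_cyclic : cyclic Z.
Proof.
exact: cyclicS (comm_odd_cyclic_Fitting ns_core_odd ns_core_odd_cyclic nOT)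
  (cyclic_Fitting ns_core_odd ns_core_odd_cyclic).
Qed.

Lemma ns_Z_subM : Z \subset M.
Proof.
apply: subset_trans (commgSS ns_core_sub sTM) _.
by rewrite commg_subr normal_norm.
Qed.

Lemma ns_core_prod : Z * R = O.
Proof.
have solO := odd_cyclic_sol ns_core_odd ns_core_odd_cyclic.
by rewrite -ns_R_def; apply: coprime_comm_cent_prod.
Qed.

(** As [M] fuses its involutions, [L = 'C_L[t] * M]; and ['C_L[t] = Z * R * D], where [Z] and [s]
    lie in [M]. So [R] and [r] are all that is missing. *)
Lemma ns_gen (X : {group gT}) : M \subset X -> R \subset X -> r \in X -> L \subset X.
Proof.
move=> sMX sRX Xr; apply/subsetP=> x Lx.
have Mtx : t ^ x \in M by rewrite memJ_norm // (subsetP (normal_norm nsM)).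
have [m Mm tm] := simple_fused simM sylT dihT rt ot Mt Mtx ot (etrans (orderJ t x) ot).
rewrite -(mulgKV m x) groupM //; last exact: (subsetP sMX).
have : x * m^-1 \in 'C_L[t].
  apply/setIP; split; first by rewrite groupM ?groupV // (subsetP sML).
  by rewrite cent1C mem_cent1E conjgM tm conjgK.
apply: subsetP; rewrite -ns_cent_prod -ns_core_prod mul_subG ?mul_subG //.
  exact: subset_trans ns_Z_subM sMX.
by case: dihD => _ _ _ _ <-; rewrite mul_subG // cycle_subG // (subsetP sMX).
Qed.

Section Nose.

Hypothesis nose : forall K : {group gT}, K \subset M ->
  (forall i, i \in T -> #[i] = 2 -> 'C_M[i] \subset K) -> K :=: M.

Let nRD : D \subset 'N(R).
Proof.
apply: gFnorm_trans; rewrite normsI ?norms_cent ?(normal_norm nsTD) //.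
exact: (subset_trans sDL (normG L)).
Qed.

Let nZD : D \subset 'N(Z).
Proof. by rewrite normsR // normal_norm. Qed.

Let nZR : R \subset 'N(Z).
Proof.
have : R \subset O by rewrite -ns_R_def subsetIl.
move/subset_trans; apply; exact: commg_norml.
Qed.

(* A minimal normal subgroup B of 'C_L[t] inside 'C_R(Z) is the only subgroup of its order that
   is normal in 'C_L[i], for every involution i of T, so 'N_M(B) = M by [nose]. *)
Lemma ns_R_faithful : 'C_R(Z) = 1.
Proof.
pose K0 := 'C_R(Z)%G; apply/eqP; apply: contraT => ntK0.
have oK0 : odd #|K0| := oddSg (subsetIl _ _) (odd_core _).
have sRC : R \subset 'C_L(T) := pcore_sub _ _.
have sK0L : K0 \subset L.
  exact: subset_trans (subsetIl _ _) (subset_trans sRC (subsetIl _ _)).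
have nK0C : 'C_L[t] \subset 'N(K0).
  rewrite -ns_cent_prod -ns_core_prod !mul_subG //.
  - by rewrite cents_norm // centsC subsetIr.
  - by rewrite normsI ?normG // norms_cent.
  by rewrite normsI // norms_cent.
have [B minB sBK0] := minnormal_exists ntK0 nK0C.
have solK0 : solvable K0 := odd_cyclic_sol oK0 (odd_cyclicS sK0L cL).
have [nBC ntB /is_abelemP[q q_pr abB]] := minnormal_solvable minB sBK0 solK0.
have qB := abelem_pgroup abB.
have [_ q_dv _] := pgroup_pdiv qB ntB.
have oq : odd q := dvdn_odd q_dv (oddSg sBK0 oK0).
have sBL : B \subset L := subset_trans sBK0 sK0L.
have oB : #|B| = q := cyclic_abelem_prime abB (cL oq sBL qB) ntB.
have cBT : B \subset 'C(T).
  exact: subset_trans sBK0 (subset_trans (subsetIl _ _) (subset_trans sRC (subsetIr _ _))).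
have defN : 'N_M(B) = M.
  apply: nose; first exact: subsetIl.
  move=> i Ti oi; have Mi := subsetP sTM i Ti.
  have [g Mg def_i] := simple_fused simM sylT dihT rt ot Mt Mi ot oi.
  have Lg := subsetP sML g Mg.
  have defCi : 'C_L[i] = 'C_L[t] :^ g by rewrite def_i cent1J -{1}(conjGid Lg) -conjIg.
  have sBCi : B \subset 'C_L[i].
    by rewrite subsetI sBL -cent_cycle (subset_trans cBT) // centS // cycle_subG.
  have sBC : B \subset 'C_L[t].
    by rewrite subsetI sBL -cent_cycle (subset_trans cBT) // centS // cycle_subG.
  have nsBg : (B :^ g)%G <| 'C_L[i].
    by rewrite defCi /= normalJ /normal sBC.
  have cCi : odd_cyclic ('C_L[i])%G by apply: odd_cyclicS cL; apply: subsetIl.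
  have defB := odd_cyclic_normal_uniq cCi q_pr oq nsBg sBCi (etrans (cardJg _ _) oB) oB.
  rewrite subsetI subsetIl; apply: subset_trans (setSI _ sML) _.
  by rewrite defB normal_norm.
have nBM : M \subset 'N(B) by rewrite -defN subsetIr.
have [sBM | nsBM] := boolP (B \subset M).
  have [_ simM'] := simpleP _ simM.
  case: (simM' B); first by rewrite /normal sBM.
    by move=> B1; rewrite B1 eqxx in ntB.
  move=> defBM; have := order_dvdG Mt; rewrite -defBM ot dvdn2.
  by rewrite (oddSg sBK0 oK0).
have tiB : B :&: M = 1 by apply: prime_TIg; rewrite // oB.
case/negP: ntB; rewrite -subG1 -CM subsetI sBL /=.
apply/commG1P/trivgP; rewrite -tiB commg_subI // subsetI subxx //.
exact: subset_trans sBL (normal_norm nsM).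
Qed.

(** Commutators of [R] with [A] act trivially on the cyclic [Z], and ['C_R(Z) = 1]. *)
Lemma ns_R_cent (A : {group gT}) : A \subset 'N(Z) -> A \subset 'N(R) -> R \subset 'C(A).
Proof.
move=> nZA nRA; apply/commG1P/trivgP; rewrite -ns_R_faithful subsetI commg_subl nRA.
exact: comm_norm_cyclic_cent ns_Z_cyclic nZR nZA.
Qed.

Lemma ns_R_cyclic : cyclic R.
Proof.
have abR : abelian R by apply: ns_R_cent; rewrite ?normG.
have cR : odd_cyclic R.
  by apply: odd_cyclicS cL; apply: subset_trans (pcore_sub _ _) (subsetIl _ _).
exact: nil_Zgroup_cyclic (odd_cyclic_Zgroup (odd_core _) cR) (abelian_nil abR).
Qed.

Lemma ns_R_D : R \subset 'C(D).
Proof. exact: ns_R_cent. Qed.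

End Nose.

End NormalSimple.

Lemma coprime_mul_mem (gT : finGroupType) (X : {group gT}) a b :
  commute a b -> coprime #[a] #[b] -> a * b \in X -> a \in X /\ b \in X.
Proof.
move=> cab co Xab; have defC := cycleM cab co.
have sCX : <[a]> * <[b]> \subset X by rewrite -defC cycle_subG.
split; apply: (subsetP sCX).
  by rewrite -[a in a \in _]mulg1 mem_mulg ?cycle_id ?group1.
by rewrite -[b in b \in _]mul1g mem_mulg ?cycle_id ?group1.
Qed.

Section DihedralMore.

Variables (gT : finGroupType) (D : {group gT}) (r s : gT).
Hypothesis dihD : dihedral_gens D r s.

Lemma dihedral_conj_rot k : k \in <[r]> -> s ^ k = s * (k * k).
Proof.
move=> rk; have [_ _ rs _ _] := dihD.
have ks : k ^ s = k^-1 by have /cycleP[n ->] := rk; apply: conj_inv_exp.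
apply: (mulgI s^-1); rewrite mulKg conjgE !mulgA; congr (_ * k).
by rewrite -mulgA -conjgE conjVg ks invgK.
Qed.

Lemma dihedral_notin_sqr : r \notin <[r ^+ 2]>.
Proof.
have [_ _ _ ev _] := dihD; apply/negP=> /order_dvdG; rewrite -orderE orderXdiv //.
move/(dvdn_leq _); have := dvdn_leq (order_gt0 r) ev.
have := divn_gt0 #[r] (isT : 0 < 2)%N => -> -> /(_ isT).
by rewrite leqNgt ltn_Pdiv ?order_gt0.
Qed.

Lemma dihedral_commg d : d \in D -> s^-1 * s ^ d \in <[r ^+ 2]>.
Proof.
move=> Dd; have [_ _ rs _ _] := dihD.
have sq k : k \in <[r]> -> k * k \in <[r ^+ 2]>.
  by case/cycleP=> n ->; rewrite -expgD addnn -mul2n expgM mem_cycle.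
have [rd | rd] := boolP (d \in <[r]>); first by rewrite dihedral_conj_rot // mulKg sq.
have [k rk ->] := dihedral_notin dihD Dd rd; have ks : k ^ s = k^-1.
  by have /cycleP[n ->] := rk; apply: conj_inv_exp.
rewrite conjgM dihedral_conj_rot // conjMg [s ^ s]conjgE mulKg mulKg.
by rewrite conjMg ks sq ?groupV.
Qed.

Lemma dihedral_reflection_conj d : d \in D -> d \notin <[r]> ->
  exists2 k, k \in <[r]> & d = s ^ k \/ d = (s * r) ^ k.
Proof.
move=> Dd rd; have [k0 rk0 def_d] := dihedral_notin dihD Dd rd.
have [os _ rs _ _] := dihD.
have k0s : k0 * s = s * k0^-1.
  have /cycleP[n def] := rk0; have: k0 ^ s = k0^-1 by rewrite def; apply: conj_inv_exp.
  by move=> <-; rewrite conjgE mulKVg.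
have rk0' : k0^-1 \in <[r]> by rewrite groupV.
have /cycleP[n def_n] := rk0'.
rewrite def_d k0s def_n; have := odd_double_half n; case: (odd n) => /= <-.
  exists (r ^+ n./2); first exact: mem_cycle.
  right; rewrite conjMg dihedral_conj_rot ?mem_cycle // -mulgA; congr (_ * _).
  rewrite (commute_conjg (commuteX _ (commute_refl r))) -expgD -expgSr.
  by rewrite addnn add1n.
exists (r ^+ n./2); first exact: mem_cycle.
by left; rewrite dihedral_conj_rot ?mem_cycle // -expgD addnn add0n.
Qed.

End DihedralMore.

Section NormalSimpleGen.

Variables (gT : finGroupType) (L D M : {group gT}) (r s r' t : gT).
Hypotheses (cL : odd_cyclic L) (sylD : 2.-Sylow(L) D) (dihD : dihedral_gens D r s).
Hypotheses (nsM : M <| L) (simM : simple M) (CM : 'C_L(M) = 1).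
Let T := (D :&: M)%G.
Hypotheses (dihT : dihedral_gens T r' s) (srr' : <[r']> \subset <[r]>).
Hypotheses (rt : t \in <[r']>) (ot : #[t] = 2).
Hypothesis nose : forall K : {group gT}, K \subset M ->
  (forall i, i \in T -> #[i] = 2 -> 'C_M[i] \subset K) -> K :=: M.

Let sDL : D \subset L. Proof. exact: pHall_sub sylD. Qed.
Let sML : M \subset L. Proof. exact: normal_sub nsM. Qed.
Let cM : odd_cyclic M. Proof. exact: odd_cyclicS sML cL. Qed.
Let sTD : T \subset D. Proof. exact: subsetIl. Qed.
Let tT : 2.-group T. Proof. exact: pgroupS sTD (pHall_pgroup sylD). Qed.
Let sTM : T \subset M. Proof. exact: subsetIr. Qed.
Let sylT : 2.-Sylow(M) T.
Proof. by have := Sylow_setI_normal nsM sylD; rewrite setIC. Qed.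
Let Tt : t \in T.
Proof. by apply: subsetP rt; rewrite cycle_subG (dihedral_mem_r dihT). Qed.
Let Ts : s \in T. Proof. exact: dihedral_mem_s dihT. Qed.
Let Ms : s \in M. Proof. exact: subsetP sTM s Ts. Qed.
Let Mt : t \in M. Proof. exact: subsetP sTM t Tt. Qed.
Let os : #[s] = 2. Proof. by case: dihT. Qed.

Local Notation R := 'O_2^'('C_L(T))%G.

Let sRL : R \subset L. Proof. exact: subset_trans (pcore_sub _ _) (subsetIl _ _). Qed.
Let cRT : R \subset 'C(T). Proof. exact: subset_trans (pcore_sub _ _) (subsetIr _ _). Qed.
Let R_fix y x : y \in R -> x \in T -> x ^ y = x.
Proof.
move=> Ry Tx; apply: commute_conjg.
by have /centP/(_ x Tx) := subsetP cRT y Ry.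
Qed.

Let cent1_conj a x : x \in L -> 'C_M[a ^ x] = 'C_M[a] :^ x.
Proof.
move=> Lx; rewrite conjIg cent1J; congr (_ :&: _).
by have /normP-> := subsetP (normal_norm nsM) x Lx.
Qed.

(** By [nose] it is enough that [X] contains the centralizers in [M] of the involutions of [T].
    Fusion in [X] reduces these to ['C_M[a]], which is its odd core times an [X]-conjugate of
    [T]. *)
Lemma ns_fused_sub (X : {group gT}) a : X \subset L -> T \subset X -> a \in T ->
    #[a] = 2 -> 'O_2^'('C_M[a]) \subset X ->
    (forall i, i \in T -> #[i] = 2 -> exists2 x, x \in X & i = a ^ x) ->
  M \subset X.
Proof.
move=> sXL sTX Ta oa sOX fX.
have [x Xx tax] := fX t Tt ot; have Lx := subsetP sXL x Xx.
have nMx : x^-1 \in 'N(M) by rewrite groupV (subsetP (normal_norm nsM)).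
have sTC : (T :^ x^-1)%G \subset 'C_M[a].
  rewrite /= sub_conjgV -cent1_conj // -tax.
  exact: Sylow_cent_inv sylT dihT rt ot.
have sylTx : 2.-Sylow('C_M[a]) (T :^ x^-1)%G.
  by apply: pHall_subl sTC (subsetIl _ _) _; rewrite pHallJnorm.
have sCX : 'C_M[a] \subset X.
  rewrite -(odd_Hall_prod sylTx); last first.
    exact: (conj_inv_Hall simM sylT dihT rt ot (subsetP sTM a Ta) oa).
  by rewrite mul_subG // -(conjGid (groupVr Xx)) conjSg.
suff <- : X :&: M = M by apply: subsetIl.
apply: (nose (K := X :&: M)); first exact: subsetIr.
move=> i Ti oi; have [z Xz ->] := fX i Ti oi.
rewrite subsetI subsetIl andbT cent1_conj ?(subsetP sXL) //.
by rewrite -(conjGid Xz) conjSg.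
Qed.

Lemma ns_involution_fused (X : {group gT}) a : T \subset X -> 
    (exists2 x, x \in X & t = a ^ x) -> (exists2 x, x \in X & s = a ^ x) ->
    (exists2 x, x \in X & s * r' = a ^ x) ->
  forall i, i \in T -> #[i] = 2 -> exists2 x, x \in X & i = a ^ x.
Proof.
move=> sTX fXt [x Xx sx] [x1 Xx1 s1x] i Ti oi.
have Xr k : k \in <[r']> -> k \in X.
  by apply: subsetP; rewrite cycle_subG (subsetP sTX) // (dihedral_mem_r dihT).
have [ri | ri] := boolP (i \in <[r']>).
  by rewrite (dihedral_involution_rot ri rt oi ot).
have [k rk [->|->]] := dihedral_reflection_conj dihT Ti ri.
  by exists (x * k); [rewrite (groupM Xx) ?Xr | rewrite conjgM -sx].
by exists (x1 * k); [rewrite (groupM Xx1) ?Xr | rewrite conjgM -s1x].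
Qed.

Hypothesis r_gt2 : 2 < #[r'].

Let coR (x y : gT) : 2.-elt x -> y \in R -> coprime #[x] #[y].
Proof.
move=> tx Ry; apply: (pnat_coprime tx); rewrite -odd_2'nat.
exact: dvdn_odd (order_dvdG Ry) (odd_core _).
Qed.

Let two_elt (x : gT) : #[x] = 2 -> 2.-elt x. Proof. by move=> o; rewrite /p_elt o. Qed.

(* X contains the core of 'C_M[s] and an element taking s to s * r, hence T; transfer then
   forces s and t to be fused in X. *)
Lemma ns_gen_full : r' = r -> D \subset M -> 'm(L) <= 2.
Proof.
move=> def_r sDM; have Tr : r' \in T := dihedral_mem_r dihT.
have s1T : s * r' \in T by rewrite groupM.
have [_ rs _ _ defT] := dihT.
have rs1 : s * r' \notin <[r']> by rewrite groupMr ?cycle_id.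
have [os1 _] := dihedral_reflection dihT s1T rs1.
have [g Mg def_s1] := simple_fused simM sylT dihT rt ot Ms (subsetP sTM _ s1T) os os1.
have [y defR] := cyclicP (ns_R_cyclic cL sylD dihD nsM simM CM dihT srr' rt ot nose).
have [z defZ] := cyclicP (core_cent_inv_cyclic cM simM sylT dihT rt ot r_gt2 Ms os).
have Ry : y \in R by rewrite /= defR cycle_id.
have Oz : z \in 'O_2^'('C_M[s]) by rewrite defZ cycle_id.
have /setIP[Mz csz] := subsetP (pcore_sub _ _) z Oz.
pose X := <<[set (s * z)%g; (y * g)%g]>>%G.
have Xsz : s * z \in X by rewrite mem_gen // set21.
have Xh : y * g \in X by rewrite mem_gen // set22.
have [Xs Xz] : s \in X /\ z \in X.
  apply: coprime_mul_mem Xsz; first by apply: commute_sym; apply/cent1P.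
  apply: (pnat_coprime (two_elt os)); rewrite -odd_2'nat.
  exact: dvdn_odd (order_dvdG Oz) (odd_core _).
have sh : s ^ (y * g) = s * r' by rewrite conjgM (R_fix Ry Ts) def_s1.
have Xr : r' \in X by rewrite -(groupMl _ Xs) -sh groupJ.
have sTX : T \subset X by rewrite -defT mul_subG ?cycle_subG.
have sXL : X \subset L.
  rewrite gen_subG subUset !sub1set !groupM //;
  by [apply: (subsetP sML) | apply: (subsetP sRL)].
have defD : T :=: D by apply/setIidPl.
have sylTX : 2.-Sylow(X) T by apply: pHall_subl sTX sXL _; rewrite defD.
have fXs1 : exists2 x, x \in X & s * r' = s ^ x by exists (y * g).
have fXs : exists2 x, x \in X & s = s ^ x by exists 1; rewrite ?conjg1.
have [fXt | nfX] := boolP [exists x in X, t == s ^ x]; last first.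
  have hX : 2^'.-Hall(X) 'O_2^'(X).
    apply: (dihedral_transfer sylTX dihT rt ot) => x d Xx Td rd; apply/negP=> /eqP dx.
    case/existsP: nfX; have Xk k : k \in <[r']> -> k \in X.
      by apply: subsetP; rewrite cycle_subG.
    have [k rk [def_d|def_d]] := dihedral_reflection_conj dihT Td rd.
      by exists (k * x); rewrite (groupM (Xk k rk) Xx) /= -dx def_d conjgM.
    exists (y * g * k * x); rewrite (groupM (groupM Xh (Xk k rk)) Xx) /=.
    by rewrite -dx def_d -sh !conjgM.
  (* Writing [y * g = o * d] with [o] in the odd core and [d] in [T], the element
     [(s * r')^-1 * s ^ d] lies in both, so [r' = s^-1 * s ^ d]; but this commutator lies in
     [<[r' ^+ 2]>]. *)
  have := Xh; rewrite -(odd_Hall_prod sylTX hX) => /mulsgP[o d Oo Td def_h].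
  case/negP: (dihedral_notin_sqr dihT).
  suff def : r' = s^-1 * s ^ d by rewrite {1}def; exact: (dihedral_commg dihT Td).
  have Xd := subsetP sTX d Td.
  have : (s * r')^-1 * s ^ d \in 'O_2^'(X) :&: T.
    rewrite in_setI; apply/andP; split; last by rewrite groupM ?groupV ?groupJ.
    rewrite -sh def_h conjgM -conjVg -conjMg memJ_norm; last first.
      exact: subsetP (gFnorm _ _) d Xd.
    rewrite -groupV invMg invgK -commgEl commgEr groupM // memJ_norm ?groupV //.
    exact: subsetP (gFnorm _ _) s Xs.
  rewrite coprime_TIg; last first.
    by rewrite coprime_sym (pnat_coprime tT) // -odd_2'nat odd_core.
  by move/set1P/eqP; rewrite -eq_mulVg1 => /eqP <-; rewrite mulKg.
have [x Xx /eqP tx] := exists_inP fXt.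
have fX := ns_involution_fused sTX (ex_intro2 _ _ x Xx tx) fXs fXs1.
have sMX : M \subset X.
  apply: (ns_fused_sub sXL sTX Ts os); first by rewrite defZ cycle_subG.
  by move=> i Ti oi; apply: fX.
have Xy : y \in X by rewrite -(groupMr y (subsetP sMX g Mg)).
apply/grank2P; exists (s * z), (y * g); split.
- exact: subsetP sXL _ Xsz.
- exact: subsetP sXL _ Xh.
apply/eqP; rewrite eqEsubset; apply/andP; split; first exact: sXL.
apply: (ns_gen cL sylD dihD nsM simM dihT srr' rt ot sMX); last by rewrite -def_r.
by rewrite /= defR cycle_subG.
Qed.

Lemma ex_order4 : exists2 c, c \in <[r']> & c * c = t.
Proof.
have d4 : 4 %| #[r'].
  have: 2.-nat #[r'] by apply: mem_p_elt tT (dihedral_mem_r dihT).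
  case/p_natP=> // n def_n; move: r_gt2; rewrite def_n.
  by case: n {def_n} => [|[|n]] // _; rewrite !expnS mulnA dvdn_mulr.
pose c := r' ^+ (#[r'] %/ 4); exists c; first exact: mem_cycle.
have rc : c * c \in <[r']> by rewrite groupM ?mem_cycle.
apply: dihedral_involution_rot rc rt _ ot.
have oc : #[c] = 4.
  by rewrite orderXdiv ?dvdn_div // divnA // mulKn.
by rewrite -[c * c]/(c ^+ 2) orderXdiv oc.
Qed.

(** [c] fixes [t] and takes [s] to [s * t]; a conjugate [c'] fixes [s] and takes [t] to [t * s].
    They act on the Klein group of [t] and [s] as two transpositions, and [c * c' * c] is the
    third. *)
Lemma ex_swap : exists g, [/\ g \in M, t ^ g = s & s ^ g = t].
Proof.
have [c rc cc] := ex_order4; have Tc : c \in T.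
  by apply: subsetP rc; rewrite cycle_subG (dihedral_mem_r dihT).
have Mc := subsetP sTM c Tc.
have tc : t ^ c = t by apply: commute_conjg; apply: (dihedral_center dihT rt ot Tc).
have [m Mm sm] := simple_fused simM sylT dihT rt ot Ms Mt os ot.
have cts : commute t s by apply: (dihedral_center dihT rt ot Ts).
have [_ rs _ _ _] := dihT.
have nts : t != s by apply: contra rs => /eqP <-.
have sTC : T \subset 'C_M[t] := Sylow_cent_inv sylT dihT rt ot.
have sylTC : 2.-Sylow('C_M[t]) T := pHall_subl sTC (subsetIl _ _) sylT.
(* [m] takes [s] to [t] but may move [t] out of [T]; a correction in ['C_M[t]] brings it back and
   keeps the image of [s]. *)
have [n Cn Ttmn] : exists2 n, n \in 'C_M[t] & t ^ (m * n) \in T.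
  have Ctm : t ^ m \in 'C_M[t].
    have cmt : commute (t ^ m) (s ^ m) by rewrite /commute -!conjMg cts.
    by rewrite in_setI groupJ //= mem_cent1E; apply/eqP/commute_conjg; rewrite -sm in cmt.
  have scC : <[t ^ m]> \subset 'C_M[t] by rewrite cycle_subG.
  have tm2 : 2.-group <[t ^ m]> by apply: two_elt; rewrite orderJ.
  have [n Cn sub] := Sylow_Jsub sylTC scC tm2.
  by exists n; rewrite // conjgM -cycle_subG cycleJ.
have [Mn ctn] := setIP Cn.
set m' := m * n in Ttmn; have Mm' : m' \in M by rewrite groupM.
have sm' : s ^ m' = t by rewrite conjgM -sm (eqP (etrans (esym (mem_cent1E _ _)) _)) // cent1C.
have rd : t ^ m' \notin <[r']>.
  apply/negP=> rd; case/eqP: nts; apply: (conjg_inj m'); rewrite sm'.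
  by apply: dihedral_involution_rot rd rt _ ot; rewrite orderJ.
have dihT' := dihedral_change dihT Ttmn rd.
pose c' := c ^ m'^-1.
have sc' : s ^ c' = s.
  by rewrite /c' -[s in s ^ _](conjgK m') sm' -conjJg tc -sm' conjgK.
have tc' : t ^ c' = t * s.
  rewrite /c' -{1}[t](conjgK m') -conjJg (dihedral_conj_rot dihT' rc) cc conjMg conjgK.
  by rewrite -{2}sm' conjgK.
have sc : s ^ c = s * t by rewrite (dihedral_conj_rot dihT rc) cc.
have tt : t * t = 1 := involution_mulK ot.
have ss : s * s = 1 := involution_mulK os.
have Mc' : c' \in M by rewrite groupJ ?groupV.
clearbody c'; exists (c * c' * c); split; first by rewrite !groupM.
  by rewrite 2!conjgM tc tc' conjMg tc sc mulgA cts -mulgA tt mulg1.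
by rewrite 2!conjgM sc (conjMg s t) sc' tc' cts mulgA ss mul1g tc.
Qed.

(* The second generator h takes s to t and t to s ^ r. *)
Lemma ns_gen_half : r' = r ^+ 2 -> 'm(L) <= 2.
Proof.
move=> def_r'; have [g [Mg tg sg]] := ex_swap.
have [y defR] := cyclicP (ns_R_cyclic cL sylD dihD nsM simM CM dihT srr' rt ot nose).
have [z defZ] := cyclicP (core_cent_inv_cyclic cM simM sylT dihT rt ot r_gt2 Mt ot).
have Ry : y \in R by rewrite /= defR cycle_id.
have Oz : z \in 'O_2^'('C_M[t]) by rewrite defZ cycle_id.
have /setIP[Mz ctz] := subsetP (pcore_sub _ _) z Oz.
have [_ _ _ _ defT] := dihT.
have Dr : r \in D := dihedral_mem_r dihD.
have Lr := subsetP sDL r Dr.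
pose h := g * r * y; pose X := <<[set (t * z)%g; h]>>%G.
have Xtz : t * z \in X by rewrite mem_gen // set21.
have Xh : h \in X by rewrite mem_gen // set22.
have [Xt Xz] : t \in X /\ z \in X.
  apply: coprime_mul_mem Xtz; first by apply: commute_sym; apply/cent1P.
  apply: (pnat_coprime (two_elt ot)); rewrite -odd_2'nat.
  exact: dvdn_odd (order_dvdG Oz) (odd_core _).
have sr : s ^ r = s * r' by rewrite (dihedral_conj_rot dihD) ?cycle_id // def_r' expgS expg1.
have tr : t ^ r = t.
  by apply: commute_conjg; apply: (dihedral_center dihD (subsetP srr' t rt) ot Dr).
have Tr : r' \in T := dihedral_mem_r dihT.
have th : t ^ h = s * r' by rewrite !conjgM tg sr R_fix // groupM.
have sh : s ^ h = t by rewrite !conjgM sg tr R_fix.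
have sh' : s = t ^ h^-1 by rewrite -sh conjgK.
have Xs : s \in X by rewrite sh' groupJ ?groupV.
have Xr' : r' \in X by rewrite -(groupMl _ Xs) -th groupJ.
have sTX : T \subset X by rewrite -defT mul_subG ?cycle_subG.
have sXL : X \subset L.
  rewrite gen_subG subUset !sub1set !groupM //;
  by [apply: (subsetP sML) | apply: (subsetP sRL)].
have sMX : M \subset X.
  apply: (ns_fused_sub sXL sTX Tt ot); first by rewrite defZ cycle_subG.
  apply: (ns_involution_fused sTX).
  - by exists 1; rewrite ?conjg1.
  - by exists h^-1; rewrite ?groupV.
  by exists h.
have Xry : r * y \in X by rewrite -(groupMl _ (subsetP sMX g Mg)) mulgA.
have [Xr Xy] : r \in X /\ y \in X.
  apply: coprime_mul_mem Xry.
    have := ns_R_D cL sylD dihD nsM simM CM dihT srr' rt ot nose.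
    by move/subsetP/(_ y Ry)/centP/(_ r Dr)/commute_sym.
  by apply: coR Ry; apply: mem_p_elt Dr; apply: pHall_pgroup sylD.
apply/grank2P; exists (t * z), h; split.
- exact: subsetP sXL _ Xtz.
- exact: subsetP sXL _ Xh.
apply/eqP; rewrite eqEsubset; apply/andP; split; first exact: sXL.
apply: (ns_gen cL sylD dihD nsM simM dihT srr' rt ot sMX) => //.
by rewrite /= defR cycle_subG.
Qed.

End NormalSimpleGen.

(** If [n] is the order of [[~ z, y]], then [z ^+ n] commutes with [y], so [z ^+ n = 1]. *)
Lemma commg_cycle_mem (gT : finGroupType) (z y : gT) :
    y \in 'N(<[z]>) -> 'C_(<[z]>)[y] = 1 -> z \in <[[~ z, y]]>.
Proof.
move=> Ny C1; have cZ := cycle_abelian z.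
have Zzy : z ^ y \in <[z]> by rewrite memJ_norm ?cycle_id.
have Zu : [~ z, y] \in <[z]> by rewrite commgEl groupM ?groupV ?cycle_id.
suff /eqP-> : <[[~ z, y]]> == <[z]> by apply: cycle_id.
rewrite eqEcard cycle_subG Zu -!orderE dvdn_leq ?order_gt0 // order_dvdn.
have : z ^+ #[[~ z, y]] \in 'C_(<[z]>)[y].
  rewrite in_setI mem_cycle mem_cent1E conjXg; apply/eqP.
  rewrite -[z ^ y](mulKVg z) -commgEl expgMn ?expg_order ?mulg1 //.
  by apply: (centsP cZ) => //; apply: cycle_id.
by rewrite C1 => /set1P->.
Qed.

Section NormalFourGen.

Variables (gT : finGroupType) (L D M : {group gT}) (r s t : gT).
Hypotheses (cL : odd_cyclic L) (sylD : 2.-Sylow(L) D) (dihD : dihedral_gens D r s).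
Hypotheses (nsM : M <| L) (simM : simple M) (CM : 'C_L(M) = 1).
Let T := (D :&: M)%G.
Hypotheses (dihT : dihedral_gens T t s) (rtr : t \in <[r]>) (ot : #[t] = 2).
Hypothesis rr : r * r = 1 \/ r * r = t.
Hypothesis nose : forall K : {group gT}, K \subset M ->
  (forall i, i \in T -> #[i] = 2 -> 'C_M[i] \subset K) -> K :=: M.

Let srr' : <[t]> \subset <[r]>. Proof. by rewrite cycle_subG. Qed.
Let rt : t \in <[t]>. Proof. exact: cycle_id. Qed.
Let sDL : D \subset L. Proof. exact: pHall_sub sylD. Qed.
Let tD : 2.-group D. Proof. exact: pHall_pgroup sylD. Qed.
Let sML : M \subset L. Proof. exact: normal_sub nsM. Qed.
Let sylT : 2.-Sylow(M) T.
Proof. by have := Sylow_setI_normal nsM sylD; rewrite setIC. Qed.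
Let Tt : t \in T. Proof. exact: dihedral_mem_r dihT. Qed.
Let Ts : s \in T. Proof. exact: dihedral_mem_s dihT. Qed.
Let Dr : r \in D. Proof. exact: dihedral_mem_r dihD. Qed.
Let Ds : s \in D. Proof. exact: dihedral_mem_s dihD. Qed.
Let os : #[s] = 2. Proof. by case: dihT. Qed.

Local Notation R := 'O_2^'('C_L(T))%G.
Local Notation O := 'O_2^'('C_L[t])%G.
(** [t] centralizes [O], so [T] acts on it through [s] alone. *)
Local Notation Z := [~: 'O_2^'('C_L[t]), <[s]>]%G.

Let O_fix x : x \in O -> t ^ x = t.
Proof.
move=> Ox; have /setIP[_ ctx] := subsetP (pcore_sub _ _) x Ox.
by apply/eqP; rewrite -mem_cent1E cent1C.
Qed.

Let O_fix' x : x \in O -> x ^ t = x.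
Proof. by move=> Ox; apply/commute_conjg/commute_sym/commgP/conjg_fixP/O_fix. Qed.

Let nOD x : x \in D -> x \in 'N(O).
Proof.
move=> Dx; apply: (subsetP (gFnorm _ _)).
exact: (subsetP (Sylow_cent_inv sylD dihD rtr ot) x Dx).
Qed.

Let facts := odd_cyclic_involution_act (ns_core_odd L t) (ns_core_odd_cyclic cL (t := t))
  (nOD Ds) os.

Let Z_cyclic : cyclic Z. Proof. by case: facts. Qed.
Let Z_normal : Z <| O. Proof. by case: facts. Qed.
Let Z_mem x : x \in O -> (x \in Z) = (x ^ s == x^-1). Proof. by case: facts => _ _ _ _; apply. Qed.
Let sZO : Z \subset O. Proof. exact: normal_sub Z_normal. Qed.

Let R_def : 'C_O[s] = R.
Proof.
rewrite -(ns_R_def sylD dihD nsM dihT srr' rt ot).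
apply/setP=> x; rewrite !in_setI; apply: andb_id2l => Ox.
rewrite -[x \in 'C(_)]sub_cent1 cent1C; apply/idP/idP=> [cs | /subsetP]; last exact.
have [_ _ _ _ <-] := dihT; rewrite mul_subG ?cycle_subG //.
by rewrite mem_cent1E O_fix.
Qed.

Let sRO : R \subset O. Proof. by rewrite -R_def subsetIl. Qed.
Let O_prod : Z * R = O. Proof. by case: facts; rewrite R_def. Qed.
Let coZR : coprime #|Z| #|R|. Proof. by case: facts; rewrite R_def. Qed.
Let nRZ : R \subset 'N(Z). Proof. exact: subset_trans sRO (normal_norm Z_normal). Qed.

Let sr : s ^ r = s * (r * r). Proof. by apply: (dihedral_conj_rot dihD); apply: cycle_id. Qed.

Let O_rr x : x \in O -> x ^ (r * r) = x.
Proof. by case: rr => -> Ox; rewrite ?conjg1 ?O_fix'. Qed.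

Let nZr : r \in 'N(Z).
Proof.
apply/normP/eqP; rewrite eqEcard cardJg leqnn andbT; apply/subsetP=> _ /imsetP[x Zx ->].
have Ox := subsetP sZO x Zx; have := Zx; rewrite !Z_mem ?memJ_norm ?nOD // => /eqP xs.
have [_ _ rs _ _] := dihD; apply/eqP.
by rewrite -conjgM conjgC rs conjgM xs conjVg -{1}(O_rr Ox) conjgM conjgK.
Qed.

(* Z = [O, s] is inverted by s, and decomposes as <[zb]> * <[z1]> * <[z2]>, where r inverts zb
   and centralises z1 and z2, and z2 but no nontrivial power of z1 commutes with R = <[y]>.
   The twists by zb and z1 make the involutions t ^ (rho ^ zb) and s recover zb and z1. *)
Lemma ns_gen_four : 'm(L) <= 2.
Proof.
have [y defR] := cyclicP (ns_R_cyclic cL sylD dihD nsM simM CM dihT srr' rt ot nose).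
have Ry : y \in R by rewrite /= defR cycle_id.
have cRD x d : x \in R -> d \in D -> commute x d.
  move=> Rx Dd; have := ns_R_D cL sylD dihD nsM simM CM dihT srr' rt ot nose.
  by move/subsetP/(_ x Rx)/centP/(_ d Dd).
have oO x : x \in O -> odd #[x].
  by move=> Ox; apply: dvdn_odd (order_dvdG Ox) (ns_core_odd L t).
have abZ : abelian Z := cyclic_abelian Z_cyclic.
have coZr : coprime #|Z| #|<[r]>|.
  rewrite coprime_sym (pnat_coprime (mem_p_elt tD Dr)) // -odd_2'nat.
  exact: oddSg sZO (ns_core_odd L t).
have nZrc : <[r]> \subset 'N(Z) by rewrite cycle_subG.
pose Zb := [~: Z, <[r]>]%G; pose Za := 'C_Z(<[r]>)%G.
have defZ : Zb * Za = Z := coprime_comm_cent_prod nZrc coZr (abelian_sol abZ).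
have sZbZ : Zb \subset Z by rewrite commg_subl.
have sZaZ : Za \subset Z by rewrite subsetIl.
have ZbP x : x \in Zb -> x ^ r = x^-1.
  move=> Zbx; have Zx := subsetP sZbZ x Zbx; have Ox := subsetP sZO x Zx.
  have Zbxr : x ^ r \in Zb by rewrite memJ_norm // (subsetP (commg_normr _ _)) ?cycle_id.
  apply/eqP; rewrite eq_sym eq_invg_mul.
  suff: x * x ^ r \in 'C_Zb(<[r]>) by rewrite coprime_abel_cent_TI // => /set1P->.
  rewrite in_setI groupM //= cent_cycle mem_cent1E.
  by rewrite conjMg -conjgM O_rr // (centsP abZ) // (subsetP sZbZ).
have ZaP x : x \in Za -> commute x r.
  by case/setIP=> _; rewrite /= cent_cycle => /cent1P/commute_sym.
have nZaR : R \subset 'N(Za).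
  rewrite normsI // norms_cent // cents_norm // centsC cycle_subG.
  by apply/centP=> x Rx; apply/commute_sym/cRD.
have coZaR : coprime #|Za| #|R| := coprimeSg sZaZ coZR.
have abZa : abelian Za := abelianS sZaZ abZ.
have defZa := coprime_comm_cent_prod nZaR coZaR (abelian_sol abZa).
have sZ1Za : [~: Za, R] \subset Za by rewrite commg_subl.
have [z1 defz1] := cyclicP (cyclicS (subset_trans sZ1Za sZaZ) Z_cyclic).
have sZ2Za : 'C_Za(R) \subset Za by rewrite subsetIl.
have [z2 defz2] := cyclicP (cyclicS (subset_trans sZ2Za sZaZ) Z_cyclic).
have [zb defzb] := cyclicP (cyclicS sZbZ Z_cyclic).
have Zazz1 : z1 \in Za by rewrite (subsetP sZ1Za) // defz1 cycle_id.
have C2z2 : z2 \in 'C_Za(R) by rewrite defz2 cycle_id.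
have [Zaz2 cRz2] := setIP C2z2.
have Zbz : zb \in Zb by rewrite /= defzb cycle_id.
have [Zz1 Zz2] : z1 \in Z /\ z2 \in Z by rewrite !(subsetP sZaZ).
have Zzb : zb \in Z := subsetP sZbZ zb Zbz.
have Oz1 := subsetP sZO z1 Zz1; have Oz2 := subsetP sZO z2 Zz2.
have Ozb := subsetP sZO zb Zzb; have Oy := subsetP sRO y Ry.
have nz1R : R \subset 'N(<[z1]>) by rewrite -defz1 commg_normr.
(* [z1] commutes with [r] and [z2], so twisting [y] by it leaves [r], [z2] and [Y] commuting in
   pairs, with coprime orders. *)
pose Y := y ^ z1; pose e := z2 * Y.
have OY : Y \in O by rewrite groupJ.
have c2Y : commute z2 Y.
  have c21 : z2 ^ z1^-1 = z2.
    by apply/commute_conjg/(centsP abZ) => //; rewrite groupV.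
  rewrite /Y -[z2](conjgKV z1) c21 /commute -!conjMg; congr (_ ^ _).
  by apply: (centP cRz2).
have c2o : coprime #[z2] #[Y].
  rewrite orderJ; apply: coprime_dvdl (order_dvdG Zz2) _.
  exact: coprime_dvdr (order_dvdG Ry) coZR.
have cre : commute r e.
  apply/commute_sym; have czr := ZaP z1 Zazz1.
  have cYr : commute Y r.
    rewrite /Y -[r in commute _ r](commute_conjg (commute_sym czr)).
    by rewrite /commute -!conjMg cRD.
  by apply/commute_sym; apply: commuteM; apply/commute_sym => //; apply: ZaP.
have core : coprime #[r] #[e].
  by apply: (pnat_coprime (mem_p_elt tD Dr)); rewrite -odd_2'nat; apply: oO (groupM Oz2 OY).
have [rho [/setIP[Mrho Nrho] orho nrho trho]] := four_fused_norm simM sylT dihT ot.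
pose X := <<[set (r * e)%g; (rho ^ zb)%g]>>%G.
have Xre : r * e \in X by rewrite mem_gen // set21.
have Xf : rho ^ zb \in X by rewrite mem_gen // set22.
have [Xr Xe] := coprime_mul_mem cre core Xre.
have [Xz2 XY] := coprime_mul_mem c2Y c2o Xe.
have Xt : t \in X by apply: subsetP rtr; rewrite cycle_subG.
have zbs : zb ^ s = zb^-1 by apply/eqP; rewrite -Z_mem.
have szb : s ^ zb = s * (zb * zb).
  by apply: (mulgI s^-1); rewrite mulKg conjgE !mulgA; congr (_ * zb); rewrite -mulgA -conjgE conjVg zbs invgK.
have tf : t ^ (rho ^ zb) = s ^ zb by rewrite -{1}(O_fix Ozb) -conjJg trho.
have Xszb : s ^ zb \in X by rewrite -tf groupJ.
have Xzb : zb \in X.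
  (* With [s ^ zb = s * w] and [r] inverting [w], the element [(s ^ zb)^-1 * (s ^ zb) ^ r] is
     [q * (w * w)^-1]. So [X] contains [zb ^+ 4], and [zb] has odd order. *)
  pose q := r * r; pose w := zb * zb.
  have Xq : q \in X by rewrite groupM.
  have qw : commute q w^-1.
    apply/commuteV/commute_sym/commgP/conjg_fixP.
    by rewrite conjMg !O_rr.
  have wr : w ^ r = w^-1 by rewrite conjMg ZbP // invMg.
  have szbw : s ^ zb = s * w := szb.
  have ozb : odd #[zb] := oO zb Ozb.
  apply: (odd_sqr_mem ozb); apply: odd_sqr_mem.
    exact: dvdn_odd (orderXdvd _ _) ozb.
  rewrite -[zb ^+ 2]/w; have srq : s ^ r = s * q := sr.
  clearbody w q; have Xww : (s ^ zb)^-1 * (s ^ zb) ^ r \in X.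
    by apply: groupM; [rewrite groupV | rewrite groupJ].
  rewrite szbw conjMg srq wr invMg -!mulgA mulKg mulgA -qw -mulgA groupMl // -invMg groupV in Xww.
  exact: Xww.
have Xs : s \in X by rewrite -(groupMr s (groupM Xzb Xzb)) -szb.
have Xrho : rho \in X by rewrite -(conjgK zb rho) groupJ ?groupV.
have defT : <[t]> * <[s]> = T by case: dihT.
have sTX : T \subset X by rewrite -defT mul_subG ?cycle_subG.
have defD : <[r]> * <[s]> = D by case: dihD.
have sDX : D \subset X by rewrite -defD mul_subG ?cycle_subG.
have Nz1y : y \in 'N(<[z1]>) := subsetP nz1R y Ry.
have Xz1 : z1 \in X.
  have Xu : [~ z1, y] \in X.
    apply: odd_sqr_mem.
      by rewrite oO // groupR.
    (* [s] fixes [y] and inverts [z1], so [Y ^ s] is the conjugate of [y] by [z1^-1]. *)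
    have -> : [~ z1, y] ^+ 2 = Y^-1 * Y ^ s.
      have z1s : z1 ^ s = z1^-1 by apply/eqP; rewrite -Z_mem.
      have ys : y ^ s = y by apply/commute_conjg/cRD.
      have Zz1' : z1 ^ y \in Z by rewrite memJ_norm // (subsetP nRZ).
      have -> : Y^-1 * Y ^ s = z1^-1 * (z1 * z1) ^ y * z1^-1.
        by rewrite /Y conjJg z1s ys -conjVg !conjgE invgK !mulgA.
      rewrite conjMg commgEl; move: (z1 ^ y) Zz1' => b Zb'.
      rewrite expgS expg1 -!mulgA; congr (_ * (_ * _)).
      by apply: (centsP abZ); rewrite // groupV.
    by apply: groupM; [rewrite groupV | rewrite groupJ].
  have: z1 \in <[[~ z1, y]]>.
    apply: (commg_cycle_mem Nz1y).
    by rewrite -defz1 -cent_cycle -defR coprime_abel_cent_TI.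
  by apply: subsetP; rewrite cycle_subG.
have Xy : y \in X by rewrite -(conjgK z1 y) groupJ ?groupV.
have sRX : R \subset X by rewrite /= defR cycle_subG.
have sZX : Z \subset X.
  rewrite -defZ -[Za : {set gT}]defZa defz1 defz2 /= -/Zb.
  by rewrite !mul_subG ?cycle_subG //= defzb cycle_subG.
have sOX : O \subset X by rewrite -O_prod mul_subG.
have sCX : 'C_L[t] \subset X.
  by rewrite -(ns_cent_prod sylD dihD srr' rt ot) mul_subG.
have sXL : X \subset L.
  have sOL := ns_core_sub L t.
  rewrite gen_subG subUset !sub1set groupM ?(subsetP sDL r Dr) //=; last first.
    by apply: (subsetP sOL); rewrite groupM.
  by rewrite groupJ ?(subsetP sML rho) ?(subsetP sOL).
have sMX : M \subset X.
  apply: (ns_fused_sub sylD nsM simM dihT rt ot nose sXL sTX Tt ot).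
    apply: subset_trans (pcore_sub _ _) (subset_trans _ sCX).
    exact: setSI.
  apply: (ns_involution_fused dihT rt ot sTX).
  - by exists 1; rewrite ?conjg1.
  - by exists rho.
  exists (rho ^+ 2); first exact: groupX.
  have nt1 : t != 1 by rewrite -order_eq1 ot.
  rewrite (four_cycle dihT ot Nrho orho nrho Tt nt1) trho.
  have := dihedral_center dihT rt ot Ts; exact: commute_sym.
apply/grank2P; exists (r * e), (rho ^ zb); split.
- exact: subsetP sXL _ Xre.
- exact: subsetP sXL _ Xf.
apply/eqP; rewrite eqEsubset; apply/andP; split; first exact: sXL.
exact: (ns_gen cL sylD dihD nsM simM dihT srr' rt ot sMX).
Qed.

End NormalFourGen.

(** * Generators in the strongly embedded case *)

Section FourEmbedded.

Variables (gT : finGroupType) (M V : {group gT}) (t s : gT).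
Hypotheses (cM : odd_cyclic M) (simM : simple M).
Hypotheses (sylV : 2.-Sylow(M) V) (dihV : dihedral_gens V t s) (ot : #[t] = 2).

Let sVM : V \subset M. Proof. exact: pHall_sub sylV. Qed.
Let tV : 2.-group V. Proof. exact: pHall_pgroup sylV. Qed.
Let Vt : t \in V. Proof. exact: dihedral_mem_r dihV. Qed.
Let Vs : s \in V. Proof. exact: dihedral_mem_s dihV. Qed.
Let os : #[s] = 2. Proof. by case: dihV. Qed.
Let rt : t \in <[t]>. Proof. exact: cycle_id. Qed.
Let Mt : t \in M. Proof. exact: subsetP sVM t Vt. Qed.
Let nt1 : t != 1. Proof. by rewrite -order_eq1 ot. Qed.
Let ns1 : s != 1. Proof. by rewrite -order_eq1 os. Qed.
Let abV : abelian V := four_abelian dihV ot.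

(** [K0] need not contain an element moving [V]. The subgroup [H] generated by the centralizers is
    normalized by such an [x], and [H <*> <[x]>] is proper, since otherwise [H] would be normal in
    the simple [M]. *)
Lemma four_embedding (K0 : {group gT}) : K0 \subset M -> K0 :!=: M ->
    (forall i, i \in V -> #[i] = 2 -> 'C_M[i] \subset K0) ->
  exists K : {group gT}, exists x, [/\ [/\ K \subset M, K :!=: M
    & forall i, i \in V -> #[i] = 2 -> 'C_M[i] \subset K],
    x \in K, x \in 'N(V), odd #[x] & x \notin 'C(V)].
Proof.
move=> sK0 nK0 centK0; have [x [/setIP[Mx Nx] ox ncx _]] := four_fused_norm simM sylV dihV ot.
pose B := \bigcup_(i in V^#) 'C_M[i]; pose H := <<B>>%G.
have sCH i : i \in V -> #[i] = 2 -> 'C_M[i] \subset H.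
  move=> Vi oi; apply: subset_trans (subset_gen _); apply: (bigcup_max i) => //.
  by rewrite !inE -order_eq1 oi Vi.
have sHK0 : H \subset K0.
  rewrite gen_subG; apply/bigcupsP=> i /setD1P[ni Vi]; apply: centK0 => //.
  exact: (four_order dihV ot Vi ni).
have nHx : x \in 'N(H).
  apply/normP/eqP; rewrite eqEcard cardJg leqnn andbT /= -genJ genS // -bigcupJ.
  apply/bigcupsP=> i /setD1P[ni Vi]; apply: (bigcup_max (i ^ x)).
    by rewrite !inE conjg_eq1 ni memJ_norm.
  by rewrite conjIg cent1J setSI // conjGid.
have nHK : H <*> <[x]> \subset 'N(H) by rewrite join_subG normG cycle_subG.
exists (H <*> <[x]>)%G, x; split=> //; last by rewrite (subsetP (joing_subr _ _)) ?cycle_id.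
split; last by move=> i Vi oi; apply: subset_trans (sCH i Vi oi) (joing_subl _ _).
  by rewrite join_subG cycle_subG Mx (subset_trans sHK0).
apply: contra nK0 => /eqP defM; have nsHM : H <| M.
  by rewrite /normal (subset_trans sHK0) // -defM.
have [_ simM'] := simpleP _ simM; have [H1 | HM] := simM' H nsHM.
  case/negP: nt1; rewrite -in_set1 -[[set 1]]H1 (subsetP (sCH t Vt ot)) //.
  by rewrite in_setI Mt; apply/cent1P.
by rewrite eqEsubset sK0 -HM.
Qed.

Variables (K : {group gT}) (x0 u : gT).
Hypotheses (sKM : K \subset M) (nKM : K :!=: M).
Hypothesis centKV : forall i, i \in V -> #[i] = 2 -> 'C_M[i] \subset K.
Hypotheses (defK : K :=: 'N_M(V)) (defC : forall i, i \in V -> i != 1 -> 'C_M[i] = 'C_M(V)).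
Hypotheses (Kx0 : x0 \in K) (ox0 : #[x0] = 3) (cx0 : 'C_M[x0] = <[x0]>).
Hypotheses (Mu : u \in M) (ou : #[u] = 2) (x0u : x0 ^ u = x0^-1).

Local Notation W := 'O_2^'('C_M(V))%G.

Let Nx0 : x0 \in 'N(V). Proof. by move: Kx0; rewrite defK => /setIP[]. Qed.
Let oddx0 : odd #[x0]. Proof. by rewrite ox0. Qed.
Lemma four_emb_mem i : i \in V -> #[i] = 2 -> i \notin 'C[x0].
Proof.
move=> Vi oi; apply/negP=> ci; have : i \in <[x0]>.
  by rewrite -cx0 in_setI (subsetP sVM).
by move/order_dvdG; rewrite -orderE oi ox0.
Qed.

Lemma four_emb_notin : x0 \notin 'C(V).
Proof.
by apply/negP=> /centP/(_ t Vt) c; case/negP: (four_emb_mem Vt ot); apply/cent1P.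
Qed.

(** A proper [Y] satisfies the hypotheses of [four_strongly_embedded] too, so it would be
    ['N_M(V) = K]. *)
Lemma four_emb_max (Y : {group gT}) : K \subset Y -> Y \subset M -> ~~ (Y \subset K) -> Y :=: M.
Proof.
move=> sKY sYM nYK; have [// | nYM] := eqVneq (Y : {set gT}) M.
have centY i : i \in V -> #[i] = 2 -> 'C_M[i] \subset Y.
  by move=> Vi oi; apply: subset_trans (centKV Vi oi) sKY.
have [defY _ _] := four_strongly_embedded cM simM sylV dihV ot sYM nYM centY
  (subsetP sKY x0 Kx0) Nx0 oddx0 four_emb_notin.
by case/negP: nYK; rewrite defY defK.
Qed.

Let hallW : 2^'.-Hall('C_M(V)) W := cent_self_Hall sylV.

Lemma four_emb_cent_prod : W * V = 'C_M(V).
Proof.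
apply: odd_Hall_prod hallW; apply: pHall_subl sylV; last exact: subsetIl.
by rewrite subsetI sVM.
Qed.

Lemma four_emb_core3 : ~~ (3 %| #|W|).
Proof. exact: (four_odd_prime cM simM sylV dihV ot (erefl 3)). Qed.

Lemma four_emb_cent3 : ~~ (3 %| #|'C_M(V)|).
Proof.
rewrite -four_emb_cent_prod TI_cardMg; last first.
  by apply: coprime_TIg; rewrite coprime_sym (pnat_coprime tV) // -odd_2'nat odd_core.
rewrite Euclid_dvdM // negb_or four_emb_core3 (card_dihedral_gens dihV) ot.
by [].
Qed.

Let nWK : K \subset 'N(W).
Proof.
apply: gFnorm_trans; rewrite normsI ?norms_cent // defK ?subsetIr //.
exact: subset_trans (subsetIl _ _) (normG M).
Qed.

Lemma four_emb_cent_x0 : 'C_W[x0] = 1.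
Proof.
apply/trivgP/subsetP=> w /setIP[Ww cw].
have /setIP[Mw _] := subsetP (pcore_sub _ _) w Ww.
have wx : w \in <[x0]> by rewrite -cx0 in_setI Mw.
apply/set1P; apply/eqP; apply: contraT => nw; case/negP: four_emb_core3.
suff <- : #[w] = 3 by apply: order_dvdG.
have := order_dvdG wx; rewrite -orderE ox0 dvdn_divisors // /= !inE.
by rewrite order_eq1 (negPf nw) => /eqP.
Qed.

Lemma four_emb_core_comm : [~: W, <[x0]>] = W.
Proof.
have nWx : <[x0]> \subset 'N(W) by rewrite cycle_subG (subsetP nWK).
have cW : odd_cyclic W.
  by apply: odd_cyclicS cM; apply: subset_trans (pcore_sub _ _) (subsetIl _ _).
have co : coprime #|W| #|<[x0]>|.
  by rewrite -orderE ox0 coprime_sym prime_coprime // four_emb_core3.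
have := coprime_comm_cent_prod nWx co (odd_cyclic_sol (odd_core _) cW).
by rewrite cent_cycle four_emb_cent_x0 mulg1.
Qed.

Lemma four_emb_core_cyclic : cyclic W.
Proof.
have nWx : <[x0]> \subset 'N(W) by rewrite cycle_subG (subsetP nWK).
have cW : odd_cyclic W.
  by apply: odd_cyclicS cM; apply: subset_trans (pcore_sub _ _) (subsetIl _ _).
rewrite /= -four_emb_core_comm.
exact: cyclicS (comm_odd_cyclic_Fitting (odd_core _) cW nWx) (cyclic_Fitting (odd_core _) cW).
Qed.

Let sylVN : 2.-Sylow('N_M(V)) V.
Proof. by apply: pHall_subl sylV; rewrite ?subsetIl // subsetI sVM normG. Qed.

Let nsVN : V <| 'N_M(V). Proof. exact: normalSG. Qed.

Lemma four_emb_notinK : u \notin K.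
Proof.
rewrite defK; apply/negP=> Nu.
have Vu : u \in V by rewrite (mem_normal_Hall sylVN nsVN Nu) /p_elt ou.
case/negP: (four_emb_mem Vu ou); rewrite mem_cent1E.
have x0Vx : [~ u, x0] \in V :&: <[x0]>.
  rewrite in_setI {1}commgEl groupM ?groupV // ?memJ_norm //.
  by rewrite commgEr groupM ?cycle_id // conjVg x0u invgK cycle_id.
apply/eqP/conjg_fixP; move: x0Vx; rewrite coprime_TIg; first by move/set1P/eqP.
by rewrite (pnat_coprime tV) // -orderE ox0.
Qed.

Lemma four_emb_join : K <*> <[u]> = M.
Proof.
apply: (four_emb_max (Y := K <*> <[u]>)); first exact: joing_subl.
  by rewrite join_subG sKM cycle_subG.
apply: contra four_emb_notinK => /subsetP; apply.
by rewrite (subsetP (joing_subr _ _)) ?cycle_id.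
Qed.

(** Otherwise [<[y]>] meets the inverted part of [E] trivially, and 3 divides [#|'C_E[v]|], hence
    [#|'C_M(V)|]. *)
Lemma four_emb_inverts (E : {group gT}) v y :
    odd #|E| -> E \subset M -> v \in V -> v != 1 -> v \in 'N(E) -> y \in E -> #[y] = 3 ->
  y ^ v = y^-1.
Proof.
move=> oE sEM Vv nv nEv Ey oy; have ov := four_order dihV ot Vv nv.
have [_ nsZ defE coZ memZ] := odd_cyclic_involution_act oE (odd_cyclicS sEM cM) nEv ov.
apply/eqP; rewrite -memZ // -cycle_subG; apply: contraT => nyZ.
have tiZ : [~: E, <[v]>] :&: <[y]> = 1.
  by rewrite setIC prime_TIg // -orderE oy.
case/negP: four_emb_cent3; have sCM : 'C_E[v] \subset 'C_M(V) by rewrite -(defC Vv nv) setSI.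
apply: dvdn_trans (cardSg sCM).
have nZy : <[y]> \subset 'N([~: E, <[v]>]) by rewrite cycle_subG (subsetP (normal_norm nsZ)).
have sZyE : [~: E, <[v]>] <*> <[y]> \subset E.
  by rewrite join_subG commg_subl !cycle_subG nEv.
have := cardSg sZyE; rewrite /= norm_joinEr // TI_cardMg // -orderE oy.
by rewrite -{2}defE coprime_cardMg // dvdn_pmul2l ?cardG_gt0.
Qed.

Lemma four_emb_mod n k : n \in 'N_M(V) -> n \notin 'C(V) -> k \in 'N_M(V) ->
  exists2 z, z \in <[n]> & k * z \in 'C_M(V).
Proof.
move=> Nn ncn Nk; have [[Mn NVn] [Mk NVk]] := (setIP Nn, setIP Nk).
have C2 z : z \in 'N_M(V) -> z.`_2 \in 'C(V).
  move=> Nz; apply: (subsetP abV).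
  by rewrite (mem_normal_Hall sylVN nsVN (groupX _ Nz)) p_elt_constt.
have o2 (z : gT) : odd #[z.`_2^'] by rewrite odd_2'nat; apply: p_elt_constt.
have nc2 : n.`_2^' \notin 'C(V).
  by apply: contra ncn => cy; rewrite -(consttC 2 n) groupM // C2.
have [z nz cz] := four_mod dihV ot (groupX _ NVn) (o2 n) nc2 (groupX _ NVk) (o2 k).
have {}nz : z \in <[n]> by apply: subsetP nz; rewrite cycle_subG mem_cycle.
exists z; rewrite // in_setI groupM //; last by apply: subsetP nz; rewrite cycle_subG.
by rewrite -(consttC 2 k) -mulgA groupM // C2.
Qed.

Lemma four_emb_gen_norm (Y : {group gT}) n :
  'C_M(V) \subset Y -> n \in Y -> n \in 'N_M(V) -> n \notin 'C(V) -> K \subset Y.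
Proof.
move=> sCY Yn Nn ncn; rewrite defK; apply/subsetP=> k Nk.
have [z nz cz] := four_emb_mod Nn ncn Nk.
have Yz : z \in Y by apply: subsetP nz; rewrite cycle_subG.
by rewrite -(groupMr _ Yz) (subsetP sCY).
Qed.

(** By [four_emb_inverts] [y] is outside the odd core of [Y], so [Y] has no normal 2-complement. Its
    Sylow 2-subgroup is then [V], on which ['N_Y(V)] acts nontrivially; hence [Y] contains [K],
    which is maximal. *)
Lemma four_emb_gen (Y : {group gT}) v y : Y \subset M -> v \in V -> v != 1 -> v \in Y ->
    W \subset Y -> y \in Y -> #[y] = 3 -> y ^ v != y^-1 -> y \notin K ->
  Y :=: M.
Proof.
move=> sYM Vv nv Yv sWY Yy oy yv nKy; have ov := four_order dihV ot Vv nv.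
have not_core : y \notin 'O_2^'(Y).
  apply: contra yv => Oy; apply/eqP; apply: four_emb_inverts Vv nv _ Oy oy.
  - exact: odd_core.
  - exact: subset_trans (pcore_sub _ _) sYM.
  exact: subsetP (gFnorm _ _) v Yv.
have oddy : odd #[y] by rewrite oy.
have tv : 2.-group <[v]> by rewrite /pgroup -orderE ov.
have svY : <[v]> \subset Y by rewrite cycle_subG.
have [S sylS svS] := Sylow_superset svY tv.
have [sSY tS _] := and3P sylS.
have [m Mm sSV] := Sylow_subJ sylV (subset_trans sSY sYM) tS.
have ncS : ~~ cyclic S.
  apply/negP=> cS; case/negP: not_core; apply: odd_mem_core Yy oddy.
  by apply: normal_complement_pdiv sylS cS _ => q /prime_gt1.
have cardV : #|V| = 4 by rewrite (card_dihedral_gens dihV) ot.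
have defS : S :=: V :^ m.
  apply/eqP; rewrite eqEcard sSV cardJg cardV leqNgt; apply: contra ncS => S4.
  have := cardSg sSV; rewrite cardJg cardV dvdn_divisors // !inE.
  case/or3P=> /eqP oS; last by rewrite oS in S4.
    by move/eqP: oS; rewrite -trivg_card1 => /eqP->; apply: cyclic1.
  by apply: prime_cyclic; rewrite oS.
have defV : S :=: V.
  have abS : abelian S by rewrite defS abelianJ.
  have sSC : S \subset 'C_M(V).
    rewrite -(defC Vv nv) subsetI (subset_trans sSY) //= -cent_cycle.
    by apply: subset_trans abS _; rewrite centS.
  apply/eqP; rewrite eqEcard defS !cardJg leqnn andbT -defS.
  rewrite (sub_normal_Hall sylVN nsVN) // subsetI (subset_trans sSY sYM).
  by apply: subset_trans (subset_trans sSC (subsetIr _ _)) (cent_sub _).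
have sVY : V \subset Y by rewrite -defV.
have sylVY : 2.-Sylow(Y) V by rewrite -defV.
have sCY : 'C_M(V) \subset Y by rewrite -four_emb_cent_prod mul_subG.
have [sNC | /subsetPn[n Nn ncn]] := boolP ('N_Y(V) \subset 'C(V)).
  case/negP: not_core; apply: odd_mem_core Yy oddy.
  exact: Burnside_normal_complement sylVY sNC.
have [Yn NVn] := setIP Nn.
have sKY : K \subset Y.
  by apply: (four_emb_gen_norm sCY Yn _ ncn); rewrite in_setI NVn (subsetP sYM).
apply: (four_emb_max sKY sYM).
by apply: contra nKy => /subsetP; apply.
Qed.

(** The conjugates of [x0] generate [M], so one lies outside [K]; [t] and [s] cannot both invert it,
    as [t * s] would lie in its centralizer, of order 3. *)
Lemma four_emb_choose : exists g v, [/\ g \in M, v \in V, v != 1, x0 ^ g \notin K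
  & (x0 ^ g) ^ v != (x0 ^ g)^-1].
Proof.
have [g Mg nKg] : exists2 g, g \in M & x0 ^ g \notin K.
  apply/exists_inP; apply: contraT; rewrite negb_exists_in => /forall_inP sK.
  have sBK : <<x0 ^: M>> \subset K.
    rewrite gen_subG; apply/subsetP=> _ /imsetP[g Mg ->].
    by have := sK g Mg; rewrite negbK.
  have nsB : <<x0 ^: M>>%G <| M.
    by rewrite /normal (subset_trans sBK sKM) norms_gen // class_norm.
  have [_ simM'] := simpleP _ simM; have [B1 | BM] := simM' _ nsB.
    have : x0 \in <<x0 ^: M>> by rewrite mem_gen ?class_refl.
    rewrite [<<_>>]B1 => /set1P x1.
    by move: ox0; rewrite x1 order1.
  by case/negP: nKM; rewrite eqEsubset sKM /= -BM.
have cy : 'C_M[x0 ^ g] = <[x0 ^ g]> by rewrite cycleJ -cx0 conjIg cent1J conjGid.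
have [tv | tv] := eqVneq ((x0 ^ g) ^ t) (x0 ^ g)^-1; last by exists g, t.
have [sv | sv] := eqVneq ((x0 ^ g) ^ s) (x0 ^ g)^-1; last by exists g, s.
have : t * s \in <[x0 ^ g]>.
  rewrite -cy in_setI groupM //=; last exact: subsetP sVM s Vs.
  by rewrite cent1C mem_cent1E conjgM tv conjVg sv invgK.
have nts1 : t * s != 1.
  have [_ rs _ _ _] := dihV; apply: contra rs => /eqP tse.
  by rewrite -[s](mulKg t) tse mulg1 groupV.
move/order_dvdG; rewrite -orderE orderJ ox0.
by rewrite (four_order dihV ot (groupM Vt Vs) nts1).
Qed.

End FourEmbedded.

Lemma order3_cycle (gT : finGroupType) (x y : gT) :
  #[x] = 3 -> y \in <[x]> -> [\/ y = 1, y = x | y = x^-1].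
Proof.
move=> ox /cyclePmin[i]; rewrite ox => lti ->.
have xV : x^-1 = x ^+ 2 by rewrite invg_expg ox.
by rewrite xV; case: i lti => [|[|[|]]] // _; [constructor 1 | constructor 2 | constructor 3].
Qed.

(** * Generators of [L] when [M] has a strongly embedded subgroup *)

Section NormalFourEmbedded.

Variables (gT : finGroupType) (L D M : {group gT}) (r s t : gT).
Hypotheses (cL : odd_cyclic L) (sylD : 2.-Sylow(L) D) (dihD : dihedral_gens D r s).
Hypotheses (nsM : M <| L) (simM : simple M) (CM : 'C_L(M) = 1).
Let T := (D :&: M)%G.
Hypotheses (dihT : dihedral_gens T t s) (rtr : t \in <[r]>) (ot : #[t] = 2).

Variables (K : {group gT}) (x0 u : gT).
Hypotheses (sKM : K \subset M) (nKM : K :!=: M).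
Hypothesis centKV : forall i, i \in T -> #[i] = 2 -> 'C_M[i] \subset K.
Hypotheses (defK : K :=: 'N_M(T)) (defC : forall i, i \in T -> i != 1 -> 'C_M[i] = 'C_M(T)).
Hypotheses (Kx0 : x0 \in K) (ox0 : #[x0] = 3) (cx0 : 'C_M[x0] = <[x0]>).
Hypotheses (Mu : u \in M) (ou : #[u] = 2) (x0u : x0 ^ u = x0^-1).

Let srr' : <[t]> \subset <[r]>. Proof. by rewrite cycle_subG. Qed.
Let rt : t \in <[t]>. Proof. exact: cycle_id. Qed.
Let sDL : D \subset L. Proof. exact: pHall_sub sylD. Qed.
Let sML : M \subset L. Proof. exact: normal_sub nsM. Qed.
Let cM : odd_cyclic M. Proof. exact: odd_cyclicS sML cL. Qed.
Let sTD : T \subset D. Proof. exact: subsetIl. Qed.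
Let sTM : T \subset M. Proof. exact: subsetIr. Qed.
Let sylT : 2.-Sylow(M) T.
Proof. by have := Sylow_setI_normal nsM sylD; rewrite setIC. Qed.
Let Tt : t \in T. Proof. exact: dihedral_mem_r dihT. Qed.
Let Ts : s \in T. Proof. exact: dihedral_mem_s dihT. Qed.
Let Dr : r \in D. Proof. exact: dihedral_mem_r dihD. Qed.
Let nsTD : T <| D.
Proof. by rewrite /normal sTD normsI ?normG // (subset_trans sDL) ?normal_norm. Qed.
Let Mx0 : x0 \in M. Proof. exact: subsetP sKM x0 Kx0. Qed.
Let Lx0 : x0 \in L. Proof. exact: subsetP sML x0 Mx0. Qed.
Let Nx0 : x0 \in 'N(T). Proof. by move: Kx0; rewrite defK => /setIP[]. Qed.
Let oddx0 : odd #[x0]. Proof. by rewrite ox0. Qed.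
Let ncx0 : x0 \notin 'C(T). Proof. exact: (four_emb_notin sylT dihT ot ox0 cx0). Qed.

Local Notation R := 'O_2^'('C_L(T))%G.
Local Notation W := 'O_2^'('C_M(T))%G.

Let sRL : R \subset L. Proof. exact: subset_trans (pcore_sub _ _) (subsetIl _ _). Qed.
Let cRT : R \subset 'C(T). Proof. exact: subset_trans (pcore_sub _ _) (subsetIr _ _). Qed.
Let cR : odd_cyclic R. Proof. exact: odd_cyclicS sRL cL. Qed.
Let sWM : W \subset M. Proof. exact: subset_trans (pcore_sub _ _) (subsetIl _ _). Qed.
Let W_cyclic : cyclic W.
Proof. exact: (four_emb_core_cyclic cM simM sylT dihT ot defK Kx0 ox0 cx0). Qed.

Let nCM x : x \in L -> x \in 'N(T) -> x \in 'N('C_M(T)).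
Proof.
move=> Lx Nx; have nMx := subsetP (normal_norm nsM) x Lx.
by rewrite -cycle_subG normsI ?norms_cent // cycle_subG.
Qed.

Let nWx x : x \in L -> x \in 'N(T) -> x \in 'N(W).
Proof.
by move=> Lx Nx; rewrite -cycle_subG gFnorm_trans // cycle_subG nCM.
Qed.

Let nWR : R \subset 'N(W).
Proof.
apply/subsetP=> x Rx; apply: nWx; first exact: subsetP sRL x Rx.
exact: subsetP (cent_sub _) x (subsetP cRT x Rx).
Qed.

Let nRx0 : x0 \in 'N(R).
Proof.
rewrite -cycle_subG gFnorm_trans // normsI ?norms_cent ?cycle_subG //.
exact: subsetP (normG L) x0 Lx0.
Qed.

Let sRMW : R :&: M \subset W.
Proof.
apply: (odd_sub_core (cent_self_Hall sylT)); last exact: oddSg (subsetIl _ _) (odd_core _).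
by rewrite subsetI subsetIr (subset_trans (subsetIl _ _) cRT).
Qed.

(** Subgroups of order 3 of [L] are conjugate to [<[x0]>], so they lie in [M]; one in [R] would lie
    in [W], whose order is prime to 3. *)
Lemma nfe_R3 : ~~ (3 %| #|R|).
Proof.
apply/negP=> /(Cauchy (isT : prime 3))[b Rb ob].
have pb : prime #[b] by rewrite ob.
have oddb : odd #[b] by rewrite ob.
have [g Lg eb] := conj_cycle_prime cL pb oddb (subsetP sRL b Rb) Lx0 (etrans ox0 (esym ob)).
have Mb : b \in M.
  rewrite -cycle_subG eb -(normsP (normal_norm nsM) g Lg) conjSg cycle_subG.
  exact: Mx0.
case/negP: (four_emb_core3 cM simM sylT dihT ot); rewrite -ob order_dvdG //.
by apply: (subsetP sRMW); apply/setIP.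
Qed.

Let R_order x : x \in R -> coprime 3 #[x].
Proof.
move=> Rx; rewrite prime_coprime //; apply: contra nfe_R3 => d.
exact: dvdn_trans d (order_dvdG Rx).
Qed.

Lemma nfe_prod : R \subset W * 'C_R[x0].
Proof.
have nRx : <[x0]> \subset 'N(R) by rewrite cycle_subG.
have co : coprime #|R| #|<[x0]>|.
  by rewrite -orderE ox0 coprime_sym prime_coprime // nfe_R3.
rewrite -{1}(coprime_comm_cent_prod nRx co (odd_cyclic_sol (odd_core _) cR)) cent_cycle.
apply: mulSg; apply: subset_trans sRMW; rewrite subsetI commg_subl nRx /=.
have sxM : <[x0]> \subset M by rewrite cycle_subG.
by apply: subset_trans (commgSS sRL sxM) _; rewrite commg_subr normal_norm.
Qed.

(* [~ h, u] centralises x0, so it is a power of x0; it is trivial because the order of h is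
   prime to 3, and h centralises M = K <*> <[u]>. *)
Lemma nfe_faithful h : h \in 'C_R[x0] -> h \in 'C(W) -> h = 1.
Proof.
case/setIP=> Rh /cent1P cxh cWh; have Lh := subsetP sRL h Rh.
have xh : x0 ^ h = x0 by apply: commute_conjg.
have Mhu : [~ h, u] \in M.
  rewrite commgEr groupM // memJ_norm ?groupV //.
  exact: subsetP (normal_norm nsM) h Lh.
have x0u' : x0 = (x0^-1) ^ u by rewrite conjVg x0u invgK.
have xhu : x0 ^ (h ^ u) = x0.
  by rewrite {1}x0u' -conjJg conjVg xh.
have ahx : [~ h, u] \in <[x0]>.
  by rewrite -cx0 in_setI Mhu cent1C mem_cent1E commgEl conjgM -{1}xh conjgK xhu eqxx.
have cah : commute h [~ h, u].
  by have /cycleP[n ->] := ahx; apply: commuteX; apply: commute_sym.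
have a1 : [~ h, u] = 1.
  apply/eqP; rewrite -order_eq1 -dvdn1.
  have /eqP <- : coprime 3 #[h] := R_order Rh.
  rewrite dvdn_gcd -{1}ox0 order_dvdG //= order_dvdn.
  have := expg_order (h ^ u); rewrite orderJ -[h ^ u](mulKVg h) -commgEl.
  by rewrite expgMn // expg_order mul1g => ->.
have cKh : K \subset 'C_M[h].
  apply: (four_emb_gen_norm sylT dihT ot defK (n := x0)) => //.
  - rewrite -(four_emb_cent_prod sylT dihT ot) mul_subG //.
      by rewrite subsetI sWM sub_cent1.
    by rewrite subsetI sTM sub_cent1 (subsetP cRT).
  - by rewrite in_setI Mx0; apply/cent1P.
  by rewrite -defK.
apply/set1P; rewrite -[[set 1]]CM in_setI Lh -sub_cent1.
rewrite -(four_emb_join cM simM sylT dihT ot sKM centKV defK Kx0 ox0 cx0 Mu ou x0u).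
rewrite join_subG (subset_trans cKh) ?subsetIr //= cycle_subG cent1C mem_cent1E.
by apply/eqP/conjg_fixP/eqP.
Qed.

(** By [nfe_faithful] this group acts faithfully on the cyclic [W], so it is abelian, with cyclic
    Sylow subgroups. *)
Lemma nfe_cyclic : cyclic 'C_R[x0].
Proof.
have sCR : 'C_R[x0] \subset R := subsetIl _ _.
have abC : abelian 'C_R[x0].
  apply/commG1P/trivgP/subsetP=> h Ch; apply/set1P/nfe_faithful.
    by apply: subsetP Ch; rewrite commg_subl normG.
  have nWC : 'C_R[x0] \subset 'N(W) := subset_trans sCR nWR.
  exact: (subsetP (comm_norm_cyclic_cent W_cyclic nWC nWC)).
have cC : odd_cyclic ('C_R[x0])%G := odd_cyclicS sCR cR.
exact: nil_Zgroup_cyclic (odd_cyclic_Zgroup (oddSg sCR (odd_core _)) cC) (abelian_nil abC).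
Qed.

Let gen_L (X : {group gT}) : M \subset X -> R \subset X -> r \in X -> L \subset X.
Proof. exact: (ns_gen cL sylD dihD nsM simM dihT srr' rt ot). Qed.

(** [b = x0 * c] with [c] generating ['C_R[x0]]: one element has to yield both [x0] and what [L] has
    beyond [M]. *)
Lemma nfe_full : D \subset M -> exists b, [/\ b \in L, x0 \in <[b]>
  & forall X : {group gT}, M \subset X -> b \in X -> L \subset X].
Proof.
move=> sDM; have /cyclicP[c defc] := nfe_cyclic.
have /setIP[Rc /cent1P/commute_sym cxc] : c \in 'C_R[x0] by rewrite defc cycle_id.
exists (x0 * c); have co : coprime #[x0] #[c] by rewrite ox0 R_order.
have [x0b _] := coprime_mul_mem (X := <[x0 * c]>) cxc co (cycle_id _).
split; rewrite // ?groupM //; first exact: subsetP sRL c Rc.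
move=> X sMX Xb; apply: gen_L => //; last exact: subsetP (subset_trans sDM sMX) r Dr.
apply: subset_trans nfe_prod _; rewrite mul_subG ?(subset_trans sWM) //.
by rewrite defc cycle_subG -(groupMl _ (subsetP sMX x0 Mx0)).
Qed.

(** A Frattini argument on the Sylow 3-subgroup [<[x0]>] of [K] corrects [r] to normalize it, and a
    power of [x0] makes the correction centralize [T]. *)
Lemma nfe_inverting : r * r = t -> r \notin M ->
  exists2 r', x0 ^ r' = x0^-1 & exists2 c, c \in 'C_M(T) & r = c * r'.
Proof.
move=> rr Mr; have Lr := subsetP sDL r Dr.
have NTr : r \in 'N(T) := subsetP (normal_norm nsTD) r Dr.
have nsK : K <| 'N_L(T).
  rewrite defK /normal setSI // normsI //; last exact: subset_trans (subsetIr _ _) (normG _).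
  by apply: subset_trans (subsetIl _ _) (normal_norm nsM).
have tx : 3.-group <[x0]> by rewrite /pgroup -orderE ox0.
have sxK : <[x0]> \subset K by rewrite cycle_subG.
have [P sylP sxP] := Sylow_superset sxK tx.
have [sPK tP _] := and3P sylP; have sPM := subset_trans sPK sKM.
have defP : P :=: <[x0]>.
  apply/eqP; rewrite eqEsubset sxP andbT -cx0 subsetI sPM /= -cent_cycle.
  apply: subset_trans (centS sxP); apply: cyclic_abelian.
  exact: cM (isT : odd 3) sPM tP.
have : r \in 'N_L(T) by rewrite in_setI Lr.
rewrite -(Frattini_arg nsK sylP) => /mulsgP[k r1 Kk /setIP[/setIP[Lr1 NTr1] NPr1] def_r].
have Nk : k \in 'N_M(T) by rewrite -defK.
have Nx : x0 \in 'N_M(T) by rewrite -defK.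
have [z xz cz] := four_emb_mod sylT dihT ot Nx ncx0 Nk.
have [_ czT] := setIP cz.
exists (z^-1 * r1); last by exists (k * z); rewrite // def_r mulgA mulgK.
have zx : x0 ^ z^-1 = x0.
  apply: commute_conjg; have /cycleP[n ->] := xz.
  exact: commuteV (commuteX _ (commute_refl _)).
have xr1 : x0 ^ (z^-1 * r1) \in <[x0]>.
  by rewrite conjgM zx -defP memJ_norm // defP cycle_id.
have actr i : i \in T -> i ^ (z^-1 * r1) = i ^ r.
  move=> Ti; rewrite def_r !conjgM; congr (_ ^ _); rewrite -[i ^ k](conjgK z) -(conjgM i k z).
  by congr (_ ^ _); apply/esym/commute_conjg/commute_sym/(centP czT).
have nt1 : t != 1 by rewrite -order_eq1 ot.
case: (order3_cycle ox0 xr1) => // xr.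
  by move/eqP: xr; rewrite conjg_eq1 -order_eq1 ox0.
(* If [r'] centralized [x0], then [r] would fix [t] and [t ^ x0], hence all of [T], whereas
   [s ^ r = s * t]. *)
have tr : t ^ r = t by rewrite -rr conjMg !(commute_conjg (commute_refl r)).
have Ttx : t ^ x0 \in T by rewrite memJ_norm.
have txr : (t ^ x0) ^ r = t ^ x0 by rewrite -actr // conjJg xr actr // tr.
have nttx : t != t ^ x0.
  by rewrite eq_sym (four_no_fix dihT ot Nx0 oddx0 ncx0 Tt nt1).
have ntx : t ^ x0 != 1 by rewrite conjg_eq1.
have /centP/(_ s Ts) crs := four_fix2 dihT ot Tt Ttx nt1 ntx nttx tr txr.
have sr : s ^ r = s * (r * r) by apply: (dihedral_conj_rot dihD); apply: cycle_id.
case/negP: nt1; rewrite -rr -(mulKg s (r * r)) -sr.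
by rewrite (commute_conjg (commute_sym crs)) mulVg.
Qed.

(** [x0 = [~ x0, r']] acts trivially on the cyclic [W = [~: W, <[x0]>]], so [W] and then [R] are
    trivial. Now [f = r' * u] centralizes [x0] and its square lies in [<[x0]>], so [f] or [f * x0]
    has both [f] and [x0] among its powers. *)
Lemma nfe_half : r * r = t -> r \notin M -> exists b, [/\ b \in L, x0 \in <[b]>
  & forall X : {group gT}, M \subset X -> b \in X -> L \subset X].
Proof.
move=> rr Mr; have Lr := subsetP sDL r Dr.
have [r' xr' [c /setIP[Mc cTc] def_r]] := nfe_inverting rr Mr.
have Lc := subsetP sML c Mc.
have def_r' : r' = c^-1 * r by rewrite def_r mulKg.
have Lr' : r' \in L by rewrite def_r' groupM ?groupV.
have NTr : r \in 'N(T) := subsetP (normal_norm nsTD) r Dr.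
have NTr' : r' \in 'N(T).
  by rewrite def_r' groupM ?groupV // (subsetP (cent_sub _)).
have W1 : W :=: 1.
  have cxW : x0 \in 'C(W).
    have nWc y : y \in L -> y \in 'N(T) -> <[y]> \subset 'N(W).
      by move=> Ly Ny; rewrite cycle_subG nWx.
    have := comm_norm_cyclic_cent W_cyclic (nWc _ Lx0 Nx0) (nWc _ Lr' NTr').
    have x3 : x0 ^+ 3 = 1 by rewrite -ox0 expg_order.
    have xV : x0^-1 = x0 ^+ 2 by rewrite invg_expg ox0.
    have def_x0 : [~ x0, r'] = x0 by rewrite commgEl xr' xV -expgD (expgD _ 3 1) x3 mul1g.
    by move/subsetP; apply; rewrite -{1}def_x0 mem_commg ?cycle_id.
  rewrite /= -(four_emb_core_comm cM simM sylT dihT ot defK Kx0 ox0 cx0).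
  by apply/commG1P; rewrite centsC cycle_subG.
have R1 : R :=: 1.
  apply/trivgP/subsetP=> h Rh; apply/set1P/nfe_faithful; last by rewrite W1 -sub_cent1 sub1G.
  by apply: subsetP Rh; apply: subset_trans nfe_prod _; rewrite W1 mul1g.
pose f := r' * u; have Lf : f \in L by rewrite groupM // (subsetP sML).
have xf : x0 ^ f = x0 by rewrite conjgM xr' conjVg x0u invgK.
have Mr' : r' \notin M by rewrite def_r' groupMl ?groupV.
have Mf : f \notin M by rewrite groupMr.
have nMx x : x \in L -> x \in 'N(M) by apply: subsetP; apply: normal_norm.
have Mff : f * f \in M.
  have -> : f * f = r' * r' * (u ^ r' * u) by rewrite conjgE /f !mulgA mulgK.
  apply: groupM; last by rewrite groupM // memJ_norm ?nMx.
  have -> : r' * r' = c^-1 * (c^-1 ^ r^-1) * (r * r).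
    by rewrite def_r' conjgE invgK !mulgA mulgKV.
  rewrite rr; apply: groupM (subsetP sTM t Tt); apply: groupM; first by rewrite groupV.
  by rewrite memJ_norm groupV ?nMx.
have ffx : f * f \in <[x0]>.
  by rewrite -cx0 in_setI Mff /= cent1C mem_cent1E conjgM !xf.
suff [b [Lb xb fb]] : exists b, [/\ b \in L, x0 \in <[b]> & f \in <[b]>].
  exists b; split=> // X sMX Xb; have Xu := subsetP sMX u Mu.
  have Xf : f \in X by apply: subsetP fb; rewrite cycle_subG.
  apply: gen_L; rewrite //= ?R1 ?sub1G // def_r.
  by apply: groupM; [apply: (subsetP sMX) | rewrite -(groupMr _ Xu)].
have cfx : commute f x0 by apply/commute_sym/commgP/conjg_fixP.
have nf1 : f != 1 by apply: contra Mf => /eqP->; apply: group1.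
have [ff1 | nff] := eqVneq (f * f) 1.
  have off := order2P nf1 ff1; exists (f * x0); rewrite groupM //.
  have co : coprime #[f] #[x0] by rewrite off ox0.
  by have [-> ->] := coprime_mul_mem (X := <[f * x0]>) cfx co (cycle_id _).
exists f; rewrite Lf cycle_id; split=> //.
case: (order3_cycle ox0 ffx) => ffe; first by rewrite ffe eqxx in nff.
  by rewrite -ffe (groupX 2) ?cycle_id.
by rewrite -[x0]invgK -ffe groupV (groupX 2) ?cycle_id.
Qed.

(** The generators are [v * w], where [w] generates [W], and a conjugate of [b] chosen so that
    [x0 ^ g] meets the requirements of [four_emb_gen]. *)
Lemma nfe_grank : D \subset M \/ r * r = t /\ r \notin M -> 'm(L) <= 2.
Proof.
move=> caseD.
have [b [Lb xb genb]] : exists b, [/\ b \in L, x0 \in <[b]>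
  & forall X : {group gT}, M \subset X -> b \in X -> L \subset X].
  by case: caseD => [| []]; [apply: nfe_full | apply: nfe_half].
have [g [v [Mg Tv nv nKy yv]]] := four_emb_choose simM sylT dihT ot sKM nKM ox0 cx0.
have [w defW] := cyclicP W_cyclic.
have Ww : w \in W by rewrite /= defW cycle_id.
have Mw := subsetP sWM w Ww; have Mv := subsetP sTM v Tv.
have ov := four_order dihT ot Tv nv.
have cvw : commute v w.
  have /setIP[_ /centP/(_ v Tv) c] := subsetP (pcore_sub _ _) w Ww.
  exact: commute_sym.
have co : coprime #[v] #[w].
  by rewrite ov coprime_sym coprime2 // (dvdn_odd (order_dvdG Ww)) // odd_core.
pose X := <<[set (v * w)%g; (b ^ g)%g]>>%G.
have Xvw : v * w \in X by rewrite mem_gen // set21.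
have Xb : b ^ g \in X by rewrite mem_gen // set22.
have [Xv Xw] := coprime_mul_mem cvw co Xvw.
have Xy : x0 ^ g \in X.
  have : x0 ^ g \in <[b ^ g]> by rewrite cycleJ memJ_conjg.
  by apply: subsetP; rewrite cycle_subG.
have defXM : X :&: M = M.
  apply: (four_emb_gen cM simM sylT dihT ot centKV defK defC Kx0 ox0 cx0
    (Y := (X :&: M)%G) (v := v) (y := x0 ^ g)) => //.
  - exact: subsetIr.
  - by rewrite in_setI Xv.
  - by rewrite defW cycle_subG in_setI Xw.
  - by rewrite in_setI Xy groupJ.
  by rewrite orderJ.
have sMX : M \subset X by rewrite -defXM subsetIl.
have sXL : X \subset L.
  by rewrite gen_subG subUset !sub1set groupJ // (subsetP sML) // groupM.
apply/grank2P; exists (v * w), (b ^ g); split.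
- exact: subsetP sXL _ Xvw.
- exact: subsetP sXL _ Xb.
apply/eqP; rewrite eqEsubset; apply/andP; split; first exact: sXL.
apply: (genb _ sMX); rewrite -(conjgK g b) groupJ ?groupV //.
exact: subsetP sMX g Mg.
Qed.

End NormalFourEmbedded.

Lemma normal_simple_grank (gT : finGroupType) (L D M : {group gT}) r s0 :
    odd_cyclic L -> 2.-Sylow(L) D -> dihedral_gens D r s0 -> M <| L -> simple M ->
    'C_L(M) = 1 -> ~~ cyclic (D :&: M) ->
  'm(L) <= 2.
Proof.
move=> cL sylD dihD0 nsM simM CM ncT; have [sDL tD _] := and3P sylD.
have sML := normal_sub nsM; have cM := odd_cyclicS sML cL.
have [s [r' [dihD Ms dihT caseD]]] := dihedral_normal_inter tD dihD0 sDL nsM ncT.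
have sylT : 2.-Sylow(M) (D :&: M)%G.
  by have := Sylow_setI_normal nsM sylD; rewrite setIC.
have tT : 2.-group (D :&: M)%G := pHall_pgroup sylT.
have [t rt ot] := dihedral_involution tT dihT.
have srr' : <[r']> \subset <[r]>.
  by case: caseD => -[->] // _; rewrite cycle_subG mem_cycle.
have [r_gt2 | r_le2] := ltnP 2 #[r'].
  have nose := dihedral8_no_strongly_embedded cM simM sylT dihT rt ot r_gt2.
  case: caseD => -[def_r].
    exact: (ns_gen_full cL sylD dihD nsM simM CM dihT srr' rt ot nose r_gt2 def_r).
  by move=> _; apply: (ns_gen_half cL sylD dihD nsM simM CM dihT srr' rt ot nose r_gt2 def_r).
have or' : #[r'] = 2.
  have [_ _ _ ev _] := dihT; apply/eqP; rewrite eqn_leq r_le2.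
  by rewrite dvdn_leq ?order_gt0.
have def_t := dihedral_involution_rot (cycle_id r') rt or' ot.
rewrite {}def_t in dihT srr' caseD {rt or' r_le2}.
have rtr : t \in <[r]> by rewrite -cycle_subG.
have [/existsP[K0 /and3P[sK0 nK0 /forall_inP cK0]] | nK0] := boolP [exists K0 : {group gT},
    [&& K0 \subset M, K0 :!=: M
      & [forall i in D :&: M, (#[i] == 2) ==> ('C_M[i] \subset K0)]]]; last first.
  apply: (ns_gen_four cL sylD dihD nsM simM CM dihT rtr ot).
    case: caseD => -[def_r _]; [left | by right].
    by rewrite -def_r involution_mulK.
  move=> K sKM cK; apply/eqP; apply: contraR nK0 => nKM; apply/existsP; exists K.
  rewrite sKM nKM; apply/forall_inP=> i Ti; apply/implyP=> /eqP oi.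
  exact: cK.
have centK0 i : i \in (D :&: M)%G -> #[i] = 2 -> 'C_M[i] \subset K0.
  by move=> Ti oi; apply: (implyP (cK0 i Ti)); rewrite oi.
have [K [x [[sKM nKM centK] Kx Nx ox ncx]]] :=
  four_embedding simM sylT dihT ot sK0 nK0 centK0.
have [defK defC [x0 [u [Kx0 ox0 cx0 Mu [ou x0u]]]]] :=
  four_strongly_embedded cM simM sylT dihT ot sKM nKM centK Kx Nx ox ncx.
apply: (nfe_grank cL sylD dihD nsM simM CM dihT rtr ot sKM nKM centK defK defC
  Kx0 ox0 cx0 Mu ou x0u).
by case: caseD => -[def_r ?]; [left | right].
Qed.

(** * From abelian subgroups to odd Sylow subgroups and involutions *)

Section CyclicAbelianSubgroups.

Variables (gT : finGroupType) (G : {group gT}).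
Hypothesis cycG : forall A : {group gT}, A \subset G -> abelian A -> cyclic A.

(** For odd [p] a noncyclic [p]-group has an elementary abelian subgroup of rank 2; quaternion
    groups show that this fails for [p = 2]. *)
Lemma cyclic_abelian_odd_cyclic : odd_cyclic G.
Proof.
move=> p P op sPG pP.
have oP : odd #|P|.
  rewrite odd_2'nat; apply: sub_in_pnat pP => q _ /eqnP->.
  by rewrite !inE; apply: contraTneq op => ->.
rewrite (odd_pgroup_rank1_cyclic pP oP) leqNgt; apply/negP=> /p_rank_geP[E].
case/pnElemP=> sEP abE dimE; have := cycG (subset_trans sEP sPG) (abelem_abelian abE).
by rewrite (abelem_cyclic abE) dimE.
Qed.

Lemma cyclic_abelian_involutions : commuting_involutions_eq G.
Proof.
move=> s t Gs Gt os ot cst; apply/eqP; apply: contraT => nst.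
case/negP: (klein_noncyclic os ot nst).
by apply: cycG; [rewrite join_subG !cycle_subG Gs | apply: klein_abelian].
Qed.

End CyclicAbelianSubgroups.

(* 'm(G), MathComp's gen_rank, is the minimal cardinality of a generating set of G. *)
Theorem theorem2p4 (gT : finGroupType) (G : {group gT})
    (cycG : forall A : {group gT}, A \subset G -> abelian A -> cyclic A) :
  ('m(G)%g <= 2)%N.
Proof.
apply: reduce_to_dihedral (cyclic_abelian_odd_cyclic cycG) (cyclic_abelian_involutions cycG).
move=> rT L D r s cL O1 sylD dihD; apply: (dihedral_reduction O1 sylD dihD).
by move=> M nsM simM CM ncT; apply: (normal_simple_grank cL sylD dihD nsM simM CM ncT).
Qed.
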